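(* Let $\mathcal D$ be a Hermann foliation on $M$ that admits a universal Lie $\infty$-algebroid structure $(E,Q)$ with anchor $\rho$. Assume that its associated resolution is of finite length. Then the vector bundle of finite rank over $M$ given by $L=\big(S(E^* )\otimes E\big)_{-1}$ (the degree $-1$ component) comes equipped with a Leibniz algebroid structure, with Leibniz bracket defined by $$[X,Y]_L:=\big[[Q,X],Y\big]$$ for all $X,Y\in\Gamma(L)$ (identified with vertical vector fields $\partial_X$ and $\partial_Y$ of degree $-1$ on the graded manifold $E$), and with anchor given by the composition $$E_{-1}\oplus\bigoplus_{k\ge1}\big(S^k(E^* )\otimes E\big)_{-1}\longrightarrow E_{-1}\xrightarrow{\ \rho\ }TM,$$ where the first map is the projection.
   Context: Let $\mathscr O$ be the sheaf of functions on $M$ (smooth, real analytic or holomorphic), $\mathfrak X$ the sheaf of vector fields, $\Gamma(\cdot)$ sheaves of sections. Hermann foliation: a sub-sheaf $\mathcal D\subset\mathfrak X$, locally finitely generated over $\mathscr O$ and closed under the Lie bracket. Lie $\infty$-algebroid $(E,Q)$ over $M$: a sequence $E=(E_{-i})_{i\ge1}$ of finite-rank vector bundles over $M$ ($E_{-i}$ in degree $-i$) and a degree $+1$ derivation $Q$, $Q^2=0$, of the sheaf of graded commutative algebras $\mathscr E=\Gamma(S(E^* ))$ (sections of $E_{-i}^*$ have degree $i$). Elements of $\Gamma(S^n(E^* ))$ have arity $n$; $Q^{(0)}$ is the arity-preserving component. Anchor $\rho:E_{-1}\to TM$: $\langle Q[f],x\rangle=\rho(x)[f]$. Linear part: $\mathrm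 d^{(i)}:E_{-i}\to E_{-i+1}$ ($i\ge2$), $\langle Q^{(0)}[\alpha],x\rangle=(-1)^{i-1}\langle\alpha,\mathrm d^{(i)}x\rangle$. $(E,Q)$ is universal resolving $\mathcal D$ if $\rho(\Gamma(E_{-1}))=\mathcal D$ and $\cdots\to\Gamma(E_{-2})\xrightarrow{\mathrm d^{(2)}}\Gamma(E_{-1})\xrightarrow{\rho}\mathcal D\to0$ is an exact sequence of sheaves (the associated resolution); it has finite length if $E_{-i}=0$ for $i$ large. Vector fields on $E$ are derivations of $\mathscr E$, with graded commutator bracket $[\cdot,\cdot]$; vertical vector fields are the $\mathscr O$-linear ones. A section $P\otimes e$ of $S(E^* )\otimes E$ is identified with the vertical vector field $P\,\partial_e$, where $\partial_e$ is the $\mathscr O$-linear derivation with $\partial_e[\xi]=\langle\xi,e\rangle$ for $\xi\in\Gamma(E^* )$. Leibniz algebroid over $M$: a vector bundle $L\to M$ with an anchor, i.e. a vector bundle morphism $\eta:L\to TM$, and a bilinear bracket on $\Gamma(L)$ satisfying the Leibniz (Loday) identity $[X,[Y,Z]]=[[X,Y],Z]+[Y,[X,Z]]$ and $[X,fY]=f[X,Y]+\eta(X)[f]\,Y$ for $f\in\mathscr O$ (the bracket need not be skew-symmetric). *)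

(* Defs.v *)
From Stdlib Require List.
From HB Require Import structures.
From mathcomp Require Import all_boot all_order all_algebra.
From mathcomp Require Import all_classical all_reals all_analysis.
From mathcomp Require Import complex.

Set Implicit Arguments.
Unset Strict Implicit.
Unset Printing Implicit Defensive.

Import Order.TTheory GRing.Theory Num.Theory.
Import numFieldNormedType.Exports.

Local Open Scope classical_set_scope.
Local Open Scope ring_scope.

(* Convention.  A section over an open set U of a family of vector spaces F
   over M is represented by a total family [s : forall x, F x] of which only
   the values on U matter: "s = t as sections over U" is [agree U s t], and
   restriction to a smaller open set leaves the representative unchanged.
   A sheaf operator is accordingly a family indexed by open sets which only
   depends on the values of its argument on the open set and commutes with
   restriction. *)

Inductive funclass := Smooth | Analytic | Holomorphic.

Definition base_field (R : realType) (c : funclass) : numFieldType :=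
  if c is Holomorphic then (R[i] : numFieldType) else R.

Section FunctionClasses.
Variables (K : numFieldType) (n : nat).
Implicit Types (W : set 'rV[K]_n) (f : 'rV[K]_n -> K).

Fixpoint Ck_on (k : nat) W f : Prop :=
  (forall x, W x -> {for x, continuous f}) /\
  if k is k'.+1 then
    forall i : 'I_n, (forall x, W x -> derivable f x (delta_mx 0 i)) /\
                     Ck_on k' W (fun x => 'D_(delta_mx 0 i) f x)
  else True.

Definition smooth_on W f : Prop := forall k, Ck_on k W f.

Definition pseries_term (c : {ffun 'I_n -> nat} -> K) (h : 'rV[K]_n) (k : nat)
    : K :=
  \sum_(a : {ffun 'I_n -> 'I_k.+1} | (\sum_i (a i : nat))%N == k)
     c [ffun i => a i : nat] * \prod_i h 0 i ^+ a i.

(* Near every point, f is the sum of an absolutely convergent power series. *)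
Definition analytic_on W f : Prop :=
  forall x, W x -> exists (c : {ffun 'I_n -> nat} -> K) (r : K), 0 < r /\
    forall h : 'rV[K]_n, (forall i, `|h 0 i| < r) ->
      cvgn (series (pseries_term (fun a => `|c a|) (\row_i `|h 0 i|))) /\
      series (pseries_term c h) @ \oo --> f (x + h).

(* Over K = R[i], [differentiable] is complex (Frechet) differentiability. *)
Definition holomorphic_on W f : Prop := forall x, W x -> differentiable f x.

Definition regular (c : funclass) W f : Prop :=
  match c with
  | Smooth => smooth_on W f
  | Analytic => analytic_on W f
  | Holomorphic => holomorphic_on W f
  end.

End FunctionClasses.

Record manifold (R : realType) (c : funclass) := Manifold {
  carrier :> topologicalType;
  mdim : nat;
  atlas : Type;
  cdom : atlas -> set carrier;
  cmap : atlas -> carrier -> 'rV[base_field R c]_mdim;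
  cinv : atlas -> 'rV[base_field R c]_mdim -> carrier;
  mf_hausdorff : hausdorff_space carrier;
  mf_countable : @second_countable carrier;
  cdom_open : forall a, open (cdom a);
  cdom_cover : forall x, exists a, cdom a x;
  cimg_open : forall a, open (cmap a @` cdom a);
  cmapK : forall a x, cdom a x -> cinv a (cmap a x) = x;
  cmap_continuous : forall a x, cdom a x -> {for x, continuous (cmap a)};
  cinv_continuous : forall a y, (cmap a @` cdom a) y ->
    {for y, continuous (cinv a)};
  transition_regular : forall a b i,
    regular c (cmap a @` (cdom a `&` cdom b))
      (fun y => cmap b (cinv a y) 0 i) }.

Section DependentFunctions.
Variables (K : numFieldType) (T : Type) (F : T -> lmodType K).

Definition dprod := forall t, F t.

HB.instance Definition _ := gen_eqMixin dprod.
HB.instance Definition _ := gen_choiceMixin dprod.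

Implicit Types f g h : dprod.

Definition dprod_zero : dprod := fun=> 0.
Definition dprod_add f g : dprod := fun t => f t + g t.
Definition dprod_opp f : dprod := fun t => - f t.
Definition dprod_scale (a : K) f : dprod := fun t => a *: f t.

Lemma dprod_addA : associative dprod_add.
Proof. by move=> f g h; apply: functional_extensionality_dep => t; exact: addrA. Qed.
Lemma dprod_addC : commutative dprod_add.
Proof. by move=> f g; apply: functional_extensionality_dep => t; exact: addrC. Qed.
Lemma dprod_add0 : left_id dprod_zero dprod_add.
Proof. by move=> f; apply: functional_extensionality_dep => t; exact: add0r. Qed.
Lemma dprod_addN : left_inverse dprod_zero dprod_opp dprod_add.
Proof. by move=> f; apply: functional_extensionality_dep => t; exact: addNr. Qed.

HB.instance Definition _ := GRing.isZmodule.Build dprod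
  dprod_addA dprod_addC dprod_add0 dprod_addN.

Lemma dprod_scaleA a b f :
  dprod_scale a (dprod_scale b f) = dprod_scale (a * b) f.
Proof. by apply: functional_extensionality_dep => t; exact: scalerA. Qed.
Lemma dprod_scale1 : left_id 1 dprod_scale.
Proof. by move=> f; apply: functional_extensionality_dep => t; exact: scale1r. Qed.
Lemma dprod_scaleDr : right_distributive dprod_scale +%R.
Proof. by move=> a f g; apply: functional_extensionality_dep => t; exact: scalerDr. Qed.
Lemma dprod_scaleDl f : {morph dprod_scale^~ f : a b / a + b}.
Proof. by move=> a b; apply: functional_extensionality_dep => t; exact: scalerDl. Qed.

HB.instance Definition _ := GRing.Zmodule_isLmodule.Build K dprod
  dprod_scaleA dprod_scale1 dprod_scaleDr dprod_scaleDl.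

End DependentFunctions.

Section Geometry.
Variables (R : realType) (c : funclass) (M : manifold R c).
Local Notation K := (base_field R c).

Definition functions (U : set M) (f : M -> K) : Prop :=
  forall a : atlas M,
    regular c (cmap a @` (cdom a `&` U)) (fun y => f (cinv a y)).

Definition agree (F : M -> Type) (U : set M) (s t : forall x, F x) : Prop :=
  forall x, U x -> s x = t x.

Definition locally (P : set M -> Prop) (U : set M) : Prop :=
  forall x, U x -> exists V, [/\ open V, V x, V `<=` U & P V].

(* A vector bundle is given by its fibres together with its sheaf of regular
   sections: around each point there is a frame, i.e. a family of sections
   forming a basis of every fibre, such that the regular sections are those
   with coefficients in the sheaf of functions. *)
Record is_vbundle (fib : M -> lmodType K)
    (reg : set M -> (forall x, fib x) -> Prop) : Prop := IsVBundle {
  vb_restrict : forall U V s, open U -> open V -> V `<=` U -> reg U s -> reg V s;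
  vb_glue : forall U s, open U -> locally (fun V => reg V s) U -> reg U s;
  vb_frame : forall x0, exists U (r : nat) (e : 'I_r -> forall x, fib x),
    [/\ open U, U x0,
        forall x, U x -> forall v : fib x,
          exists! a : 'rV[K]_r, v = \sum_j a 0 j *: e j x
      & forall V s, open V -> V `<=` U ->
          (reg V s <-> exists a : 'I_r -> M -> K,
             (forall j, functions V (a j)) /\
             agree V s (fun x => \sum_j a j x *: e j x))] }.

Record vbundle := VBundle {
  fib :> M -> lmodType K;
  reg : set M -> (forall x, fib x) -> Prop;
  vbundleP : is_vbundle reg }.

(* Also used when the target is the tangent bundle, whose regular sections
   are the vector fields. *)
Definition bundle_morphism (A B : M -> lmodType K)
    (regA : set M -> (forall x, A x) -> Prop)
    (regB : set M -> (forall x, B x) -> Prop)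
    (phi : forall x, A x -> B x) : Prop :=
  (forall x, linear (phi x)) /\
  (forall U s, open U -> regA U s -> regB U (fun x => phi x (s x))).

Definition regular_at (x : M) (f : M -> K) : Prop :=
  exists U, [/\ open U, U x & functions U f].

(* The tangent space at x consists of the derivations at x of germs of
   functions; they are represented on total functions, with value 0 on
   functions that are not regular near x, so as to have equality. *)
Definition tangent_axiom (x : M) (v : (M -> K) -> K^o) : Prop :=
  [/\ forall f g U, regular_at x f -> open U -> U x -> agree U f g -> v f = v g,
      forall a f g, regular_at x f -> regular_at x g ->
        v (fun y => a * f y + g y) = a * v f + v g,
      forall f g, regular_at x f -> regular_at x g ->
        v (fun y => f y * g y) = f x * v g + v f * g x
    & forall f, ~ regular_at x f -> v f = 0].

Definition tangent_pred (x : M) : {pred (M -> K) -> K^o} :=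
  fun v => `[< tangent_axiom x v >].

Fact tangent_submod (x : M) : submod_closed (tangent_pred x).
Proof.
split.
  by apply/asboolP; split=> //= *; rewrite /GRing.zero /= ?mulr0 ?mul0r ?addr0.
move=> a u v /asboolP[u1 u2 u3 u4] /asboolP[v1 v2 v3 v4]; apply/asboolP.
have E f : (a *: u + v) f = a * u f + v f :> K by [].
split=> [f g U rf oU Ux fg|b f g rf rg|f g rf rg|f rf]; rewrite !E.
- by rewrite (u1 f g U) // (v1 f g U).
- by rewrite u2 // v2 // !mulrDr !mulrA (mulrC a b) -!addrA; congr (_ + _);
    rewrite addrCA.
- rewrite u3 // v3 // !mulrDr !mulrDl !mulrA (mulrC a (f x)) -!addrA.
  by congr (_ + _); rewrite addrCA.
- by rewrite u4 // v4 // mulr0 addr0.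
Qed.

HB.instance Definition _ (x : M) := GRing.isSubmodClosed.Build K
  ((M -> K) -> K^o) (tangent_pred x) (tangent_submod x).

Record tangent (x : M) := Tangent {
  tval :> (M -> K) -> K^o;
  _ : tval \in tangent_pred x }.

HB.instance Definition _ (x : M) := [isSub for @tval x].
HB.instance Definition _ (x : M) := [Choice of tangent x by <:].
HB.instance Definition _ (x : M) :=
  [SubChoice_isSubLmodule of tangent x by <:].

Definition vfield (U : set M) (X : forall x, tangent x) : Prop :=
  forall V f, open V -> V `<=` U -> functions V f ->
    functions V (fun x => X x f).

Definition is_lie_bracket (U : set M) (X Y Z : forall x, tangent x) : Prop :=
  forall V f, open V -> V `<=` U -> functions V f ->
    agree V (fun x => Z x f)
      (fun x => X x (fun y => Y y f) - Y x (fun y => X y f)).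

(* Sub-sheaves of O-modules of the sheaf of vector fields which are locally
   finitely generated (finitely many sections over a neighbourhood generate
   the sheaf there) and involutive. *)
Record hermann_foliation (D : set M -> (forall x, tangent x) -> Prop) : Prop :=
  HermannFoliation {
  hf_vfield : forall U X, open U -> D U X -> vfield U X;
  hf_agree : forall U X Y, open U -> agree U X Y -> D U X -> D U Y;
  hf_restrict : forall U V X, open U -> open V -> V `<=` U -> D U X -> D V X;
  hf_glue : forall U X, open U -> locally (fun V => D V X) U -> D U X;
  hf_zero : forall U, open U -> D U (fun=> 0);
  hf_linear : forall U f X Y, open U -> functions U f -> D U X -> D U Y ->
    D U (fun x => f x *: X x + Y x);
  hf_fingen : forall x0, exists U (r : nat) (G : 'I_r -> forall x, tangent x),
    [/\ open U, U x0, forall j, D U (G j)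
      & forall V X, open V -> V `<=` U -> D V X ->
          locally (fun W => exists a : 'I_r -> M -> K,
            (forall j, functions W (a j)) /\
            agree W X (fun x => \sum_j a j x *: G j x)) V];
  hf_involutive : forall U X Y Z, open U -> D U X -> D U Y -> vfield U Z ->
    is_lie_bracket U X Y Z -> D U Z }.

(* [E i] is the component of degree - (i + 1). *)
Section GradedBundle.
Variable E : nat -> vbundle.

Definition hvec (x : M) := {i : nat & E i x}.

Definition hv x i (v : E i x) : hvec x := Tagged (fun i => E i x) v.

Definition hdeg x (v : hvec x) : nat := (tag v).+1.
Definition sdeg x (s : seq (hvec x)) : nat := sumn (map (@hdeg x) s).

(* Elements of S(E_x^* ) are encoded as graded symmetric multilinear forms on
   E_x: functions on finite sequences of homogeneous vectors, the arity being
   the length of the sequence and the degree its total degree.  A form p is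
   normalised by
      p (v_1, ..., v_n) = the arity 0 part of d_{v_n} ... d_{v_1} p,
   where d_v is the derivation of S(E_x^* ) with d_v xi = <xi, v>; thus d_v is
   insertion of v in the first slot.  More generally, for a vector space F,
   elements of S(E_x^* ) (x) F are F-valued forms, p (x) e being
   s |-> p s *: e. *)
Definition gsym_form (F : lmodType K) x (p : seq (hvec x) -> F) : Prop :=
  (forall s t i (a : K) (u v : E i x),
     p (s ++ hv (a *: u + v) :: t) =
     a *: p (s ++ hv u :: t) + p (s ++ hv v :: t)) /\
  (forall s t (u v : hvec x),
     p (s ++ u :: v :: t) = (-1) ^+ (hdeg u * hdeg v) *: p (s ++ v :: u :: t)).

Definition fsec := forall x, seq (hvec x) -> K.

Definition bsec := {i : nat & forall x, E i x}.
Definition bsec_reg (U : set M) (s : bsec) : Prop := reg (v := E (tag s)) U (tagged s).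
Definition bsec_at (s : bsec) (x : M) : hvec x := hv (tagged s x).

(* [fun_deg U k w]: w is a section over U of the degree k part of S(E^* ); for
   k < 0 this forces w = 0 on U. *)
Definition fun_deg (U : set M) (k : int) (w : fsec) : Prop :=
  [/\ forall x, U x -> gsym_form (F := K^o) (w x),
      forall x s, U x -> (sdeg s)%:Z != k -> w x s = 0
    & forall V (s : seq bsec), open V -> V `<=` U ->
        List.Forall (bsec_reg V) s ->
        functions V (fun x => w x (map (bsec_at^~ x) s))].

Definition fconst (f : M -> K) : fsec := fun x s => if s is [::] then f x else 0.
Arguments fconst f x s : clear implicits.

Definition arity_part (n : nat) (w : fsec) : fsec :=
  fun x s => if size s == n then w x s else 0.
Arguments arity_part n w x s : clear implicits.

(* Sum over the ways to split s into two subsequences, with the Koszul sign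
   of the unshuffle; the recursion is the Leibniz rule
   d_v (p q) = (d_v p) q + (-1)^(|v| |p|) p (d_v q). *)
Fixpoint shuffle (A C : lmodType K) (B : Type) (m : A -> B -> C) x
    (p : seq (hvec x) -> A) (q : seq (hvec x) -> B) (s : seq (hvec x)) : C :=
  if s is v :: s' then
    shuffle m (fun t => p (v :: t)) q s' +
    shuffle m (fun t => (-1) ^+ (hdeg v * sdeg t) *: p t)
      (fun t => q (v :: t)) s'
  else m (p [::]) (q [::]).

Definition fmul (w w' : fsec) : fsec := fun x s =>
  shuffle (A := K^o) (C := K^o) (fun a b : K => a * b) (w x) (w' x) s.
Arguments fmul w w' x s : clear implicits.

Definition operator := set M -> fsec -> fsec.

Record is_derivation (U : set M) (d : int) (D : operator) : Prop :=
  IsDerivation {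
  der_deg : forall V k w, open V -> V `<=` U -> fun_deg V k w ->
    fun_deg V (k + d) (D V w);
  der_restrict : forall V V' k w w', open V -> open V' -> V' `<=` V ->
    V `<=` U -> fun_deg V k w -> fun_deg V' k w' -> agree V' w w' ->
    agree V' (D V w) (D V' w');
  der_linear : forall V k (a : K) w w', open V -> V `<=` U ->
    fun_deg V k w -> fun_deg V k w' ->
    agree V (D V (fun x s => a * w x s + w' x s))
      (fun x s => a * D V w x s + D V w' x s);
  der_leibniz : forall V k k' w w', open V -> V `<=` U ->
    fun_deg V k w -> fun_deg V k' w' ->
    agree V (D V (fmul w w'))
      (fun x s => fmul (D V w) w' x s + (-1) ^ (d * k) * fmul w (D V w') x s) }.

Definition is_vertical (U : set M) (D : operator) : Prop :=
  forall V k f w, open V -> V `<=` U -> functions V f -> fun_deg V k w ->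
    agree V (D V (fun x s => f x * w x s)) (fun x s => f x * D V w x s).

(* [d] and [d'] are the degrees of [D] and [D']. *)
Definition gcomm (d d' : int) (D D' : operator) : operator := fun V w x s =>
  D V (D' V w) x s - (-1) ^ (d * d') * D' V (D V w) x s.
Arguments gcomm d d' D D' V w x s : clear implicits.

Definition op_agree (U : set M) (D D' : operator) : Prop :=
  forall V k w, open V -> V `<=` U -> fun_deg V k w ->
    agree V (D V w) (D' V w).

(* The bundle L = (S(E^* ) (x) E)_{-1}: its elements are forms X with values in the product of the E_i, the component X s i being
   nonzero only if s has degree i, so that X has degree i - (i + 1) = -1.
   This product is the direct sum as soon as E has finite length. *)
Definition lform (x : M) := seq (hvec x) -> dprod (fun i => E i x).

Definition lfib_axiom x (X : lform x) : Prop :=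
  gsym_form X /\ forall s i, sdeg s != i -> X s i = 0.

Definition lfib_pred (x : M) : {pred lform x} := fun X => `[< lfib_axiom X >].
Arguments lfib_pred x _ : clear implicits.

Fact lfib_submod (x : M) : submod_closed (lfib_pred x).
Proof.
have E0 s : (0 : lform x) s = 0 by [].
split.
  apply/asboolP; split; first split.
  - by move=> *; rewrite !E0 scaler0 addr0.
  - by move=> *; rewrite !E0 scaler0.
  - by [].
move=> a X Y /asboolP[[X1 X2] X3] /asboolP[[Y1 Y2] Y3]; apply/asboolP.
have Es s : (a *: X + Y) s = a *: X s + Y s by [].
split; first split.
- move=> s t i b u v; rewrite !Es X1 Y1 !scalerDr !scalerA (mulrC a b) -!addrA.
  by congr (_ + _); rewrite addrCA.
- by move=> s t u v; rewrite !Es X2 Y2 scalerDr !scalerA (mulrC a).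
- move=> s i si; have -> : (a *: X + Y) s i = a *: X s i + Y s i by [].
  by rewrite X3 // Y3 // scaler0 addr0.
Qed.

HB.instance Definition _ (x : M) := GRing.isSubmodClosed.Build K
  (lform x) (lfib_pred x) (lfib_submod x).

Record lfib (x : M) := LFib { lval :> lform x; _ : lval \in lfib_pred x }.

HB.instance Definition _ (x : M) := [isSub for @lval x].
HB.instance Definition _ (x : M) := [Choice of lfib x by <:].
HB.instance Definition _ (x : M) := [SubChoice_isSubLmodule of lfib x by <:].

Definition L (x : M) : lmodType K := lfib x.

Definition Lreg (U : set M) (X : forall x, L x) : Prop :=
  forall V (s : seq bsec) i, open V -> V `<=` U ->
    List.Forall (bsec_reg V) s ->
    reg (v := E i) V (fun x => lval (X x) (map (bsec_at^~ x) s) i).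

(* The projection onto S^0(E^* ) (x) E_{-1}. *)
Definition Lproj (x : M) (X : L x) : E 0 x := lval X [::] 0%N.

(* The vertical vector field of X: the O-linear extension of
   p (x) e |-> p d_e.  On a sequence s only the components of X of index
   i <= |s| contribute. *)
Definition vert (X : forall x, L x) : operator := fun _ w x s =>
  \sum_(i < (sdeg s).+1)
    shuffle (A := E i x) (C := K^o) (fun e (phi : E i x -> K) => phi e)
      (fun t => lval (X x) t i) (fun t e => w x (hv e :: t)) s.
Arguments vert X V w x s : clear implicits.

End GradedBundle.

Arguments fconst {E} f x s.
Arguments arity_part {E} n w x s.
Arguments fmul {E} w w' x s.
Arguments gcomm {E} d d' D D' V w x s.
Arguments vert {E} X V w x s.

Record lie_infty_algebroid := LieInftyAlgebroid {
  bun :> nat -> vbundle;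
  Q : operator bun;
  Q_derivation : is_derivation setT 1 Q;
  Q_square : forall U k w, open U -> fun_deg U k w ->
    agree U (Q U (Q U w)) (fun _ _ => 0) }.

Arguments Q : clear implicits.

Section LieInfty.
Variable A : lie_infty_algebroid.

Definition is_anchor (rho : forall x, A 0 x -> tangent x) : Prop :=
  bundle_morphism (@reg (A 0)) vfield rho /\
  forall U f, open U -> functions U f -> forall x (v : A 0 x), U x ->
    Q A U (fconst f) x [:: hv v] = rho x v f.

(* [d i] is d^(i + 2) : E_{-(i + 2)} -> E_{-(i + 1)}. *)
Definition is_linear_part (d : forall i x, A i.+1 x -> A i x) : Prop :=
  forall i,
    bundle_morphism (@reg (A i.+1)) (@reg (A i)) (d i) /\
    forall U w, open U -> fun_deg U (i.+1)%:Z w -> agree U (arity_part 1 w) w ->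
      forall x (v : A i.+1 x), U x ->
        arity_part 1 (Q A U w) x [:: hv v] =
        (-1) ^+ i.+1 * w x [:: hv (d i x v)].

(* Exactness at the sections of B2, in the sense of sheaves: preimages are only
   required locally. *)
Definition exact_at (B1 B2 : vbundle) (C : M -> lmodType K)
    (phi : forall x, B1 x -> B2 x) (psi : forall x, B2 x -> C x) : Prop :=
  forall U (b : forall x, B2 x), open U -> reg U b ->
    (agree U (fun x => psi x (b x)) (fun=> 0) <->
     locally (fun V => exists2 a : forall x, B1 x,
       reg V a & agree V b (fun x => phi x (a x))) U).

Definition is_universal (D : set M -> (forall x, tangent x) -> Prop)
    (rho : forall x, A 0 x -> tangent x)
    (d : forall i x, A i.+1 x -> A i x) : Prop :=
  [/\ forall U X, open U ->
        (D U X <-> locally (fun V => exists2 e : forall x, A 0 x,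
           reg V e & agree V X (fun x => rho x (e x))) U),
      exact_at (C := fun x => tangent x) (d 0) rho
    & forall i, exact_at (C := A i) (d i.+1) (d i)].

Definition finite_length : Prop :=
  exists N : nat, forall i x (v : A i x), (N <= i)%N -> v = 0.

End LieInfty.

Record is_leibniz_algebroid (B : M -> lmodType K)
    (regB : set M -> (forall x, B x) -> Prop)
    (eta : forall x, B x -> tangent x)
    (br : set M -> (forall x, B x) -> (forall x, B x) -> forall x, B x) : Prop :=
  IsLeibnizAlgebroid {
  leib_vbundle : is_vbundle regB;
  leib_anchor : bundle_morphism regB vfield eta;
  leib_reg : forall U X Y, open U -> regB U X -> regB U Y -> regB U (br U X Y);
  leib_restrict : forall U V X X' Y Y', open U -> open V -> V `<=` U ->
    regB U X -> regB U Y -> regB V X' -> regB V Y' ->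
    agree V X X' -> agree V Y Y' -> agree V (br U X Y) (br V X' Y');
  leib_linearl : forall U (a : K) X X' Y, open U ->
    regB U X -> regB U X' -> regB U Y ->
    agree U (br U (fun x => a *: X x + X' x) Y)
      (fun x => a *: br U X Y x + br U X' Y x);
  leib_linearr : forall U (a : K) X Y Y', open U ->
    regB U X -> regB U Y -> regB U Y' ->
    agree U (br U X (fun x => a *: Y x + Y' x))
      (fun x => a *: br U X Y x + br U X Y' x);
  leib_identity : forall U X Y Z, open U ->
    regB U X -> regB U Y -> regB U Z ->
    agree U (br U X (br U Y Z))
      (fun x => br U (br U X Y) Z x + br U Y (br U X Z) x);
  leib_function : forall U f X Y, open U ->
    functions U f -> regB U X -> regB U Y ->
    agree U (br U X (fun x => f x *: Y x))
      (fun x => f x *: br U X Y x + (eta x (X x) f : K) *: Y x) }.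

End Geometry.

Arguments Q {R c M} l U w x _.

(* Main.v *)
(* Every derivation of degree -1 of the sheaf of graded functions is O-linear,
   since it sends functions to degree -1, and is therefore the vertical vector
   field of a unique section of L: Euler's identity writes a graded function of
   degree n <> 0 as a sum of products of coframe elements and graded functions
   of lower degree, so that a derivation is determined by its values on
   functions and on the coframe.  As [[Q, X], Y] is such a derivation, this
   defines the bracket.  The Leibniz identity follows from two applications of
   the graded Jacobi identity together with [Q, [Q, X]] = 0.  The anchor
   comes from [Q, X] f = X (Q f), a function which only involves the
   component of X in E_{-1}.  A local frame of L is
   obtained from frames of the E_{-i}, in which the forms in L have their
   coefficients in a fixed finite-dimensional space. *)
Require Import Defs.
From HB Require Import structures.
From mathcomp Require Import all_boot all_order all_algebra.
From mathcomp Require Import all_classical all_reals all_analysis.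
From mathcomp Require Import ring zify.

Set Implicit Arguments.
Unset Strict Implicit.
Unset Printing Implicit Defensive.

Import Order.TTheory GRing.Theory Num.Theory.
Import numFieldNormedType.Exports.
Local Open Scope classical_set_scope.
Local Open Scope ring_scope.

(** * Sheaves of functions *)

(** Sections are total families, and the analytic and holomorphic classes have no partitions of
    unity, so every construction is made pointwise or near a point: the section representing a
    derivation is written in a frame chosen at each point, and its independence of that choice, due
    to O-linearity and locality, makes it regular. These arguments rest on frames of all components
    over one common neighbourhood. This is where finite length enters; it also bounds the words that
    index the coefficients of an element of L. In a frame a vertical field is a finite sum of forms
    times insertions, so its Leibniz rule reduces to that of insertions together with associativity
    and graded commutativity of the shuffle product, both proved by induction on the sequence of
    arguments. The Euler field multiplies by the arity and not by the degree, while a form of fixed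
    degree mixes arities: the compensating factor therefore depends on the number of arguments.
    Closure of the functions under sums and products has to be obtained class by class, for analytic
    functions from the Cauchy product of power series. *)

Section Smooth.
Variables (K : numFieldType) (n : nat).
Implicit Types (W : set 'rV[K]_n) (f g : 'rV[K]_n -> K).

(** Each clause of [Ck_on] is a condition at a single point on the total function, so any set
    through the point can carry it. *)
Lemma Ck_on_local k W f :
  (forall x, W x -> exists2 V : set 'rV[K]_n, V x & Ck_on k V f) -> Ck_on k W f.
Proof.
elim: k f => [|k IH] f H /=; split=> //.
- by move=> x Wx; have [V Vx [cf _]] := H x Wx; apply: cf.
- by move=> x Wx; have [V Vx [cf _]] := H x Wx; apply: cf.
- move=> i; split; first by move=> x Wx; have [V Vx [_ /(_ i)[df _]]] := H x Wx; apply: df.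
  by apply: IH => x Wx; have [V Vx [_ /(_ i)[_ df]]] := H x Wx; exists V.
Qed.

Lemma near_eq_on W f g x : open W -> W x -> (forall y, W y -> f y = g y) ->
  {near x, f =1 g}.
Proof.
move=> oW Wx fg; have : nbhs x W by apply: open_nbhs_nbhs.
by apply: filterS => y /fg.
Qed.

Lemma Ck_on_eq k W f g : open W -> (forall x, W x -> f x = g x) ->
  Ck_on k W f -> Ck_on k W g.
Proof.
move=> oW; have cg f' g' : (forall x, W x -> f' x = g' x) ->
    (forall x, W x -> {for x, continuous f'}) ->
    (forall x, W x -> {for x, continuous g'}).
  move=> fg cf x Wx; rewrite /continuous_at /prop_for -(fg _ Wx).
  have E := near_eq_on oW Wx fg.
  exact: cvg_trans (near_eq_cvg E) (cf x Wx).
elim: k f g => [|k IH] f g fg /= [cf Hf]; split=> //; try exact: (cg f).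
move=> i; have [d1 d2] := Hf i.
have fg_ x : W x -> {near x, f =1 g} by move=> Wx; exact: (near_eq_on oW Wx).
split.
  by move=> x Wx; apply: near_eq_derivable (fg_ x Wx) (d1 x Wx).
apply: (IH _ _ _ d2) => x Wx; have := fg_ x Wx; exact: near_eq_derive.
Qed.

(** The hypothesis is on values because the derivative met in the induction is known to be constant
    only pointwise. *)
Lemma Ck_on_cst k W f a : (forall x, f x = a) -> Ck_on k W f.
Proof.
elim: k f a => [|k IH] f a fa; have -> : f = cst a by apply/funext.
  by split=> // x _; exact: cst_continuous.
split=> [x _|i]; first exact: cst_continuous.
split=> [x _|]; first exact: derivable_cst.
by apply: (IH _ 0) => x; exact: derive_cst.
Qed.

(** Serves for products: the derivative of f g contains f and g themselves, which must be lowered to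
    the class of their derivatives. *)
Lemma Ck_onW k W f : Ck_on k.+1 W f -> Ck_on k W f.
Proof.
elim: k f => [|k IH] f [cf Hf]; first by split.
by split=> // i; have [d1 d2] := Hf i; split=> //; exact: IH.
Qed.

Lemma Ck_onD k W f g : open W -> Ck_on k W f -> Ck_on k W g ->
  Ck_on k W (fun x => f x + g x).
Proof.
move=> oW; elim: k f g => [|k IH] f g /= [cf Hf] [cg Hg]; split=> //;
  try by move=> x Wx; exact: (continuousD (cf x Wx) (cg x Wx)).
move=> i; have [f1 f2] := Hf i; have [g1 g2] := Hg i; split.
  by move=> x Wx; apply: derivableD; [exact: f1|exact: g1].
apply: (Ck_on_eq oW _ (IH _ _ f2 g2)) => x Wx.
by rewrite -deriveD //; [exact: f1|exact: g1].
Qed.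

Lemma Ck_onM k W f g : open W -> Ck_on k W f -> Ck_on k W g ->
  Ck_on k W (fun x => f x * g x).
Proof.
move=> oW; elim: k f g => [|k IH] f g Hf0 Hg0;
  have [cf Hf] := Hf0; have [cg Hg] := Hg0; split=> //=;
  try by move=> x Wx; exact: (continuousM (cf x Wx) (cg x Wx)).
move=> i; have [f1 f2] := Hf i; have [g1 g2] := Hg i; split.
  by move=> x Wx; apply: derivableM; [exact: f1|exact: g1].
have := Ck_onD oW (IH _ _ (Ck_onW Hf0) g2) (IH _ _ (Ck_onW Hg0) f2).
apply: (Ck_on_eq oW) => x Wx /=.
by rewrite -[in RHS]/(f * g) deriveM //; [exact: f1|exact: g1].
Qed.

End Smooth.

Section Holomorphic.
Variables (K : numFieldType) (n : nat).
Implicit Types (W : set 'rV[K]_n) (f g : 'rV[K]_n -> K).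

(** The first-order expansion of f at x is also one of g, and [diff_unique] identifies its linear
    part with the differential of g. *)
Lemma near_eq_differentiable f g x :
  {near x, f =1 g} -> differentiable f x -> differentiable g x.
Proof.
move=> fg /diff_locallyP[cdf df].
have gE : g \o shift x = cst (g x) + 'd f x +o_ 0 id.
  apply/eqaddoP => e e0.
  move/eqaddoP : df => /(_ e e0).
  have fg0 : \forall h \near 0, f (h + x) = g (h + x).
    by move: fg; rewrite (near_shift 0) subr0.
  apply: filterS2 fg0 => h /=.
  rewrite /GRing.opp /GRing.add /= => <-.
  by rewrite (nbhs_singleton fg).
have dE := diff_unique cdf gE.
by apply/diff_locallyP; rewrite dE.
Qed.

End Holomorphic.

(** * Cauchy products of absolutely convergent series *)

Section CauchyProduct.
Variable R : realType.
Implicit Types u v : nat -> R.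

Definition cauchy_prod u v (k : nat) : R :=
  \sum_(0 <= i < k.+1) u i * v (k - i)%N.

Lemma series_cauchy_prod u v n :
  series (cauchy_prod u v) n = \sum_(0 <= i < n) \sum_(0 <= j < n - i) u i * v j.
Proof.
rewrite /series /=; elim: n => [|n IH]; first by rewrite !big_geq.
rewrite big_nat_recr //= IH [in RHS]big_nat_recr //= subSnn big_nat1.
rewrite /cauchy_prod big_nat_recr //= subnn addrA; congr (_ + _).
rewrite -big_split /= !big_nat; apply: eq_bigr => i /andP[_ lin].
by rewrite subSn 1?ltnW // big_nat_recr.
Qed.

Lemma le_sum_nat (f : nat -> R) m n : (forall i, 0 <= f i) -> (m <= n)%N ->
  \sum_(0 <= i < m) f i <= \sum_(0 <= i < n) f i.
Proof.
move=> f0 mn; rewrite (big_cat_nat (leq0n m) mn) /= lerDl; exact: sumr_ge0.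
Qed.

(** The part i + j >= n of the square of side n: what the Cauchy product leaves out of the product
    of the partial sums. *)
Definition cauchy_tail u v n :=
  \sum_(0 <= i < n) \sum_(n - i <= j < n) u i * v j.

Lemma mul_series u v n :
  series u n * series v n = \sum_(0 <= i < n) \sum_(0 <= j < n) u i * v j.
Proof.
by rewrite /series /= mulr_suml; apply: eq_bigr => i _; rewrite mulr_sumr.
Qed.

Lemma cauchy_tailE u v n :
  cauchy_tail u v n = series u n * series v n - series (cauchy_prod u v) n.
Proof.
apply/eqP; rewrite eq_sym subr_eq mul_series series_cauchy_prod /cauchy_tail.
rewrite -big_split /=; apply/eqP; apply: eq_bigr => i _.
by rewrite addrC -big_cat_nat // leq_subr.
Qed.

Lemma cauchy_tail_norm u v n :
  `|cauchy_tail u v n| <= cauchy_tail (fun i => `|u i|) (fun i => `|v i|) n.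
Proof.
apply: le_trans (ler_norm_sum _ _ _) _; apply: ler_sum => i _.
apply: le_trans (ler_norm_sum _ _ _) _; apply: ler_sum => j _.
by rewrite normrM.
Qed.

Lemma cvg_half : (fun n : nat => n./2) @ \oo --> \oo.
Proof.
move=> P [N _ HN]; exists N.*2 => // n /= Nn; apply: HN => /=.
by rewrite -(doubleK N) half_leq.
Qed.

(** Squeeze: the triangle i + j < n lies between the squares of sides n/2 and n, whose sums are
    products of partial sums. *)
Lemma cvg_cauchy_prod_ge0 u v (a b : R) :
  (forall i, 0 <= u i) -> (forall i, 0 <= v i) ->
  series u @ \oo --> a -> series v @ \oo --> b ->
  series (cauchy_prod u v) @ \oo --> a * b.
Proof.
move=> u0 v0 ua vb.
have uv : (fun n => series u n * series v n) @ \oo --> a * b.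
  exact: (cvgM ua vb).
apply: (squeeze_cvgr _ _ uv); last first.
  exact: (cvg_comp _ _ cvg_half uv).
near=> n; apply/andP; split; rewrite /= mul_series series_cauchy_prod.
  apply: (@le_trans _ _ (\sum_(0 <= i < n./2) \sum_(0 <= j < n - i) u i * v j)).
    rewrite !big_nat; apply: ler_sum => i /andP[_ ilt].
    apply: le_sum_nat => [j|]; first exact: mulr_ge0.
    rewrite leq_subRL; last by rewrite (leq_trans (ltnW ilt)) // -divn2 leq_div.
    rewrite -{2}(odd_double_half n) -addnn addnA leq_add2r.
    by apply: leq_trans (ltnW ilt) _; rewrite leq_addl.
  apply: le_sum_nat => [i|]; last by rewrite -divn2 leq_div.
  by apply: sumr_ge0 => j _; exact: mulr_ge0.
apply: ler_sum => i _; apply: le_sum_nat => [j|]; first exact: mulr_ge0.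
exact: leq_subr.
Unshelve. all: by end_near. Qed.

(** The tail is bounded by the tail of the absolute values, which tends to A B - A B = 0 by the
    nonnegative case. *)
Lemma cvg_cauchy_prod u v (a b : R) :
  cvgn (series (fun i => `|u i|)) -> cvgn (series (fun i => `|v i|)) ->
  series u @ \oo --> a -> series v @ \oo --> b ->
  series (cauchy_prod u v) @ \oo --> a * b.
Proof.
move=> /cvg_ex[/= A uA] /cvg_ex[/= B vB] ua vb.
have W : series (cauchy_prod (fun i => `|u i|) (fun i => `|v i|)) @ \oo --> A * B.
  by apply: cvg_cauchy_prod_ge0.
have T0 : (fun n => cauchy_tail (fun i => `|u i|) (fun i => `|v i|) n) @ \oo
    --> (0 : R).
  under eq_fun do rewrite cauchy_tailE.
  by rewrite -(subrr (A * B)); apply: cvgB => //; exact: (cvgM uA vB).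
have T : (fun n => cauchy_tail u v n) @ \oo --> (0 : R).
  have NT0 : (fun n => - cauchy_tail (fun i => `|u i|) (fun i => `|v i|) n)
    @ \oo --> (0 : R) by rewrite -oppr0; exact: cvgN.
  apply: (squeeze_cvgr _ NT0 T0).
  by near=> n; rewrite -ler_norml cauchy_tail_norm.
have -> : series (cauchy_prod u v) =
    (fun n => series u n * series v n - cauchy_tail u v n).
  by apply/funext => n; rewrite cauchy_tailE subKr.
by rewrite -(subr0 (a * b)); apply: cvgB => //; exact: (cvgM ua vb).
Unshelve. all: by end_near. Qed.

End CauchyProduct.

(** * Multi-indices and products of power series *)

Section MultiIndex.
Variables (R : realType) (n : nat).
Implicit Types (a : {ffun 'I_n -> nat}) (c d : {ffun 'I_n -> nat} -> R).
Implicit Types (h : 'rV[R]_n).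

Definition msum a := (\sum_i a i)%N.
Definition monom h a : R := \prod_i h 0 i ^+ a i.
(** Sums need a finite index type, and the box in [pseries_term] grows with the degree; passing
    through plain multi-indices makes boxes of different sizes comparable. *)
Definition box_val N (b : {ffun 'I_n -> 'I_N.+1}) : {ffun 'I_n -> nat} :=
  [ffun i => b i : nat].
Definition box_ord N a : {ffun 'I_n -> 'I_N.+1} := [ffun i => inord (a i)].

Lemma box_ordK N a : (forall i, (a i <= N)%N) -> box_val (box_ord N a) = a.
Proof. by move=> aN; apply/ffunP => i; rewrite !ffunE inordK ?ltnS. Qed.

Lemma box_valK N (b : {ffun 'I_n -> 'I_N.+1}) : box_ord N (box_val b) = b.
Proof. by apply/ffunP => i; rewrite !ffunE inord_val. Qed.

Lemma box_val_le N (b : {ffun 'I_n -> 'I_N.+1}) i : (box_val b i <= N)%N.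
Proof. by rewrite ffunE -ltnS. Qed.

Lemma leq_msum a i : (a i <= msum a)%N.
Proof. by rewrite /msum (bigD1 i) //= leq_addr. Qed.

Lemma sum_box (P : pred {ffun 'I_n -> nat}) (G : {ffun 'I_n -> nat} -> R) k N :
  (k <= N)%N -> (forall a, P a -> forall i, (a i <= k)%N) ->
  \sum_(b : {ffun 'I_n -> 'I_k.+1} | P (box_val b)) G (box_val b) =
  \sum_(b : {ffun 'I_n -> 'I_N.+1} | P (box_val b)) G (box_val b).
Proof.
move=> kN Pk.
rewrite [RHS](reindex_onto (fun b => box_ord N (box_val b))
  (fun b => box_ord k (box_val b))) /=; last first.
  by move=> b /Pk bk; rewrite box_ordK // box_valK.
have E (b : {ffun 'I_n -> 'I_k.+1}) : box_val (box_ord N (box_val b)) = box_val b.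
  by rewrite box_ordK // => i; exact: leq_trans (box_val_le b i) kN.
by apply: eq_big => b; rewrite E ?box_valK ?eqxx ?andbT.
Qed.

Lemma pseries_termE c h k N : (k <= N)%N ->
  pseries_term c h k = \sum_(b : {ffun 'I_n -> 'I_N.+1} | msum (box_val b) == k)
    c (box_val b) * monom h (box_val b).
Proof.
move=> kN; rewrite -(sum_box (P := fun a => msum a == k)
  (fun a => c a * monom h a) kN); last first.
  by move=> a /eqP <- i; exact: leq_msum.
rewrite /pseries_term; apply: eq_big => b.
  by rewrite /msum; congr (_ == _); apply: eq_bigr => i _; rewrite ffunE.
move=> _; congr (_ * _); rewrite /monom; apply: eq_bigr => i _.
by rewrite ffunE.
Qed.

(** The coefficients of a product of power series. The truncated subtraction is exact, since b is at
    most a entry by entry. *)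
Definition mconv c d a : R :=
  \sum_(b : {ffun 'I_n -> 'I_(msum a).+1} | [forall i, box_val b i <= a i]%N)
    c (box_val b) * d [ffun i => a i - box_val b i]%N.

Lemma mconvE c d a N : (msum a <= N)%N -> mconv c d a =
  \sum_(b : {ffun 'I_n -> 'I_N.+1} | [forall i, box_val b i <= a i]%N)
    c (box_val b) * d [ffun i => a i - box_val b i]%N.
Proof.
move=> aN; apply: (sum_box (P := fun b => [forall i, b i <= a i]%N)
  (fun b => c b * d [ffun i => a i - b i]%N) aN).
by move=> b /forallP ba i; exact: leq_trans (ba i) (leq_msum a i).
Qed.

Lemma monomD h a (b : {ffun 'I_n -> nat}) : monom h [ffun i => a i + b i]%N = monom h a * monom h b.
Proof.
by rewrite /monom -big_split /=; apply: eq_bigr => i _; rewrite ffunE exprD.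
Qed.

Lemma msumD a (b : {ffun 'I_n -> nat}) : msum [ffun i => a i + b i]%N = (msum a + msum b)%N.
Proof. by rewrite /msum -big_split /=; apply: eq_bigr => i _; rewrite ffunE. Qed.

(** Both sides are the sum over pairs (b, b') of total degree k, grouped by b + b' on the left and
    by the degree of b on the right. *)
Lemma pseries_term_mconv c d h k :
  pseries_term (mconv c d) h k =
  cauchy_prod (pseries_term c h) (pseries_term d h) k.
Proof.
rewrite (pseries_termE _ _ (leqnn k)).
transitivity (\sum_(b : {ffun 'I_n -> 'I_k.+1} | (msum (box_val b) <= k)%N)
  \sum_(b' : {ffun 'I_n -> 'I_k.+1} | msum (box_val b') == (k - msum (box_val b))%N)
     c (box_val b) * monom h (box_val b) * (d (box_val b') * monom h (box_val b'))).
  under eq_bigr => a /eqP ak do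
    rewrite (mconvE _ _ (N := k)) ?ak // mulr_suml.
  rewrite (exchange_big_dep (fun b : {ffun 'I_n -> 'I_k.+1} =>
    (msum (box_val b) <= k)%N)) /=; last first.
    by move=> a b /eqP ak /forallP ba; rewrite -[leqRHS]ak; exact: leq_sum.
  apply: eq_bigr => b bk.
  have le (b' : {ffun 'I_n -> 'I_k.+1}) :
      (msum (box_val b') == (k - msum (box_val b))%N) -> forall i,
      ([ffun i => box_val b i + box_val b' i] i <= k)%N.
    move=> /eqP b'k i; apply: leq_trans (leq_msum _ i) _.
    by rewrite msumD b'k subnKC.
  (* The inner sum runs over the multi-indices a above b; substituting a = b + b' makes it a sum
     over b'. *)
  rewrite (reindex_onto
    (fun b' => box_ord k [ffun i => box_val b i + box_val b' i]%N)
    (fun e => box_ord k [ffun i => box_val e i - box_val b i]%N)) /=; last first.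
    move=> a /andP[/eqP ak /forallP ba]; rewrite box_ordK; last first.
      by move=> i; rewrite ffunE (leq_trans (leq_subr _ _)) // box_val_le.
    rewrite -[RHS]box_valK; congr box_ord; apply/ffunP => i.
    by rewrite !ffunE subnKC //; have := ba i; rewrite !ffunE.
  (* [box_ord] would replace an entry too large for the box by a default. The last condition forces
     b' = q - b, so b + b' = q stays in the box. *)
  have E (b' : {ffun 'I_n -> 'I_k.+1}) : [&& msum (box_val
      (box_ord k [ffun i => box_val b i + box_val b' i]%N)) == k,
      [forall i, box_val b i <= box_val
      (box_ord k [ffun i => box_val b i + box_val b' i]) i]%N &
      box_ord k [ffun i => box_val (box_ord k
        [ffun i => box_val b i + box_val b' i]) i - box_val b i]%N == b'] ->
      forall i, ([ffun i => box_val b i + box_val b' i] i <= k)%N.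
    case/and3P => _ /forallP b1 /eqP b2 i.
    move: b1 b2; set q := box_ord k [ffun i => box_val b i + box_val b' i]%N.
    move=> b1 b2; have b'E : box_val b' i = (box_val q i - box_val b i)%N.
      rewrite -b2 box_ordK ?ffunE // => j.
      by rewrite ffunE (leq_trans (leq_subr _ _)) // box_val_le.
    by rewrite ffunE b'E subnKC // box_val_le.
  apply: eq_big => b'.
    rewrite -andbA; apply/idP/idP => [H|H].
      have := E _ H; case/and3P: H => /eqP H _ _ /box_ordK Eb; move: H.
      by rewrite Eb msumD => kE; rewrite -[X in (X - _)%N]kE addKn.
    have Eb := box_ordK (le _ H); rewrite Eb msumD (eqP H) subnKC // eqxx /=.
    apply/andP; split; first by apply/forallP => i; rewrite !ffunE leq_addr.
    rewrite -[X in _ == X]box_valK; apply/eqP; congr box_ord.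
    by apply/ffunP => i; rewrite !ffunE addKn.
  rewrite -andbA => /E /box_ordK ->.
  rewrite monomD mulrACA mulrA [RHS]mulrA; congr (_ * _ * _ * _).
  congr (d _); apply/ffunP => i; by rewrite !ffunE addKn.
rewrite /cauchy_prod big_mkord.
(* Grouping by the degree of b produces the index of the Cauchy product. *)
rewrite (partition_big (fun b : {ffun 'I_n -> 'I_k.+1} =>
  inord (msum (box_val b)) : 'I_k.+1) xpredT) //=.
apply: eq_bigr => i _.
rewrite (pseries_termE c h (leq_ord i)) (pseries_termE d h (leq_subr i k)).
rewrite mulr_suml; apply: eq_big => b.
  apply/idP/idP => [/andP[bk /eqP <-]|/eqP bi]; first by rewrite inordK.
  by rewrite bi -ltnS ltn_ord /= inord_val.
move=> /andP[bk /eqP <-]; rewrite inordK // mulr_sumr.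
by apply: eq_bigr.
Qed.

Lemma norm_monom h a : `|monom h a| = monom (\row_i `|h 0 i|) a.
Proof.
by rewrite /monom normr_prod; apply: eq_bigr => i _; rewrite normrX mxE.
Qed.

Lemma pseries_term_norm c h k :
  `|pseries_term c h k| <=
  pseries_term (fun a => `|c a|) (\row_i `|h 0 i|) k.
Proof.
rewrite !(pseries_termE _ _ (leqnn k)); apply: le_trans (ler_norm_sum _ _ _) _.
by apply: ler_sum => b _; rewrite normrM norm_monom.
Qed.

Lemma ler_pseries_term c d h k :
  (forall a, c a <= d a) -> (forall i, 0 <= h 0 i) ->
  pseries_term c h k <= pseries_term d h k.
Proof.
move=> cd h0; rewrite !(pseries_termE _ _ (leqnn k)).
apply: ler_sum => b _; apply: ler_wpM2r => //.
by apply: prodr_ge0 => i _; exact: exprn_ge0.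
Qed.

Lemma pseries_term_ge0 c h k :
  (forall a, 0 <= c a) -> (forall i, 0 <= h 0 i) -> 0 <= pseries_term c h k.
Proof.
move=> c0 h0; rewrite (pseries_termE _ _ (leqnn k)).
apply: sumr_ge0 => b _; apply: mulr_ge0 => //.
by apply: prodr_ge0 => i _; exact: exprn_ge0.
Qed.

Lemma pseries_termD c d h k :
  pseries_term (fun a => c a + d a) h k = pseries_term c h k + pseries_term d h k.
Proof.
rewrite !(pseries_termE _ _ (leqnn k)) -big_split /=.
by apply: eq_bigr => b _; rewrite mulrDl.
Qed.

Lemma pseries_term_cst (e : R) h k :
  pseries_term (fun a => if msum a == 0%N then e else 0) h k =
  if k == 0%N then e else 0.
Proof.
rewrite (pseries_termE _ _ (leqnn k)).
case: k => [|k] /=.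
  rewrite (big_pred1 [ffun=> ord0]) => [|b].
    have -> : box_val [ffun=> ord0 : 'I_1] = [ffun=> 0%N].
      by apply/ffunP => i; rewrite !ffunE.
    rewrite /msum big1 => [|i _]; last by rewrite ffunE.
    by rewrite eqxx /monom big1 ?mulr1 // => i _; rewrite ffunE expr0.
  have -> : b = [ffun=> ord0] by apply/ffunP => i; rewrite ffunE ord1.
  by rewrite /= eqxx /msum big1 // => i _; rewrite !ffunE.
by rewrite big1 // => b /eqP ->; rewrite mul0r.
Qed.

End MultiIndex.

(** * Analytic functions *)

Section Analytic.
Variables (R : realType) (n : nat).
Implicit Types (W : set 'rV[R]_n) (f g : 'rV[R]_n -> R).

Lemma lt_minE (t u v : R) : t < Num.min u v -> t < u /\ t < v.
Proof. by rewrite lt_min => /andP. Qed.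

(** Balls of row vectors are defined entry by entry, hence are polydiscs. *)
Lemma row_ball W x : open W -> W x -> exists r : R, 0 < r /\
  forall h : 'rV[R]_n, (forall i, `|h 0 i| < r) -> W (x + h).
Proof.
move=> oW Wx; have : nbhs x W by apply: open_nbhs_nbhs.
move=> /nbhs_ballP[r /= r0 rW]; exists r; split=> // h hr; apply: rW.
by split=> // i j; rewrite /ball /= !mxE opprD addrA subrr sub0r normrN ord1.
Qed.

Lemma analytic_on_eq W f g : open W -> (forall x, W x -> f x = g x) ->
  analytic_on W f -> analytic_on W g.
Proof.
move=> oW fg af x Wx; have [c [r [r0 cr]]] := af x Wx.
have [r' [r'0 r'W]] := row_ball oW Wx.
exists c, (Num.min r r'); split; first by rewrite lt_min r0.
move=> h hr; have [c1 c2] := cr h (fun i => (lt_minE (hr i)).1).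
split=> //; rewrite -fg //; apply: r'W => i.
exact: (lt_minE (hr i)).2.
Qed.

Lemma analytic_on_cst W (e : R) : analytic_on W (fun=> e).
Proof.
move=> x _; exists (fun a => if msum a == 0%N then e else 0), 1; split=> // h _.
have S (e' : R) h' : series (pseries_term (fun a : {ffun 'I_n -> nat} =>
    if msum a == 0%N then e' else 0) h') @ \oo --> e'.
  have : (fun=> e') @ \oo --> e' by exact: cvg_cst.
  apply: cvg_trans; apply: near_eq_cvg; exists 1%N => // k /= k1.
  rewrite /series /=; case: k k1 => // k _; rewrite big_nat_recl //.
  rewrite pseries_term_cst eqxx big1 ?addr0 // => i _.
  by rewrite pseries_term_cst.
split=> //; apply/cvg_ex; exists `|e|.
have -> : (fun a : {ffun 'I_n -> nat} => `|if msum a == 0%N then e else 0|) =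
    (fun a => if msum a == 0%N then `|e| else 0).
  by apply/funext => a; case: ifP; rewrite // normr0.
exact: S.
Qed.

Lemma cvg_pseries_le (u v : nat -> R) :
  (forall k, 0 <= u k) -> (forall k, u k <= v k) ->
  cvgn (series v) -> cvgn (series u).
Proof.
move=> u0 uv; apply: series_le_cvg => // k; exact: le_trans (u0 k) (uv k).
Qed.

Lemma row_norm_ge0 (h : 'rV[R]_n) i : 0 <= (\row_i `|h 0 i|) 0 i :> R.
Proof. by rewrite mxE. Qed.

Lemma analytic_onD W f g : analytic_on W f -> analytic_on W g ->
  analytic_on W (fun x => f x + g x).
Proof.
move=> af ag x Wx; have [c [r [r0 cr]]] := af x Wx.
have [d [r' [r'0 dr]]] := ag x Wx.
exists (fun a => c a + d a), (Num.min r r'); split; first by rewrite lt_min r0.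
move=> h hr; have [c1 c2] := cr h (fun i => (lt_minE (hr i)).1).
have [|d1 d2] := dr h.
  by move=> i; exact: (lt_minE (hr i)).2.
have seqD (u v : nat -> R) : series (fun k => u k + v k) = series u + series v.
  by rewrite -seriesD.
split.
  have := is_cvg_seriesD c1 d1; apply: cvg_pseries_le => k.
    by apply: pseries_term_ge0 => *; rewrite ?row_norm_ge0.
  rewrite -[leRHS]/(_ + _) -pseries_termD.
  apply: ler_pseries_term => [a|i]; [exact: ler_normD|exact: row_norm_ge0].
have -> : pseries_term (fun a => c a + d a) h =
    (fun k => pseries_term c h k + pseries_term d h k).
  by apply/funext => k; rewrite pseries_termD.
rewrite seqD; exact: cvgD.
Qed.

Lemma analytic_onM W f g : analytic_on W f -> analytic_on W g ->
  analytic_on W (fun x => f x * g x).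
Proof.
move=> af ag x Wx; have [c [r [r0 cr]]] := af x Wx.
have [d [r' [r'0 dr]]] := ag x Wx.
exists (mconv c d), (Num.min r r'); split; first by rewrite lt_min r0.
move=> h hr; have [c1 c2] := cr h (fun i => (lt_minE (hr i)).1).
have [|d1 d2] := dr h.
  by move=> i; exact: (lt_minE (hr i)).2.
have fE b : pseries_term (mconv b d) h = cauchy_prod (pseries_term b h) (pseries_term d h).
  by apply/funext => k; rewrite pseries_term_mconv.
have abs b : cvgn (series (pseries_term (fun a => `|b a|) (\row_i `|h 0 i|))) ->
    cvgn (series (fun k => `|pseries_term b h k|)).
  apply: cvg_pseries_le => k; [exact: normr_ge0|exact: pseries_term_norm].
split; last by rewrite fE; apply: cvg_cauchy_prod => //; exact: abs.
(* Absolute values of the convolution are at most the convolution of the absolute values, whose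
   series is a Cauchy product of nonnegative convergent series. *)
move: c1 d1 => /cvg_ex[/= C c1] /cvg_ex[/= D d1].
apply: (@cvg_pseries_le _ (cauchy_prod (pseries_term (fun a => `|c a|) (\row_i `|h 0 i|))
  (pseries_term (fun a => `|d a|) (\row_i `|h 0 i|)))).
- by move=> k; apply: pseries_term_ge0 => *; rewrite ?row_norm_ge0.
- move=> k; rewrite -pseries_term_mconv.
  apply: ler_pseries_term => [a|i]; last exact: row_norm_ge0.
  apply: le_trans (ler_norm_sum _ _ _) _; apply: ler_sum => b _.
  by rewrite normrM.
- apply/cvg_ex; exists (C * D); apply: cvg_cauchy_prod_ge0 => // k;
    by apply: pseries_term_ge0 => *; rewrite ?row_norm_ge0.
Qed.

End Analytic.

Section Regular.
Variables (R : realType) (c : funclass) (n : nat).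
Local Notation K := (base_field R c).
Implicit Types (W : set 'rV[K]_n) (f g : 'rV[K]_n -> K).

Lemma regular_local W f :
  (forall x, W x -> exists2 V : set 'rV[K]_n, V x & regular c V f) ->
  regular c W f.
Proof.
case: c W f => W f H /=.
- by move=> k; apply: Ck_on_local => x /H[V Vx fV]; exists V.
- by move=> x Wx; have [V Vx fV] := H x Wx; exact: fV.
- by move=> x Wx; have [V Vx fV] := H x Wx; exact: fV.
Qed.

Lemma regular_sub W W' f : W' `<=` W -> regular c W f -> regular c W' f.
Proof. by move=> W'W rf; apply: regular_local => x /W'W Wx; exists W. Qed.

Lemma regular_eq W f g : open W -> (forall x, W x -> f x = g x) ->
  regular c W f -> regular c W g.
Proof.
case: c W f g => W f g oW fg /=.
- by move=> rf k; exact: Ck_on_eq (rf k).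
- exact: analytic_on_eq.
- move=> rf x Wx; apply: near_eq_differentiable (rf x Wx).
  exact: near_eq_on Wx fg.
Qed.

Lemma regular_cst W (a : K) : regular c W (fun=> a).
Proof.
case: c W a => W a /=.
- by move=> k; exact: Ck_on_cst.
- exact: analytic_on_cst.
- by move=> x _; exact: differentiable_cst.
Qed.

Lemma regularD W f g : open W -> regular c W f -> regular c W g ->
  regular c W (fun x => f x + g x).
Proof.
case: c W f g => W f g oW /= rf rg.
- by move=> k; exact: Ck_onD.
- exact: analytic_onD.
- by move=> x Wx; apply: differentiableD; [exact: rf|exact: rg].
Qed.

Lemma regularM W f g : open W -> regular c W f -> regular c W g ->
  regular c W (fun x => f x * g x).
Proof.
case: c W f g => W f g oW /= rf rg.
- by move=> k; exact: Ck_onM.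
- exact: analytic_onM.
- by move=> x Wx; apply: differentiableM; [exact: rf|exact: rg].
Qed.

End Regular.

(** * The sheaf of functions on the manifold *)

Section Functions.
Variables (R : realType) (c : funclass) (M : manifold R c).
Local Notation K := (base_field R c).
Implicit Types (U V : set M) (f g : M -> K).

(** The image is the open image of the whole chart domain, cut by the preimage of V under the
    continuous inverse chart. *)
Lemma open_chart_image (a : atlas M) V :
  open V -> open (cmap a @` (cdom a `&` V)).
Proof.
move=> oV; rewrite openE => _ [x [ax Vx] <-]; rewrite /interior.
have N1 : nbhs (cmap a x) (cmap a @` cdom a).
  by apply: open_nbhs_nbhs; split; [exact: cimg_open|exists x].
have N2 : nbhs (cmap a x) (cinv a @^-1` V).
  apply: (@cinv_continuous _ _ _ a (cmap a x)); first by exists x.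
  by rewrite cmapK //; exact: open_nbhs_nbhs.
apply: filterS2 N1 N2 => y [z az <-] /=; rewrite cmapK // => Vz.
by exists z.
Qed.

Lemma functions_agree V f g : open V -> agree V f g ->
  functions V f -> functions V g.
Proof.
move=> oV fg ff a; apply: regular_eq (ff a); first exact: open_chart_image.
by move=> _ [x [ax Vx] <-]; rewrite cmapK // fg.
Qed.

Lemma functions_sub U V f : V `<=` U -> functions U f -> functions V f.
Proof.
move=> VU ff a; apply: regular_sub (ff a).
by move=> _ [x [ax /VU Ux] <-]; exists x.
Qed.

Lemma functions_local V f :
  (forall x, V x -> exists2 W : set M, W x & functions W f) -> functions V f.
Proof.
move=> H a; apply: regular_local => _ [x [ax Vx] <-].
by have [W Wx fW] := H x Vx; exists (cmap a @` (cdom a `&` W)); [exists x|exact: fW].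
Qed.

Lemma functions_cst V (e : K) : functions V (fun=> e).
Proof. by move=> a; exact: regular_cst. Qed.

Lemma functionsD V f g : open V -> functions V f -> functions V g ->
  functions V (fun x => f x + g x).
Proof. by move=> oV ff fg a; apply: regularD => //; exact: open_chart_image. Qed.

Lemma functionsM V f g : open V -> functions V f -> functions V g ->
  functions V (fun x => f x * g x).
Proof. by move=> oV ff fg a; apply: regularM => //; exact: open_chart_image. Qed.

Lemma functions_sum V (I : Type) (r : seq I) (P : pred I) (F : I -> M -> K) :
  open V -> (forall i, P i -> functions V (F i)) ->
  functions V (fun x => \sum_(i <- r | P i) F i x).
Proof.
move=> oV fF; elim: r => [|i r IH].
  apply: functions_agree oV _ (functions_cst V 0) => x _.
  by rewrite big_nil.
case Pi : (P i); last first.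
  by apply: functions_agree oV _ IH => x _; rewrite big_cons Pi.
apply: functions_agree oV _ (functionsD oV (fF i Pi) IH) => x _.
by rewrite big_cons Pi.
Qed.

End Functions.

(** * The shuffle algebra of forms at a point *)

Section Signs.
Variable K : fieldType.
Implicit Types k l : int.

Definition zsign (k : int) : K := (-1) ^ k.

Lemma zsignD k l : zsign (k + l) = zsign k * zsign l.
Proof. by rewrite /zsign expfzDr // oppr_eq0 oner_neq0. Qed.

Lemma zsignN k : zsign (- k) = zsign k.
Proof. by rewrite /zsign -exprz_inv invrN1. Qed.

Lemma zsign_nat (n : nat) : zsign n%:Z = (-1) ^+ n.
Proof. by []. Qed.

Lemma zsignK k : zsign k * zsign k = 1.
Proof. by rewrite -{2}(zsignN k) -zsignD subrr. Qed.

(** Reduces an identity between signs to finitely many cases, each closed by [ring]. *)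
Lemma zsign_bool k : exists b : bool, zsign k = (-1) ^+ b.
Proof.
case: k => n; first by exists (odd n); rewrite zsign_nat signr_odd.
by exists (odd n.+1); rewrite NegzE zsignN zsign_nat signr_odd.
Qed.

End Signs.

Section ShuffleAlgebra.
Variables (R : realType) (c : funclass) (M : manifold R c).
Local Notation K := (base_field R c).
Variables (E : nat -> vbundle M) (x : M).
Local Notation H := (hvec E x).
Implicit Types (p q r : seq H -> K) (s t : seq H) (v : H).

Definition sh p q s : K :=
  shuffle (A := K^o) (C := K^o) (fun a b : K => a * b) p q s.

Definition ins v p : seq H -> K := fun t => p (v :: t).

(** The sign a form acquires when something of degree d passes it. With it the Leibniz rule for an
    insertion holds for forms that need not be homogeneous. *)
Definition tw (d : nat) p : seq H -> K := fun t => (-1) ^+ (d * sdeg t) * p t.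

Lemma sh_nil p q : sh p q [::] = p [::] * q [::].
Proof. by []. Qed.

Lemma sh_cons p q v s :
  sh p q (v :: s) = sh (ins v p) q s + sh (tw (hdeg v) p) (ins v q) s.
Proof. by []. Qed.

Lemma ins_sh v p q :
  ins v (sh p q) = fun s => sh (ins v p) q s + sh (tw (hdeg v) p) (ins v q) s.
Proof. by []. Qed.

Lemma sdeg_cons v s : sdeg (v :: s) = (hdeg v + sdeg s)%N.
Proof. by []. Qed.

Lemma sdeg_cat s t : sdeg (s ++ t) = (sdeg s + sdeg t)%N.
Proof. by rewrite /sdeg map_cat sumn_cat. Qed.

Lemma sh_linl (a : K) p p' q s :
  sh (fun t => a * p t + p' t) q s = a * sh p q s + sh p' q s.
Proof.
elim: s p p' q => [|v s IH] p p' q; first by rewrite !sh_nil mulrDl mulrA.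
rewrite !sh_cons; have -> : tw (hdeg v) (fun t => a * p t + p' t) =
    (fun t => a * tw (hdeg v) p t + tw (hdeg v) p' t).
  by apply/funext => t; rewrite /tw mulrDr mulrCA.
by rewrite (IH (ins v p)) (IH (tw _ p)) mulrDr addrACA.
Qed.

Lemma sh_linr (a : K) p q q' s :
  sh p (fun t => a * q t + q' t) s = a * sh p q s + sh p q' s.
Proof.
elim: s p q q' => [|v s IH] p q q'; first by rewrite !sh_nil mulrDr mulrCA.
by rewrite !sh_cons (IH _ q) (IH _ (ins v q)) mulrDr addrACA.
Qed.

Lemma sh0l q s : sh (fun=> 0) q s = 0.
Proof.
have := sh_linl (-1) (fun=> 0) (fun=> 0) q s.
by rewrite mulr0 addr0 mulN1r addNr.
Qed.

Lemma sh0r p s : sh p (fun=> 0) s = 0.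
Proof.
have := sh_linr (-1) p (fun=> 0) (fun=> 0) s.
by rewrite mulr0 addr0 mulN1r addNr.
Qed.

Lemma shZl (a : K) p q s : sh (fun t => a * p t) q s = a * sh p q s.
Proof.
have -> : (fun t => a * p t) = (fun t => a * p t + (fun=> 0) t).
  by apply/funext => t; rewrite addr0.
by rewrite sh_linl sh0l addr0.
Qed.

Lemma shZr (a : K) p q s : sh p (fun t => a * q t) s = a * sh p q s.
Proof.
have -> : (fun t => a * q t) = (fun t => a * q t + (fun=> 0) t).
  by apply/funext => t; rewrite addr0.
by rewrite sh_linr sh0r addr0.
Qed.

Lemma shDl p p' q s : sh (fun t => p t + p' t) q s = sh p q s + sh p' q s.
Proof.
have -> : (fun t => p t + p' t) = (fun t => 1 * p t + p' t).
  by apply/funext => t; rewrite mul1r.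
by rewrite sh_linl mul1r.
Qed.

Lemma shDr p q q' s : sh p (fun t => q t + q' t) s = sh p q s + sh p q' s.
Proof.
have -> : (fun t => q t + q' t) = (fun t => 1 * q t + q' t).
  by apply/funext => t; rewrite mul1r.
by rewrite sh_linr mul1r.
Qed.

Lemma sh_suml (I : Type) (l : seq I) (F : I -> seq H -> K) q s :
  sh (fun t => \sum_(i <- l) F i t) q s = \sum_(i <- l) sh (F i) q s.
Proof.
elim: l => [|i l IH].
  by rewrite big_nil -[RHS](sh0l q s); congr sh; apply/funext => t; rewrite big_nil.
rewrite big_cons -IH -shDl; congr sh.
by apply/funext => t; rewrite big_cons.
Qed.

Lemma sh_sumr (I : Type) (l : seq I) (F : I -> seq H -> K) p s :
  sh p (fun t => \sum_(i <- l) F i t) s = \sum_(i <- l) sh p (F i) s.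
Proof.
elim: l => [|i l IH].
  by rewrite big_nil -[RHS](sh0r p s); congr sh; apply/funext => t; rewrite big_nil.
rewrite big_cons -IH -shDr; congr sh.
by apply/funext => t; rewrite big_cons.
Qed.

Lemma tw_comm d d' p : tw d (tw d' p) = tw d' (tw d p).
Proof. by apply/funext => t; rewrite /tw mulrCA. Qed.

Lemma ins_tw d v p : ins v (tw d p) = fun t => (-1) ^+ (d * hdeg v) * tw d (ins v p) t.
Proof.
by apply/funext => t; rewrite /ins /tw sdeg_cons mulnDr exprD mulrA.
Qed.

(** The degree is additive under splitting s into subsequences, so [tw d], a power of the grading
    automorphism, is multiplicative. Associativity rests on this. *)
Lemma tw_sh d p q : tw d (sh p q) = sh (tw d p) (tw d q).
Proof.
apply/funext => s; rewrite {1}/tw.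
elim: s p q => [|v s IH] p q.
  by rewrite !sh_nil /tw muln0 expr0 !mul1r.
rewrite !sh_cons !ins_tw shZl shZr sdeg_cons mulnDr exprD -mulrA mulrDr !IH.
by rewrite mulrDr tw_comm.
Qed.

(** Inserting v in either product gives the same three terms, with v in p, in q or in r; [tw_sh]
    matches the twists. *)
Lemma shA p q r s : sh (sh p q) r s = sh p (sh q r) s.
Proof.
elim: s p q r => [|v s IH] p q r; first by rewrite !sh_nil mulrA.
rewrite !sh_cons !ins_sh shDl shDr tw_sh !IH.
by rewrite addrA.
Qed.

Definition hom p (k : int) := forall s, (sdeg s)%:Z != k -> p s = 0.

Lemma hom_ins p k v : hom p k -> hom (ins v p) (k - (hdeg v)%:Z).
Proof.
move=> pk s sk; apply: pk; apply: contra sk => /eqP <-.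
by rewrite sdeg_cons PoszD addrC addKr.
Qed.

Lemma hom_tw p k d : hom p k -> hom (tw d p) k.
Proof. by move=> pk s /pk ps; rewrite /tw ps mulr0. Qed.

Lemma hom_twE p k d : hom p k -> tw d p = fun t => zsign K (d%:Z * k) * p t.
Proof.
move=> pk; apply/funext => t; rewrite /tw.
have [tk|/pk ->] := eqVneq (sdeg t)%:Z k; last by rewrite !mulr0.
by rewrite -tk -PoszM.
Qed.

Lemma hom_sh p q k l : hom p k -> hom q l -> hom (sh p q) (k + l).
Proof.
move=> pk ql s; elim: s p q k l pk ql => [|v s IH] p q k l pk ql skl.
  rewrite sh_nil; have [k0|k0] := eqVneq k 0; last first.
    by rewrite pk ?mul0r // eq_sym.
  rewrite ql ?mulr0 //; apply: contra skl => /eqP <-.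
  by rewrite k0.
rewrite sh_cons (IH _ _ _ _ (hom_ins (v := v) pk) ql); last first.
  by apply: contra skl => /eqP E'; rewrite sdeg_cons PoszD E'; apply/eqP; ring.
rewrite (IH _ _ _ _ (hom_tw (hdeg v) pk) (hom_ins (v := v) ql)) ?addr0 //.
by apply: contra skl => /eqP E'; rewrite sdeg_cons PoszD E'; apply/eqP; ring.
Qed.

(** Homogeneity turns the twists into scalar signs; the two terms of the Leibniz rule for one
    product then match those for the other crosswise. *)
Lemma shC p q k l s : hom p k -> hom q l ->
  sh p q s = zsign K (k * l) * sh q p s.
Proof.
elim: s p q k l => [|v s IH] p q k l pk ql.
  rewrite !sh_nil (mulrC (q _)).
  have [k0|k0] := eqVneq k 0; last by rewrite pk ?mul0r ?mulr0 // eq_sym.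
  by rewrite k0 mul0r /zsign expr0z mul1r.
rewrite !sh_cons mulrDr (hom_twE _ pk) (hom_twE _ ql) !shZl.
rewrite (IH _ _ _ _ (hom_ins (v := v) pk) ql) (IH _ _ _ _ pk (hom_ins (v := v) ql)).
rewrite addrC !mulrA -!zsignD.
have S1 : zsign K ((hdeg v)%:Z * k + k * (l - (hdeg v)%:Z)) = zsign K (k * l).
  by congr zsign; ring.
have S2 : zsign K ((k - (hdeg v)%:Z) * l) = zsign K (k * l + (hdeg v)%:Z * l).
  rewrite zsignD -[zsign K ((hdeg v)%:Z * l)]zsignN -zsignD.
  by congr zsign; ring.
by rewrite S1 S2.
Qed.

Definition unit_form (a : K) : seq H -> K := fun t => if t is [::] then a else 0.

Lemma sh_unitl a q s : sh (unit_form a) q s = a * q s.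
Proof.
elim: s q => [|v s IH] q //.
rewrite sh_cons; have -> : ins v (unit_form a) = fun=> 0 by [].
have -> : tw (hdeg v) (unit_form a) = unit_form a.
  by apply/funext => -[|w t]; rewrite /tw /= ?mulr0 // muln0 expr0 mul1r.
by rewrite sh0l add0r IH.
Qed.

Definition gsym p := gsym_form (E := E) (F := K^o) p.

Lemma gsymP p : gsym p <->
  (forall s t i (a : K) (u v : E i x),
     p (s ++ hv (a *: u + v) :: t) =
     a * p (s ++ hv u :: t) + p (s ++ hv v :: t)) /\
  (forall s t u v,
     p (s ++ u :: v :: t) = (-1) ^+ (hdeg u * hdeg v) * p (s ++ v :: u :: t)).
Proof. by []. Qed.

Lemma gsym_ins p v : gsym p -> gsym (ins v p).
Proof. by move=> [p1 p2]; split=> s t *; [apply: (p1 (v :: s))|apply: (p2 (v :: s))]. Qed.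

(** Neither linearity in a slot nor an exchange of slots alters the length or the total degree.
    Covers both the twists and the factor in the Euler identity. *)
Lemma gsym_scale_deg (f : nat -> nat -> K) p :
  gsym p -> gsym (fun t => f (size t) (sdeg t) * p t).
Proof.
move=> /gsymP[p1 p2]; apply/gsymP; split=> s t.
  move=> i a u v; rewrite p1 !size_cat !sdeg_cat !sdeg_cons /= /hdeg /=.
  by rewrite mulrDr mulrCA.
move=> u v; rewrite p2 !size_cat !sdeg_cat !sdeg_cons /= mulrCA.
by rewrite (addnCA (hdeg v)).
Qed.

Lemma gsym_tw d p : gsym p -> gsym (tw d p).
Proof. exact: (@gsym_scale_deg (fun _ k => (-1) ^+ (d * k))). Qed.

Lemma gsym0 : gsym (fun=> 0).
Proof. by apply/gsymP; split=> *; rewrite ?mulr0 ?addr0. Qed.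

Lemma gsym_lin (a : K) p q : gsym p -> gsym q -> gsym (fun t => a * p t + q t).
Proof.
move=> /gsymP[p1 p2] /gsymP[q1 q2]; apply/gsymP; split=> s t *.
  by rewrite p1 q1; ring.
by rewrite p2 q2; ring.
Qed.

Lemma gsym_sum (I : Type) (l : seq I) (F : I -> seq H -> K) :
  (forall i, gsym (F i)) -> gsym (fun t => \sum_(i <- l) F i t).
Proof.
move=> gF; elim: l => [|i l IH].
  by have := gsym0; congr gsym; apply/funext => t; rewrite big_nil.
have := gsym_lin 1 (gF i) IH; congr gsym; apply/funext => t.
by rewrite big_cons mul1r.
Qed.

Lemma gsym_unit a : gsym (unit_form a).
Proof. by apply/gsymP; split=> -[|w s] t *; rewrite /= ?mulr0 ?addr0. Qed.

Lemma gsym_sh p q : gsym p -> gsym q -> gsym (sh p q).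
Proof.
move=> gp gq; apply/gsymP; split=> s; elim: s p q gp gq => [|w s IH] p q gp gq t.
- move=> i a u v; rewrite /= !sh_cons.
  have -> : ins (hv (a *: u + v)) p = fun t => a * ins (hv u) p t + ins (hv v) p t.
    by apply/funext => t'; have [p1 _] := gp; exact: (p1 [::]).
  have -> : ins (hv (a *: u + v)) q = fun t => a * ins (hv u) q t + ins (hv v) q t.
    by apply/funext => t'; have [q1 _] := gq; exact: (q1 [::]).
  by rewrite sh_linl sh_linr /hdeg /=; ring.
- move=> i a u v; rewrite /= !sh_cons IH //; last exact: gsym_ins.
  by rewrite IH; [ring|exact: gsym_tw|exact: gsym_ins].
(* Two insertions into a product give four terms; exchanging u and v gives the sign on each of them
   and swaps the two mixed ones. *)
- have I2 r u v : gsym r -> ins v (ins u r) =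
      fun t => (-1) ^+ (hdeg u * hdeg v) * ins u (ins v r) t.
    by move=> [_ r2]; apply/funext => t'; exact: (r2 [::]).
  move=> u v; rewrite /= !sh_cons (I2 p u v gp) (I2 q u v gq).
  rewrite !ins_tw !shZl !shZr (tw_comm (hdeg v)) (mulnC (hdeg v)).
  have S : (-1) ^+ (hdeg u * hdeg v) * (-1) ^+ (hdeg u * hdeg v) = 1 :> K.
    by rewrite -exprMn mulrNN mulr1 expr1n.
  rewrite !mulrDr !mulrA S !mul1r.
  by rewrite addrACA.
- move=> u v; rewrite /= !sh_cons (IH _ _ (gsym_ins w gp) gq).
  by rewrite (IH _ _ (gsym_tw (hdeg w) gp) (gsym_ins w gq)); ring.
Qed.

(** Expanding the pairing of vectors and covectors in coordinates [lam] reduces the vector-valued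
    shuffle in [vert] to scalar products. *)
Lemma shuffle_pair i (I : Type) (l : seq I) (lam : I -> E i x -> K)
    (p : seq H -> E i x) (q : seq H -> E i x -> K) (qj : I -> seq H -> K) s :
  (forall j (a : K) e, lam j (a *: e) = a * lam j e) ->
  (forall t e, q t e = \sum_(j <- l) lam j e * qj j t) ->
  shuffle (A := E i x) (C := K^o) (fun e (phi : E i x -> K) => phi e) p q s =
  \sum_(j <- l) sh (fun t => lam j (p t)) (qj j) s.
Proof.
move=> lamZ; elim: s p q qj => [|v s IH] p q qj qE /=; first exact: qE.
under eq_bigr => j _ do rewrite sh_cons.
rewrite big_split /=; congr (_ + _); first exact: IH.
rewrite (IH _ _ (fun j => ins v (qj j))) //.
apply: eq_bigr => j _; congr sh; apply/funext => t.
by rewrite lamZ.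
Qed.

End ShuffleAlgebra.

(** * Frames *)

Section Bundle.
Variables (R : realType) (c : funclass) (M : manifold R c).
Local Notation K := (base_field R c).

(** A frame together with its dual coframe [cf]. Natural numbers below r serve as indices, so that
    frames of different ranks share one type. *)
Definition lframe (B : M -> lmodType K) (regB : set M -> (forall x, B x) -> Prop)
    (U : set M) (r : nat) (e : nat -> forall x, B x)
    (cf : forall x, B x -> nat -> K) : Prop :=
  [/\ forall x (v : B x), U x -> v = \sum_(0 <= j < r) cf x v j *: e j x,
      forall x a (u v : B x) j, U x ->
        cf x (a *: u + v) j = a * cf x u j + cf x v j,
      forall x j k, U x -> (j < r)%N -> (k < r)%N ->
        cf x (e j x) k = (j == k)%:R
    & forall V s, open V -> V `<=` U ->
        (regB V s <-> forall j, (j < r)%N -> functions V (fun x => cf x (s x) j))].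

Lemma lframe_exists (B : M -> lmodType K) regB (vB : is_vbundle (fib := B) regB) x0 :
  exists U r e cf, [/\ open U, U x0 & lframe regB U r e cf].
Proof.
have [U [r [e [oU Ux0 basis regP]]]] := vb_frame vB x0.
pose e' j x : B x := if insub j is Some k then e k x else 0.
(* [xget] picks the coordinates, with default 0 where none exist; over U uniqueness makes the choice
   linear. *)
pose co x (v : B x) : 'rV[K]_r := xget 0 [set a : 'rV[K]_r | v = \sum_j a 0 j *: e j x].
pose cf x (v : B x) j : K := if insub j is Some k then co x v 0 k else 0.
have e'E (j : 'I_r) x : e' j x = e j x by rewrite /e' valK.
have cfE x (v : B x) (j : 'I_r) : cf x v j = co x v 0 j by rewrite /cf valK.
have coP x (v : B x) : U x -> v = \sum_j co x v 0 j *: e j x.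
  move=> Ux; have [a [va _]] := basis x Ux v.
  by rewrite /co; case: xgetP => [b -> //|/(_ a)]; case.
have coU x (v : B x) (a : 'rV[K]_r) : U x -> v = \sum_j a 0 j *: e j x -> co x v = a.
  move=> Ux va; have [b [_ bu]] := basis x Ux v.
  by rewrite -(bu _ va) -(bu _ (coP x v Ux)).
exists U, r, e', cf; split=> //; split.
- move=> x v Ux; rewrite big_mkord {1}(coP x v Ux).
  by apply: eq_bigr => j _; rewrite cfE e'E.
- move=> x a u v j Ux; rewrite /cf; case: insubP => [k _ _|_]; last first.
    by rewrite mulr0 addr0.
  rewrite (coU _ _ (a *: co x u + co x v) Ux) ?mxE //.
  rewrite {1}(coP x u Ux) {1}(coP x v Ux) scaler_sumr -big_split /=.
  by apply: eq_bigr => l _; rewrite !mxE scalerDl scalerA.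
- move=> x j k Ux jr kr; rewrite -[j]/(val (Ordinal jr)) -[k]/(val (Ordinal kr)).
  rewrite e'E cfE (coU _ _ (delta_mx 0 (Ordinal jr)) Ux) ?mxE //=.
    by rewrite eq_sym.
  rewrite (bigD1 (Ordinal jr)) //= mxE !eqxx scale1r big1 ?addr0 // => l.
  by move=> /negbTE lj; rewrite mxE lj andbF scale0r.
- move=> V s oV VU; rewrite regP //; split.
    move=> [a [fa sa]] j jr; apply: functions_agree oV _ (fa (Ordinal jr)).
    move=> x Vx; rewrite -[j]/(val (Ordinal jr)) cfE.
    rewrite (coU _ _ (\row_k a k x) (VU _ Vx)) ?mxE // sa //.
    by apply: eq_bigr => l _; rewrite mxE.
  move=> fs; exists (fun j x => cf x (s x) j); split.
    by move=> j; exact: fs.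
  move=> x Vx; rewrite {1}(coP _ (s x) (VU _ Vx)).
  by apply: eq_bigr => l _; rewrite cfE.
Qed.

Variables (B : vbundle M).
Implicit Types (s t : forall x, B x).

Lemma reg_local U s : open U ->
  (forall x, U x -> exists V, [/\ open V, V x, V `<=` U & reg V s]) -> reg U s.
Proof. by move=> oU H; apply: (vb_glue (vbundleP B)) => // x /H. Qed.

Lemma reg_restrict U V s : open U -> open V -> V `<=` U -> reg U s -> reg V s.
Proof. exact: (vb_restrict (vbundleP B)). Qed.

(** Gluing makes regularity a condition on coordinates near each point, so closure properties of
    sections come from those of functions. *)
Lemma reg_by_frame U s : open U ->
  (forall x0, U x0 -> exists V r e cf, [/\ open V, V x0,
     lframe (@reg _ _ _ B) V r e cf &
     forall j, (j < r)%N -> functions (U `&` V) (fun x => cf x (s x) j)]) ->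
  reg U s.
Proof.
move=> oU H; apply: reg_local => // x Ux; have [V [r [e [cf [oV Vx [_ _ _ fV] fs]]]]] := H x Ux.
exists (U `&` V); split=> //; first exact: openI.
by apply/fV => //; exact: openI.
Qed.

Lemma reg_agree U s t : open U -> agree U s t -> reg U s -> reg U t.
Proof.
move=> oU st rs; apply: reg_by_frame => // x Ux.
have [V [r [e [cf [oV Vx fV]]]]] := lframe_exists (vbundleP B) x.
exists V, r, e, cf; split=> // j jr.
have oUV : open (U `&` V) by exact: openI.
have [_ _ _ /(_ _ s oUV (@subIsetr _ _ _)) [Fs _]] := fV.
have rs' : reg (U `&` V) s by apply: reg_restrict rs.
apply: functions_agree oUV _ (Fs rs' j jr).
by move=> y [Uy _]; rewrite st.
Qed.

Lemma reg_lin U f s t : open U -> functions U f -> reg U s -> reg U t ->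
  reg U (fun x => f x *: s x + t x).
Proof.
move=> oU ff rs rt; apply: reg_by_frame => // x Ux.
have [V [r [e [cf [oV Vx fV]]]]] := lframe_exists (vbundleP B) x.
exists V, r, e, cf; split=> // j jr.
have oUV : open (U `&` V) by exact: openI.
have [_ F2 _ F4] := fV.
have rs' : reg (U `&` V) s by apply: reg_restrict rs.
have rt' : reg (U `&` V) t by apply: reg_restrict rt.
have fs := (F4 _ s oUV (@subIsetr _ _ _)).1 rs' j jr.
have ft := (F4 _ t oUV (@subIsetr _ _ _)).1 rt' j jr.
have ff' : functions (U `&` V) f by apply: functions_sub ff.
apply: functions_agree oUV _ (functionsD oUV (functionsM oUV ff' fs) ft).
by move=> y [_ Vy]; rewrite F2.
Qed.

Lemma reg0 U : open U -> reg U (fun x => 0 : B x).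
Proof.
move=> oU; apply: reg_by_frame => // x Ux.
have [V [r [e [cf [oV Vx fV]]]]] := lframe_exists (vbundleP B) x.
exists V, r, e, cf; split=> // j jr.
have oUV : open (U `&` V) by exact: openI.
apply: functions_agree oUV _ (functions_cst _ 0) => y [_ Vy].
have [_ F2 _ _] := fV; have := F2 y (-1) 0 0 j Vy.
by rewrite scaler0 addr0 mulN1r addNr.
Qed.

Lemma regZ U f s : open U -> functions U f -> reg U s ->
  reg U (fun x => f x *: s x).
Proof.
move=> oU ff rs; apply: reg_agree (reg_lin oU ff rs (reg0 oU)) => //.
by move=> x _; rewrite addr0.
Qed.

Lemma reg_sum U (I : Type) (l : seq I) (F : I -> forall x, B x) : open U ->
  (forall i, reg U (F i)) -> reg U (fun x => \sum_(i <- l) F i x).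
Proof.
move=> oU rF; elim: l => [|i l IH].
  by apply: reg_agree (reg0 oU) => // x _; rewrite big_nil.
apply: reg_agree (reg_lin oU (functions_cst U 1) (rF i) IH) => // x _.
by rewrite big_cons scale1r.
Qed.

End Bundle.

Section FrameSystems.
Variables (R : realType) (c : funclass) (M : manifold R c).
Local Notation K := (base_field R c).
Variable E : nat -> vbundle M.

(* Local frames of all the E i at once, indexed by natural numbers; [cf] gives
   the coordinates. *)
Record frame_system (U : set M) (N : nat) := FrameSystem {
  rk : nat -> nat;
  fv : forall (i j : nat) (x : M), E i x;
  cf : forall (i : nat) (x : M), E i x -> nat -> K;
  rk0 : forall i, (N <= i)%N -> rk i = 0%N;
  frameP : forall i, lframe (@reg _ _ _ (E i)) U (rk i) (fv i) (@cf i) }.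

Definition vanish_from (N : nat) := forall i x (v : E i x), (N <= i)%N -> v = 0.

Lemma lframe_restrict (B : vbundle M) U V r (e : nat -> forall x, B x) cf : V `<=` U ->
  lframe (@reg _ _ _ B) U r e cf -> lframe (@reg _ _ _ B) V r e cf.
Proof.
move=> VU [F1 F2 F3 F4]; split.
- by move=> x v /VU; exact: F1.
- by move=> x a u v j /VU; exact: F2.
- by move=> x j k /VU; exact: F3.
- by move=> W s oW WV; apply: F4 => //; exact: subset_trans WV VU.
Qed.

(** Only finitely many neighbourhoods are intersected, one for each index below N; the other
    components vanish and carry the empty frame. *)
Lemma frame_system_exists N (x0 : M) : vanish_from N ->
  exists (U : set M) (F : frame_system U N), open U /\ U x0.
Proof.
move=> E0.
have [W HW] := boolp.choice (fun i => lframe_exists (vbundleP (E i)) x0).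
have [U [oU Ux0 UW]] : exists U, [/\ open U, U x0 &
    forall i, (i < N)%N -> U `<=` W i].
  elim: N {E0} => [|N [U [oU Ux0 UW]]]; first by exists setT; split=> //; exact: openT.
  have [_ [_ [_ [oW Wx0 _]]]] := HW N.
  exists (U `&` W N); split; [exact: openI|by []|].
  move=> i; rewrite ltnS leq_eqVlt => /orP[/eqP ->|iN]; first exact: subIsetr.
  by apply: subset_trans (UW i iN); exact: subIsetl.
pose P i (t : nat * (nat -> forall x, E i x) * (forall x, E i x -> nat -> K)) :=
  ((N <= i)%N -> t.1.1 = 0%N) /\ lframe (@reg _ _ _ (E i)) U t.1.1 t.1.2 t.2.
have H i : {t | P i t}.
  apply: cid; have [Ni|iN] := leqP N i.
    exists (0%N, (fun _ _ => 0), (fun _ _ _ => 0)); split=> //; split=> //=.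
    - by move=> x v _; rewrite big_geq // (E0 i x v).
    - by move=> *; rewrite mulr0 addr0.
    - move=> V s oV _; split=> // _; apply: reg_agree (reg0 _ oV) => // x _.
      by rewrite (E0 i x (s x)).
  have [r [e [cf [oW Wx0 fr]]]] := HW i.
  exists (r, e, cf); split=> /=; first by rewrite leqNgt iN.
  exact: lframe_restrict (UW i iN) fr.
exists U; unshelve eexists; last by [].
by apply: (@FrameSystem U N (fun i => (sval (H i)).1.1)
  (fun i => (sval (H i)).1.2) (fun i => (sval (H i)).2)) => i;
  have [H1 H2] := svalP (H i).
Qed.

Variables (U : set M) (N : nat) (F : frame_system U N).

Definition idx : seq (nat * nat) :=
  [seq (i, j) | i <- index_iota 0 N, j <- index_iota 0 (rk F i)].

Definition ev (k : nat * nat) (x : M) : hvec E x := hv (fv F k.1 k.2 x).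

(** The coframe element of index k on a homogeneous vector: it vanishes on the other components. *)
Definition co (k : nat * nat) (x : M) (v : hvec E x) : K :=
  if tag v == k.1 then cf F (tagged v) k.2 else 0.

Lemma mem_idx k : (k \in idx) = (k.2 < rk F k.1)%N.
Proof.
apply/allpairsPdep/idP => [[i [j [iN jr ->]]]|kr]; first by move: jr; rewrite mem_index_iota.
exists k.1, k.2; split; [|by rewrite mem_index_iota|by case: (k)].
rewrite mem_index_iota /=; case: (ltnP k.1 N) => // /(rk0 F) r0.
by rewrite r0 in kr.
Qed.

Lemma idx_uniq : uniq idx.
Proof.
apply: allpairs_uniq_dep => [|i _|]; try exact: iota_uniq.
by move=> /= [i j] [i' j'] _ _ /= [-> ->].
Qed.

Lemma sum_idx (V : zmodType) (G : nat * nat -> V) :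
  \sum_(k <- idx) G k = \sum_(0 <= i < N) \sum_(0 <= j < rk F i) G (i, j).
Proof. by rewrite /idx big_allpairs_dep. Qed.

Lemma cf_lin i x (a : K) (u v : E i x) j : U x ->
  cf F (a *: u + v) j = a * cf F u j + cf F v j.
Proof. by move=> Ux; have [_ F2 _ _] := frameP F i; exact: F2. Qed.

Lemma cf0 i x j : U x -> cf F (0 : E i x) j = 0.
Proof.
move=> Ux; have := cf_lin (-1) (0 : E i x) 0 j Ux.
by rewrite scaler0 addr0 mulN1r addNr.
Qed.

Lemma cfZ i x (a : K) (u : E i x) j : U x -> cf F (a *: u) j = a * cf F u j.
Proof. by move=> Ux; have := cf_lin a u 0 j Ux; rewrite !addr0 cf0 // addr0. Qed.

Lemma cf_sum i x (I : Type) (l : seq I) (a : I -> K) (u : I -> E i x) j : U x ->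
  cf F (\sum_(k <- l) a k *: u k) j = \sum_(k <- l) a k * cf F (u k) j.
Proof.
move=> Ux; elim: l => [|k l IH]; first by rewrite !big_nil cf0.
by rewrite !big_cons cf_lin // IH.
Qed.

Lemma cf_frame i x j k : U x -> (j < rk F i)%N -> (k < rk F i)%N ->
  cf F (fv F i j x) k = (j == k)%:R.
Proof. by move=> Ux; have [_ _ F3 _] := frameP F i; exact: F3. Qed.

Lemma frame_expand i x (v : E i x) : U x ->
  v = \sum_(0 <= j < rk F i) cf F v j *: fv F i j x.
Proof. by move=> Ux; have [F1 _ _ _] := frameP F i; exact: F1. Qed.

Lemma reg_frame i V s : open V -> V `<=` U ->
  (reg (v := E i) V s <->
   forall j, (j < rk F i)%N -> functions V (fun x => cf F (s x) j)).
Proof. by have [_ _ _ F4] := frameP F i; exact: F4. Qed.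

Lemma reg_fv i j V : open V -> V `<=` U -> (j < rk F i)%N -> reg V (fv F i j).
Proof.
move=> oV VU jr; apply/reg_frame => // k kr.
apply: functions_agree oV _ (functions_cst V (j == k)%:R) => x Vx.
by rewrite cf_frame //; exact: VU.
Qed.

Lemma co_ev k l x : U x -> k \in idx -> l \in idx ->
  co l (ev k x) = (k == l)%:R.
Proof.
move=> Ux; rewrite !mem_idx /co /=; case: k l => [i j] [i' j'] /=.
case: eqVneq => [<- jr j'r|ii' _ _]; last by rewrite xpair_eqE (negbTE ii').
by rewrite cf_frame // xpair_eqE eqxx.
Qed.

Lemma form_frame_sum x (p : seq (hvec E x) -> K) s t i (I : Type) (l : seq I)
    (a : I -> K) (u : I -> E i x) :
  (forall (b : K) (w z : E i x), p (s ++ hv (b *: w + z) :: t) =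
     b * p (s ++ hv w :: t) + p (s ++ hv z :: t)) ->
  p (s ++ hv (\sum_(k <- l) a k *: u k) :: t) =
  \sum_(k <- l) a k * p (s ++ hv (u k) :: t).
Proof.
move=> plin; elim: l => [|k l IH]; last by rewrite !big_cons plin IH.
rewrite !big_nil; have := plin (-1) 0 0.
by rewrite scaler0 addr0 mulN1r addNr.
Qed.

(* The slot v may lie in any component of the graded bundle: those of index
   at least N vanish. *)
Lemma form_expand x (p : seq (hvec E x) -> K) s v t : U x ->
  (forall i (b : K) (w z : E i x), p (s ++ hv (b *: w + z) :: t) =
     b * p (s ++ hv w :: t) + p (s ++ hv z :: t)) ->
  p (s ++ v :: t) = \sum_(k <- idx) co k v * p (s ++ ev k x :: t).
Proof.
move=> Ux plin; case: v => i w; rewrite sum_idx.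
rewrite -[existT _ i w]/(hv w) {1}(frame_expand w Ux) form_frame_sum //.
have [iN|Ni] := ltnP i N; last first.
  rewrite rk0 // big_geq // big_nat big1 // => i' /andP[_ i'N].
  rewrite big1 // => j _; rewrite /co /=; case: eqP => [ii'|]; last by rewrite mul0r.
  by have := leq_trans i'N Ni; rewrite -ii' ltnn.
rewrite [RHS](bigD1_seq i) ?mem_index_iota ?iota_uniq //= [X in _ + X]big1 ?addr0.
  by apply: eq_bigr => j _; rewrite /co /= eqxx.
move=> i' ii'; apply: big1 => j _.
by rewrite /co /= eq_sym (negbTE ii') mul0r.
Qed.

End FrameSystems.

(** * Graded functions and vertical vector fields *)

Arguments fmul {R c M E} w w' x s.
Arguments fconst {R c M E} f x s.
Arguments vert {R c M E} X V w x s.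
Arguments gcomm {R c M E} d d' D D' V w x s.

Section GradedFunctions.
Variables (R : realType) (c : funclass) (M : manifold R c).
Local Notation K := (base_field R c).
Variable E : nat -> vbundle M.
Implicit Types (U V W : set M) (w : fsec E) (X : forall x, L E x).

Definition reg_on V w := forall s : seq (bsec E), List.Forall (bsec_reg V) s ->
  functions V (fun x => w x (map (@bsec_at _ _ _ E ^~ x) s)).

Lemma reg_on_ins V w b : bsec_reg V b -> reg_on V w ->
  reg_on V (fun x => ins (bsec_at b x) (w x)).
Proof. by move=> rb rw s rs; apply: (rw (b :: s)); constructor. Qed.

Lemma sdeg_bsec x (s : seq (bsec E)) :
  sdeg (map (@bsec_at _ _ _ E ^~ x) s) = sumn (map (fun b : bsec E => (tag b).+1) s).
Proof. by rewrite /sdeg -map_comp. Qed.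

(** The factor is a constant function, since the length and the degree of a sequence of sections are
    the same at every point. *)
Lemma reg_on_scale_deg V (f : nat -> nat -> K) w : open V -> reg_on V w ->
  reg_on V (fun x t => f (size t) (sdeg t) * w x t).
Proof.
move=> oV rw s rs; apply: functions_agree oV _
  (functionsM oV (functions_cst V (f (size s)
    (sumn (map (fun b : bsec E => (tag b).+1) s)))) (rw s rs)).
by move=> x Vx; rewrite sdeg_bsec size_map.
Qed.

Lemma reg_on_tw V w d : open V -> reg_on V w -> reg_on V (fun x => tw d (w x)).
Proof. by move=> oV; exact: (@reg_on_scale_deg V (fun _ k => (-1) ^+ (d * k))). Qed.

Lemma reg_on_sh V w w' : open V -> reg_on V w -> reg_on V w' ->
  reg_on V (fun x => sh (w x) (w' x)).
Proof.
move=> oV rw rw' s; elim: s w w' rw rw' => [|b s IH] w w' rw rw' rs.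
  exact: functionsM oV (rw _ rs) (rw' _ rs).
have [rb rs'] := (proj1 (List.Forall_cons_iff _ _ _)) rs.
apply: functionsD => //; first by apply: IH => //; exact: reg_on_ins.
apply: (IH (fun x => tw (tag b).+1 (w x)) (fun x => ins (bsec_at b x) (w' x))) => //.
  exact: reg_on_tw.
exact: reg_on_ins.
Qed.

Lemma fun_degP U k w : fun_deg U k w <->
  [/\ forall x, U x -> gsym (w x), forall x, U x -> hom (w x) k
    & forall V, open V -> V `<=` U -> reg_on V w].
Proof.
split=> -[w1 w2 w3]; split=> //.
- by move=> x Ux s; exact: w2.
- by move=> V oV VU s; exact: w3.
- by move=> x s Ux; exact: w2.
- by move=> V s oV VU; exact: w3.
Qed.

Lemma fun_deg_sub U V k w : V `<=` U -> fun_deg U k w -> fun_deg V k w.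
Proof.
move=> VU /fun_degP[w1 w2 w3]; apply/fun_degP; split.
- by move=> x /VU; exact: w1.
- by move=> x /VU; exact: w2.
- by move=> W oW WV; apply: w3 => //; exact: subset_trans VU.
Qed.

Lemma fun_deg_agree U k w w' : agree U w w' -> fun_deg U k w -> fun_deg U k w'.
Proof.
move=> ww' /fun_degP[w1 w2 w3]; apply/fun_degP; split.
- by move=> x Ux; rewrite -ww' //; exact: w1.
- by move=> x Ux; rewrite -ww' //; exact: w2.
- move=> W oW WU s rs; apply: functions_agree oW _ (w3 W oW WU s rs).
  by move=> x /WU Ux; rewrite ww'.
Qed.

Lemma fun_deg_lin U k f w w' : functions U f -> fun_deg U k w -> fun_deg U k w' ->
  fun_deg U k (fun x s => f x * w x s + w' x s).
Proof.
move=> ff /fun_degP[w1 w2 w3] /fun_degP[v1 v2 v3]; apply/fun_degP; split.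
- by move=> x Ux; apply: gsym_lin; [exact: w1|exact: v1].
- by move=> x Ux s sk; rewrite w2 // v2 // mulr0 addr0.
- move=> W oW WU s rs; apply: functionsD (v3 W oW WU s rs) => //.
  by apply: functionsM (w3 W oW WU s rs) => //; exact: functions_sub ff.
Qed.

Lemma fun_deg0 U k : fun_deg U k (fun (x : M) (_ : seq (hvec E x)) => 0).
Proof.
apply/fun_degP; split=> *; [exact: gsym0|by []|].
by move=> s _; exact: functions_cst.
Qed.

Lemma fun_degZ U k f w : functions U f -> fun_deg U k w ->
  fun_deg U k (fun x s => f x * w x s).
Proof.
move=> ff fw; apply: fun_deg_agree (fun_deg_lin ff fw (fun_deg0 U k)) => x _.
by apply/funext => s; rewrite addr0.
Qed.

Lemma fun_deg_combine U k (a : K) w w' : fun_deg U k w -> fun_deg U k w' ->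
  fun_deg U k (fun x s => a * w x s + w' x s).
Proof. exact: fun_deg_lin (functions_cst U a). Qed.

Lemma fun_deg_fmul U k l w w' : fun_deg U k w -> fun_deg U l w' ->
  fun_deg U (k + l) (fmul w w').
Proof.
move=> /fun_degP[w1 w2 w3] /fun_degP[v1 v2 v3]; apply/fun_degP; split.
- by move=> x Ux; apply: gsym_sh; [exact: w1|exact: v1].
- by move=> x Ux; apply: hom_sh; [exact: w2|exact: v2].
- by move=> W oW WU; apply: reg_on_sh; [|exact: w3|exact: v3].
Qed.

Lemma fun_deg_fconst U f : functions U f -> fun_deg U 0 (fconst (E := E) f).
Proof.
move=> ff; apply/fun_degP; split.
- by move=> x _; exact: gsym_unit.
- by move=> x _ [|v s].
- move=> W oW WU [|b s] _; first exact: functions_sub ff.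
  exact: functions_cst.
Qed.

Lemma fun_deg_lt0 U k w x s : fun_deg U k w -> U x -> k < 0 -> w x s = 0.
Proof.
move=> /fun_degP[_ w2 _] Ux k0; apply: w2 => //.
by apply: contraTneq k0 => <-.
Qed.

Lemma fun_deg0E U w : fun_deg U 0 w -> agree U w (fconst (fun x => w x [::])).
Proof.
move=> /fun_degP[_ w2 _] x Ux; apply/funext => -[|v s] //=.
by apply: w2 => //; rewrite sdeg_cons /hdeg.
Qed.

Lemma fun_deg_nil U k w : open U -> fun_deg U k w -> functions U (fun x => w x [::]).
Proof.
by move=> oU /fun_degP[_ _ w3]; exact: (w3 U oU (@subset_refl _ _) [::] (List.Forall_nil _)).
Qed.

Lemma fmul_fconst f w x s : fmul (fconst f) w x s = f x * w x s.
Proof. exact: sh_unitl. Qed.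

Lemma lvalP x (l : L E x) : lfib_axiom (lval l).
Proof. by case: l => l lP; apply/asboolP. Qed.

(** The product evaluates p only on subsequences of s, whose degrees are at most that of s. This
    justifies the range of the sum in [vert]. *)
Lemma hom_sh_lt x (p q : seq (hvec E x) -> K) k s :
  hom p k -> (sdeg s)%:Z < k -> sh p q s = 0.
Proof.
elim: s p q k => [|v s IH] p q k pk sk.
  by rewrite sh_nil pk ?mul0r // lt_eqF.
rewrite sh_cons (IH _ _ _ (hom_ins (v := v) pk)); last first.
  by move: sk; rewrite sdeg_cons PoszD ltrBrDr addrC.
rewrite (IH _ _ k) ?addr0 //; first exact: hom_tw.
by apply: le_lt_trans sk; rewrite sdeg_cons lez_nat leq_addl.
Qed.

(** * Vertical vector fields and the Euler identity in a frame *)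

Section InFrame.
Variables (U : set M) (N : nat) (F : frame_system E U N).

(** The coefficient form P of the term P (x) e in the expansion of l, where e is the frame vector of
    index k. *)
Definition Lco (k : nat * nat) x (l : L E x) : seq (hvec E x) -> K :=
  fun t => cf F (lval l t k.1) k.2.

Lemma gsym_Lco k x (l : L E x) : U x -> gsym (Lco k l).
Proof.
move=> Ux; have [[l1 l2] _] := lvalP l; apply/gsymP; split=> s t *.
  by rewrite /Lco l1 -cf_lin.
by rewrite /Lco l2 -cfZ.
Qed.

Lemma hom_Lco k x (l : L E x) : U x -> hom (Lco k l) k.1%:Z.
Proof.
move=> Ux s sk; have [_ l3] := lvalP l.
by rewrite /Lco l3 ?cf0 // -eqz_nat.
Qed.

Lemma reg_on_Lco k X V : k \in idx F -> open V -> V `<=` U -> Lreg V X ->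
  reg_on V (fun x => Lco k (X x)).
Proof.
rewrite mem_idx => kr oV VU rX s rs.
pose S y : E k.1 y := lval (X y) (map (@bsec_at _ _ _ E ^~ y) s) k.1.
by apply: (proj1 (reg_frame F S oV VU) _ _ kr); exact: rX.
Qed.

Lemma sum_nat_widen (V : zmodType) (G : nat -> V) m n : (m <= n)%N ->
  (forall i, (m <= i)%N -> G i = 0) -> \sum_(0 <= i < m) G i = \sum_(0 <= i < n) G i.
Proof.
move=> mn G0; rewrite (big_cat_nat (leq0n m) mn) /= [X in _ + X]big_nat.
by rewrite [X in _ + X]big1 ?addr0 // => i /andP[mi _]; exact: G0.
Qed.

Lemma vertE X V w x s : U x -> gsym (w x) ->
  vert X V w x s =
  \sum_(k <- idx F) sh (Lco k (X x)) (ins (ev F k x) (w x)) s.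
Proof.
move=> Ux gw; pose G i := \sum_(0 <= j < rk F i)
  sh (Lco (i, j) (X x)) (ins (ev F (i, j) x) (w x)) s.
transitivity (\sum_(0 <= i < (sdeg s).+1) G i).
  rewrite big_mkord; apply: eq_bigr => i _.
  apply: (@shuffle_pair _ _ _ _ _ _ _ (index_iota 0 (rk F i))
    (fun j e => cf F e j) _ _ (fun j => ins (ev F (val i, j) x) (w x))).
    by move=> j a e; rewrite cfZ.
  move=> t e; rewrite {1}(frame_expand F e Ux).
  by apply: (form_frame_sum (s := [::])) => b u v; have [w1 _] := gw; exact: (w1 [::]).
(* Beyond the degree of s the terms vanish by degree, beyond N for lack of frame vectors; both
   ranges are widened to their maximum. *)
rewrite sum_idx -/(G _); transitivity (\sum_(0 <= i < maxn N (sdeg s).+1) G i).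
  apply: sum_nat_widen => [|i si]; first exact: leq_maxr.
  rewrite /G big1 // => j _; apply: (@hom_sh_lt _ _ _ i%:Z); last by rewrite ltz_nat.
  exact: (hom_Lco (k := (i, j))).
apply/esym/sum_nat_widen => [|i Ni]; first exact: leq_maxl.
by rewrite /G rk0 // big_geq.
Qed.

(** Each term is a coefficient form times an insertion: the Leibniz rule of the insertion applies,
    and graded commutativity carries the coefficient form past w. *)
Lemma vert_leibniz X V k w w' x s : U x -> gsym (w x) -> gsym (w' x) ->
  hom (w x) k -> vert X V (fmul w w') x s =
  fmul (vert X V w) w' x s + (-1) ^ (-1 * k) * fmul w (vert X V w') x s.
Proof.
move=> Ux gw gw' hw; rewrite vertE //; last exact: gsym_sh.
have vE u : gsym (u x) -> vert X V u x = fun t =>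
    \sum_(k <- idx F) sh (Lco k (X x)) (ins (ev F k x) (u x)) t.
  by move=> gu; apply/funext => t; exact: vertE.
rewrite /fmul -!/(sh _ _ _) (vE _ gw) (vE _ gw') sh_suml sh_sumr mulr_sumr.
rewrite -big_split /=; apply: eq_bigr => l _.
rewrite ins_sh shDr shA (hom_twE _ hw); congr (_ + _).
rewrite -[X in _ = _ * X]shA.
have -> : sh (w x) (Lco l (X x)) = fun t => zsign K (k * l.1%:Z) * sh (Lco l (X x)) (w x) t.
  by apply/funext => t; rewrite (shC _ hw (hom_Lco (k := l) (X x) Ux)).
have -> : sh (fun t => zsign K ((hdeg (ev F l x))%:Z * k) * w x t)
    (ins (ev F l x) (w' x)) =
    (fun t => zsign K ((hdeg (ev F l x))%:Z * k) * sh (w x) (ins (ev F l x) (w' x)) t).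
  by apply/funext => t; rewrite shZl.
rewrite shZr shZl mulrA shA -/(zsign K _) -zsignD; congr (_ * _).
have -> : hdeg (ev F l x) = l.1.+1 by [].
(* The exponents to compare, (l.1 + 1) k from the insertion and - k + k l.1 from the exchange,
   differ by 2 k: the square of a sign inserted here absorbs it. *)
rewrite -[LHS]mulr1 -(zsignK K (-1 * k)) mulrA -zsignD -zsignD.
rewrite intS; congr zsign; ring.
Qed.

Definition xi (k : nat * nat) : fsec E :=
  fun x t => if t is [:: v] then co F k v else 0.

Arguments xi k x t : clear implicits.

Lemma co_lin k x i (a : K) (u v : E i x) : U x ->
  co F k (hv (a *: u + v)) = a * co F k (hv u) + co F k (hv v).
Proof.
move=> Ux; rewrite /co /=; case: ifP => _; last by rewrite mulr0 addr0.
exact: cf_lin.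
Qed.

Lemma hom_xi k x : hom (xi k x) k.1.+1%:Z.
Proof.
move=> [|v [|v' s]] //=; rewrite /sdeg /= addn0 /co /hdeg => vk.
by case: eqP => // vk'; rewrite vk' eqxx in vk.
Qed.

Lemma fun_deg_xi k V : k \in idx F -> V `<=` U -> fun_deg V k.1.+1%:Z (xi k).
Proof.
move=> kF VU; apply/fun_degP; split.
- move=> x /VU Ux; apply/gsymP; split.
    move=> [|v [|v' s]] [|v1 t] i a u u'; rewrite /= ?mulr0 ?addr0 //.
    exact: co_lin.
  by move=> [|v [|v' s]] t u u'; rewrite /= ?mulr0.
- by move=> x _; exact: hom_xi.
- move=> W oW WV [|b [|b' s]] rs /=; try exact: functions_cst.
  have [rb _] := (proj1 (List.Forall_cons_iff _ _ _)) rs.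
  rewrite /co /=; case: eqP => [bk|_]; last exact: functions_cst.
  apply: (proj1 (reg_frame F (tagged b) oW (subset_trans WV VU))) => //.
  by move: kF; rewrite mem_idx bk.
Qed.

(** The sum of [xi k] times insertion of [ev k] is the Euler field, which counts arity: inserting v
    either meets [xi k], and the frame expansion of v appears, or passes to p. The weight g is
    evaluated at the arity left after the insertion and can be chosen to cancel the count. *)
Lemma euler x (p : seq (hvec E x) -> K) (g : nat -> K) s : U x -> gsym p ->
  \sum_(k <- idx F) sh (xi k x) (fun t => g (size t) * ins (ev F k x) p t) s =
  (size s)%:R * g (size s).-1 * p s.
Proof.
move=> Ux; elim: s p g => [|v s IH] p g gp.
  by rewrite big1 ?mul0r ?mul0r // => k _; rewrite sh_nil mul0r.
under eq_bigr => k _ do rewrite sh_cons.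
rewrite big_split /=.
have -> : \sum_(k <- idx F) sh (ins v (xi k x))
    (fun t => g (size t) * ins (ev F k x) p t) s = g (size s) * p (v :: s).
  have [p1 _] := gp; rewrite -[v :: s]cat0s (form_expand F _ Ux (p1 [::] s)) mulr_sumr.
  apply: eq_bigr => k _; have -> : ins v (xi k x) = unit_form (co F k v).
    by apply/funext => -[].
  by rewrite sh_unitl mulrCA.
have -> : \sum_(k <- idx F) sh (tw (hdeg v) (xi k x))
    (ins v (fun t => g (size t) * ins (ev F k x) p t)) s =
    (size s)%:R * g (size s).-1.+1 * p (v :: s).
  (* Here v stays among the arguments of p, so the weight is taken at a length larger by one. *)
  rewrite -[p (v :: s)]/(ins v p s) -(IH _ (g \o S)); last exact: gsym_ins.
  apply: eq_bigr => k _.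
  rewrite (hom_twE _ (@hom_xi k x)) shZl -shZr; congr sh; apply/funext => t.
  rewrite /ins /=; have [_ p2] := gp.
  have -> : p (ev F k x :: v :: t) =
      (-1) ^+ (k.1.+1 * hdeg v) * p (v :: ev F k x :: t) by exact: (p2 [::]).
  rewrite -PoszM zsign_nat (mulnC (hdeg v)); set sg := _ ^+ _.
  have sg2 : sg * sg = 1 by rewrite /sg -expr2 sqrr_sign.
  transitivity (sg * sg * (g (size t).+1 * p (v :: ev F k x :: t))); first by ring.
  by rewrite sg2 mul1r.
case: s {IH} => [|v' s] /=; first by rewrite !mul0r addr0 mul1r.
by rewrite -mulrDl -[X in X + _]mul1r -mulrDl [1 + _]addrC natr1.
Qed.

(* The factor turns Euler's identity into w = sum_k xi k * wcomp w k. *)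
Definition wcomp w k : fsec E := fun x t => (size t).+1%:R^-1 * w x (ev F k x :: t).

Arguments wcomp w k x t : clear implicits.

Lemma fun_deg_wcomp V n w k : open V -> V `<=` U -> k \in idx F -> fun_deg V n w ->
  fun_deg V (n - k.1.+1%:Z) (wcomp w k).
Proof.
move=> oV VU kF /fun_degP[w1 w2 w3]; apply/fun_degP; split.
- move=> x Vx; apply: (@gsym_scale_deg _ _ _ _ _ (fun n _ => n.+1%:R^-1)).
  by apply: gsym_ins; exact: w1.
- move=> x Vx s sk; rewrite /wcomp -[w x _]/(ins (ev F k x) (w x) s).
  by rewrite (hom_ins (w2 x Vx)) // mulr0.
- move=> W oW WV; apply: (@reg_on_scale_deg _ (fun n _ => n.+1%:R^-1)) => //.
  apply: (reg_on_ins (b := existT (fun i => forall x, E i x) k.1 (fv F k.1 k.2))).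
    by apply: reg_fv => //; [exact: subset_trans VU|rewrite -mem_idx].
  exact: w3.
Qed.

Lemma fun_deg_decomp V n w : V `<=` U -> n != 0 -> fun_deg V n w ->
  agree V w (fun x s => \sum_(k <- idx F) fmul (xi k) (wcomp w k) x s).
Proof.
move=> VU n0 /fun_degP[w1 w2 w3] x Vx; apply/funext => s.
have := euler (fun n => n.+1%:R^-1) s (VU _ Vx) (w1 x Vx).
move=> /= e; rewrite [RHS]e; case: s e => [|v s] _ /=.
  (* On the empty sequence the Euler factor is 0, and so is w, its degree n being nonzero. *)
  by rewrite w2 ?mulr0 // eq_sym.
by rewrite mulfV ?mul1r // pnatr_eq0.
Qed.

End InFrame.

Arguments xi {U N} F k x t.
Arguments wcomp {U N} F w k x t.

(** * Sections of L as derivations *)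

Section Vertical.
Variables (N : nat) (vN : vanish_from E N).

Lemma Lreg_sub U V X : V `<=` U -> Lreg U X -> Lreg V X.
Proof.
by move=> VU rX W s i oW WV; apply: rX => //; exact: subset_trans VU.
Qed.

(** All three clauses can be checked near a point, where [vertE] presents the value as a finite sum
    of products. *)
Lemma fun_deg_vert U V k X w : open V -> V `<=` U -> Lreg U X ->
  fun_deg V k w -> fun_deg V (k - 1) (vert X V w).
Proof.
move=> oV VU rX /fun_degP[w1 w2 w3]; apply/fun_degP; split.
- move=> x Vx; have [W [F [oW Wx]]] := frame_system_exists x vN.
  have -> : vert X V w x = fun t =>
      \sum_(k <- idx F) sh (Lco F k (X x)) (ins (ev F k x) (w x)) t.
    by apply/funext => t; apply: vertE => //; exact: w1.
  apply: gsym_sum => i; apply: gsym_sh; first exact: gsym_Lco.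
  by apply: gsym_ins; exact: w1.
- move=> x Vx s sk; have [W [F [oW Wx]]] := frame_system_exists x vN.
  rewrite (vertE F) //; last exact: w1.
  rewrite big1 // => i _.
  apply: (hom_sh (hom_Lco F (k := i) (X x) Wx) (hom_ins (v := ev F i x) (w2 x Vx))).
  apply: contra sk => /eqP ->; apply/eqP.
  have -> : hdeg (ev F i x) = i.1.+1 by [].
  by rewrite intS; ring.
- move=> W oW WV s rs; apply: functions_local => x Wx.
  have [W' [F [oW' W'x]]] := frame_system_exists x vN.
  have oWW : open (W `&` W') by exact: openI.
  exists (W `&` W'); first by [].
  have rs' : List.Forall (bsec_reg (W `&` W')) s.
    apply: List.Forall_impl rs => b; apply: reg_restrict => //.
  have fl i : i \in idx F -> functions (W `&` W') (fun x =>
      sh (Lco F i (X x)) (ins (ev F i x) (w x)) (map (@bsec_at _ _ _ E ^~ x) s)).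
    move=> iF; apply: (reg_on_sh oWW) => //.
      apply: reg_on_Lco => //.
      by apply: Lreg_sub rX => y [/WV/VU].
    apply: (reg_on_ins (b := existT (fun i => forall x, E i x) i.1 (fv F i.1 i.2))).
      by apply: reg_fv => //; rewrite -mem_idx.
    by apply: w3 => // y [/WV].
  have := functions_sum (idx F) (P := fun i => i \in idx F) oWW fl.
  apply: functions_agree => // y [Wy W'y] /=.
  by rewrite (vertE F) -?big_seq //; apply: w1; exact: WV.
Qed.

Lemma vert_lin X V (f : M -> K) w w' x s : gsym (w x) -> gsym (w' x) ->
  vert X V (fun x s => f x * w x s + w' x s) x s =
  f x * vert X V w x s + vert X V w' x s.
Proof.
move=> gw gw'; have [W [F [oW Wx]]] := frame_system_exists x vN.
rewrite !(vertE F) //; last exact: gsym_lin.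
rewrite mulr_sumr -big_split /=; apply: eq_bigr => i _.
by rewrite -sh_linr.
Qed.

Lemma vert_linl X Y V (f : M -> K) w x s : gsym (w x) ->
  vert (fun x => f x *: X x + Y x) V w x s =
  f x * vert X V w x s + vert Y V w x s.
Proof.
move=> gw; have [W [F [oW Wx]]] := frame_system_exists x vN.
rewrite !(vertE F) // mulr_sumr -big_split /=; apply: eq_bigr => i _.
rewrite -sh_linl; congr sh; apply/funext => t.
by rewrite /Lco -cf_lin.
Qed.

Lemma vert_agree X Y V w x s : X x = Y x -> vert X V w x s = vert Y V w x s.
Proof. by move=> XY; rewrite /vert XY. Qed.

Lemma vert_agreer X V V' w w' x s : w x = w' x -> vert X V w x s = vert X V' w' x s.
Proof. by move=> ww'; rewrite /vert ww'. Qed.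

Lemma vert_derivation U X : open U -> Lreg U X -> is_derivation U (-1) (vert X).
Proof.
move=> oU rX; split.
- by move=> V k w oV VU fw; exact: fun_deg_vert oV VU rX fw.
- move=> V V' k w w' oV oV' V'V VU fw fw' ww' x V'x; apply/funext => s.
  by apply: vert_agreer; exact: ww'.
- move=> V k a w w' oV VU /fun_degP[w1 _ _] /fun_degP[v1 _ _] x Vx.
  apply/funext => s; apply: (@vert_lin X V (fun=> a)); [exact: w1|exact: v1].
- move=> V k k' w w' oV VU /fun_degP[w1 w2 _] /fun_degP[v1 _ _] x Vx.
  apply/funext => s; have [W [F [oW Wx]]] := frame_system_exists x vN.
  by apply: (vert_leibniz F) => //; [exact: w1|exact: v1|exact: w2].
Qed.

Lemma vert_vertical U X : is_vertical U (vert X).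
Proof.
move=> V k f w oV VU ff /fun_degP[w1 _ _] x Vx; apply/funext => s.
have := @vert_lin X V f w (fun _ _ => 0) x s (w1 x Vx) (@gsym0 _ _ _ E x).
have -> : vert X V (fun _ _ => 0) x s = 0.
  have [W [F [oW Wx]]] := frame_system_exists x vN.
  rewrite (vertE F) //; last exact: gsym0.
  by rewrite big1 // => i _; exact: sh0r.
by rewrite addr0 => <-; apply: vert_agreer; apply/funext => t; rewrite addr0.
Qed.

End Vertical.

End GradedFunctions.

Arguments xi {R c M E U N} F k x t.
Arguments wcomp {R c M E U N} F w k x t.

(** * Derivations of degree -1 *)

Section Derivations.
Variables (R : realType) (c : funclass) (M : manifold R c).
Local Notation K := (base_field R c).
Variable E : nat -> vbundle M.
Implicit Types (U V W : set M) (w : fsec E) (D : operator E) (d : int).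

Lemma fsec_ext w w' : (forall x s, w x s = w' x s) -> w = w'.
Proof.
by move=> H; apply: functional_extensionality_dep => x; apply/funext => s.
Qed.

Lemma derivation_sub U V d D : V `<=` U -> is_derivation U d D -> is_derivation V d D.
Proof.
move=> VU [D1 D2 D3 D4]; split.
- by move=> W k w oW WV; apply: D1 => //; exact: subset_trans VU.
- by move=> W W' k w w' oW oW' WW' WV; apply: D2 => //; exact: subset_trans VU.
- by move=> W k a w w' oW WV; apply: D3 => //; exact: subset_trans VU.
- by move=> W k k' w w' oW WV; apply: D4 => //; exact: subset_trans VU.
Qed.

Section OneDerivation.
Variables (U : set M) (d : int) (D : operator E) (dD : is_derivation U d D).
Arguments D : clear implicits.

(** Operators receive total families, so an identity that holds only over V cannot be rewritten
    under D; it goes through locality instead. *)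
Lemma der_agree V k w w' : open V -> V `<=` U -> fun_deg V k w ->
  agree V w w' -> agree V (D V w) (D V w').
Proof.
move=> oV VU fw ww'; apply: (der_restrict dD (k := k)) => //.
exact: fun_deg_agree fw.
Qed.

Lemma der_restrict_id V V' k w : open V -> open V' -> V' `<=` V -> V `<=` U ->
  fun_deg V k w -> agree V' (D V w) (D V' w).
Proof.
move=> oV oV' V'V VU fw; apply: (der_restrict dD (k := k)) => //.
exact: fun_deg_sub fw.
Qed.

(** The shape in which the graded Leibniz rule and [gcommE] present their two terms. *)
Lemma derDZ V k (a : K) w w' : open V -> V `<=` U ->
  fun_deg V k w -> fun_deg V k w' ->
  agree V (D V (fun x s => w x s + a * w' x s))
    (fun x s => D V w x s + a * D V w' x s).
Proof.
move=> oV VU fw fw' x Vx; apply/funext => s; rewrite addrC.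
rewrite -[RHS](congr1 (@^~ s) (der_linear dD a oV VU fw' fw Vx)).
congr (D V _ x s); apply: fsec_ext => y t.
by rewrite addrC.
Qed.

Lemma der0 V : open V -> V `<=` U ->
  agree V (D V (fun _ _ => 0)) (fun _ _ => 0).
Proof.
move=> oV VU x Vx; apply/funext => s.
have f0 := @fun_deg0 _ _ _ E V 0.
have := congr1 (@^~ s) (derDZ (-1) oV VU f0 f0 Vx).
by rewrite mulr0 addr0 mulN1r subrr.
Qed.

Lemma der_sum V k (I : eqType) (l : seq I) (G : I -> fsec E) :
  open V -> V `<=` U -> (forall i, i \in l -> fun_deg V k (G i)) ->
  agree V (D V (fun x s => \sum_(i <- l) G i x s))
    (fun x s => \sum_(i <- l) D V (G i) x s).
Proof.
move=> oV VU; elim: l => [|i l IH] fG x Vx; apply/funext => s.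
  rewrite big_nil -[RHS](congr1 (@^~ s) (der0 oV VU Vx)).
  by congr (D V _ x s); apply: fsec_ext => y t; rewrite big_nil.
have fl : forall j, j \in l -> fun_deg V k (G j).
  by move=> j jl; apply: fG; rewrite in_cons jl orbT.
have fsum : fun_deg V k (fun x s => \sum_(j <- l) G j x s).
  elim: (l) fl => [|j l' IH'] fl.
    by apply: fun_deg_agree (fun_deg0 E V k) => y _; apply/funext => t; rewrite big_nil.
  have fj := fl j (mem_head _ _).
  have fl' : fun_deg V k (fun x s => \sum_(j <- l') G j x s).
    by apply: IH' => j' j'l; apply: fl; rewrite in_cons j'l orbT.
  apply: fun_deg_agree (fun_deg_combine 1 fj fl') => y _.
  by apply/funext => t; rewrite big_cons mul1r.
rewrite big_cons -(congr1 (@^~ s) (IH fl x Vx)).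
have := congr1 (@^~ s) (derDZ 1 oV VU (fG i (mem_head _ _)) fsum Vx).
rewrite mul1r => <-; congr (D V _ x s); apply: fsec_ext => y t.
by rewrite big_cons mul1r.
Qed.

End OneDerivation.

Lemma fmulDZl (a : K) w w' w'' x s :
  fmul (fun x s => w x s + a * w' x s) w'' x s =
  fmul w w'' x s + a * fmul w' w'' x s.
Proof. by rewrite /fmul -!/(sh _ _ _) shDl shZl. Qed.

Lemma fmulDZr (a : K) w w' w'' x s :
  fmul w'' (fun x s => w x s + a * w' x s) x s =
  fmul w'' w x s + a * fmul w'' w' x s.
Proof. by rewrite /fmul -!/(sh _ _ _) shDr shZr. Qed.

Lemma gcommE d d' D D' V w : gcomm d d' D D' V w =
  fun x s => D V (D' V w) x s + (- zsign K (d * d')) * D' V (D V w) x s.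
Proof.
by apply: fsec_ext => x s; rewrite mulNr.
Qed.

Section TwoDerivations.
Variables (U : set M) (d d' : int) (D D' : operator E).
Arguments D : clear implicits.
Arguments D' : clear implicits.
Hypotheses (dD : is_derivation U d D) (dD' : is_derivation U d' D').

Lemma fun_deg_comp V k w : open V -> V `<=` U -> fun_deg V k w ->
  fun_deg V (k + (d + d')) (D V (D' V w)).
Proof.
move=> oV VU fw; rewrite (addrC d) addrA.
by apply: (der_deg dD) => //; exact: (der_deg dD').
Qed.

Lemma comp_leibniz V k k' w w' x s : open V -> V `<=` U ->
  fun_deg V k w -> fun_deg V k' w' -> V x ->
  D V (D' V (fmul w w')) x s =
  fmul (D V (D' V w)) w' x s +
  zsign K (d * (k + d')) * fmul (D' V w) (D V w') x s +
  zsign K (d' * k) * (fmul (D V w) (D' V w') x s +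
    zsign K (d * k) * fmul w (D V (D' V w')) x s).
Proof.
move=> oV VU fw fw' Vx.
have D'w := der_deg dD' oV VU fw; have D'w' := der_deg dD' oV VU fw'.
have e1 := der_leibniz dD' oV VU fw fw'.
have f1 : fun_deg V (k + k' + d') (fmul (D' V w) w').
  by rewrite addrAC; exact: fun_deg_fmul.
have f2 : fun_deg V (k + k' + d') (fmul w (D' V w')).
  by rewrite -addrA; exact: fun_deg_fmul.
have fww := der_deg dD' oV VU (fun_deg_fmul fw fw').
rewrite (congr1 (@^~ s) (der_agree dD oV VU fww e1 Vx)).
rewrite (congr1 (@^~ s) (derDZ dD _ oV VU f1 f2 Vx)).
rewrite (congr1 (@^~ s) (der_leibniz dD oV VU D'w fw' Vx)).
by rewrite (congr1 (@^~ s) (der_leibniz dD oV VU fw D'w' Vx)).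
Qed.

End TwoDerivations.

(** * Graded commutators of derivations *)

Section Commutator.
Variables (U : set M) (d d' : int) (D D' : operator E).
Arguments D : clear implicits.
Arguments D' : clear implicits.
Hypotheses (dD : is_derivation U d D) (dD' : is_derivation U d' D').

Lemma fun_deg_gcomm V k w : open V -> V `<=` U -> fun_deg V k w ->
  fun_deg V (k + (d + d')) (gcomm d d' D D' V w).
Proof.
move=> oV VU fw; rewrite gcommE.
have f1 := fun_deg_comp dD dD' oV VU fw.
have f2 := fun_deg_comp dD' dD oV VU fw.
rewrite [d' + d]addrC in f2.
apply: fun_deg_agree (fun_deg_combine (- zsign K (d * d')) f2 f1) => x _.
by apply/funext => s; rewrite addrC.
Qed.

Lemma comp_restrict (D1 D2 : operator E) d1 d2 V V' k w w' :
  is_derivation U d1 D1 -> is_derivation U d2 D2 ->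
  open V -> open V' -> V' `<=` V -> V `<=` U ->
  fun_deg V k w -> fun_deg V' k w' -> agree V' w w' ->
  agree V' (D1 V (D2 V w)) (D1 V' (D2 V' w')).
Proof.
move=> dD1 dD2 oV oV' V'V VU fw fw' ww'.
have V'U := subset_trans V'V VU.
apply: (der_restrict dD1 oV oV' V'V VU (der_deg dD2 oV VU fw) (der_deg dD2 oV' V'U fw')).
by move=> x V'x; exact: (der_restrict dD2 oV oV' V'V VU fw fw' ww' V'x).
Qed.

Lemma comp_linear (D1 D2 : operator E) d1 d2 V k (a : K) w w' :
  is_derivation U d1 D1 -> is_derivation U d2 D2 -> open V -> V `<=` U ->
  fun_deg V k w -> fun_deg V k w' ->
  agree V (D1 V (D2 V (fun x s => a * w x s + w' x s)))
      (fun x s => a * D1 V (D2 V w) x s + D1 V (D2 V w') x s).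
Proof.
move=> dD1 dD2 oV VU fw fw' x Vx.
have e2 := der_linear dD2 a oV VU fw fw'.
have f2 := der_deg dD2 oV VU (fun_deg_combine a fw fw').
rewrite (der_agree dD1 oV VU f2 e2 Vx).
exact: (der_linear dD1 a oV VU (der_deg dD2 oV VU fw) (der_deg dD2 oV VU fw') Vx).
Qed.

(** In D D' applied to a product, the terms where D and D' hit different factors cancel against
    those of D' D. *)
Lemma gcomm_derivation : is_derivation U (d + d') (gcomm d d' D D').
Proof.
split.
- by move=> V k w oV VU; exact: fun_deg_gcomm.
- move=> V V' k w w' oV oV' V'V VU fw fw' ww' x V'x; apply/funext => s.
  rewrite /gcomm (comp_restrict dD dD' oV oV' V'V VU fw fw' ww' V'x).
  by rewrite (comp_restrict dD' dD oV oV' V'V VU fw fw' ww' V'x).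
- move=> V k a w w' oV VU fw fw' x Vx; apply/funext => s.
  rewrite /gcomm (comp_linear a dD dD' oV VU fw fw' Vx).
  by rewrite (comp_linear a dD' dD oV VU fw fw' Vx); ring.
- move=> V k k' w w' oV VU fw fw' x Vx; apply/funext => s.
  rewrite {1}gcommE (comp_leibniz dD dD' s oV VU fw fw' Vx).
  rewrite (comp_leibniz dD' dD s oV VU fw fw' Vx) !gcommE fmulDZl fmulDZr.
  rewrite -/(zsign K _) !mulrDr !mulrDl !zsignD [d' * d]mulrC.
  (* All signs are products of these three, which leaves eight cases. *)
  have [a ->] := zsign_bool K (d * k); have [b ->] := zsign_bool K (d' * k).
  have [e ->] := zsign_bool K (d * d').
  by case: a; case: b; case: e; rewrite ?expr1 ?expr0; ring.
Qed.

End Commutator.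

Lemma jacobi U d1 d2 d3 D1 D2 D3 V k w x s :
  is_derivation U d1 D1 -> is_derivation U d2 D2 -> is_derivation U d3 D3 ->
  open V -> V `<=` U -> fun_deg V k w -> V x ->
  gcomm d1 (d2 + d3) D1 (gcomm d2 d3 D2 D3) V w x s =
  gcomm (d1 + d2) d3 (gcomm d1 d2 D1 D2) D3 V w x s +
  zsign K (d1 * d2) * gcomm d2 (d1 + d3) D2 (gcomm d1 d3 D1 D3) V w x s.
Proof.
move=> dD1 dD2 dD3 oV VU fw Vx.
(* A commutator standing under a derivation is opened by linearity of the latter; an outermost one
   ([inner]) opens by definition. What remains is an identity of signs between triple
   compositions. *)
have outer e1 e2 e3 F1 F2 F3 : is_derivation U e1 F1 -> is_derivation U e2 F2 ->
    is_derivation U e3 F3 -> F1 V (gcomm e2 e3 F2 F3 V w) x s =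
    F1 V (F2 V (F3 V w)) x s - zsign K (e2 * e3) * F1 V (F3 V (F2 V w)) x s.
  move=> dF1 dF2 dF3; rewrite gcommE -mulNr.
  have f2 := fun_deg_comp dF3 dF2 oV VU fw; rewrite [e3 + e2]addrC in f2.
  by rewrite (congr1 (@^~ s) (derDZ dF1 _ oV VU (fun_deg_comp dF2 dF3 oV VU fw) f2 Vx)).
have inner e1 e2 F1 F2 v : gcomm e1 e2 F1 F2 V v x s =
    F1 V (F2 V v) x s - zsign K (e1 * e2) * F2 V (F1 V v) x s by [].
rewrite (inner d1) (outer d1 d2 d3) // (inner d2 d3).
rewrite (inner (d1 + d2)) (inner d1 d2) (outer d3 d1 d2) //.
rewrite (inner d2 (d1 + d3)) (outer d2 d1 d3) // (inner d1 d3).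
rewrite !mulrDl !mulrDr !zsignD [d2 * d1]mulrC.
have [a ->] := zsign_bool K (d1 * d2); have [b ->] := zsign_bool K (d1 * d3).
have [e ->] := zsign_bool K (d2 * d3).
by case: a; case: b; case: e; rewrite ?expr1 ?expr0; ring.
Qed.

Lemma gcomm_agree U d d' D1 D1' D2 D2' :
  is_derivation U d D1 -> is_derivation U d D1' ->
  is_derivation U d' D2 -> is_derivation U d' D2' ->
  op_agree U D1 D1' -> op_agree U D2 D2' ->
  op_agree U (gcomm d d' D1 D2) (gcomm d d' D1' D2').
Proof.
move=> dD1 dD1' dD2 dD2' a1 a2 V k w oV VU fw x Vx; apply/funext => s.
have f1 := der_deg dD1 oV VU fw; have f2 := der_deg dD2 oV VU fw.
rewrite /gcomm (der_agree dD1 oV VU f2 (a2 V k w oV VU fw) Vx).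
rewrite (der_agree dD2 oV VU f1 (a1 V k w oV VU fw) Vx).
rewrite (a1 V _ _ oV VU (der_deg dD2' oV VU fw) x Vx).
by rewrite (a2 V _ _ oV VU (der_deg dD1' oV VU fw) x Vx).
Qed.

Lemma op_agree_sym U D D' : op_agree U D D' -> op_agree U D' D.
Proof. by move=> H V k w oV VU fw x Vx; rewrite (H V k w). Qed.

Lemma op_agree_trans U D D' D'' : op_agree U D D' -> op_agree U D' D'' -> op_agree U D D''.
Proof. by move=> H H' V k w oV VU fw x Vx; rewrite (H V k w) // (H' V k w). Qed.

Lemma op_agree_sub U V D D' : V `<=` U -> op_agree U D D' -> op_agree V D D'.
Proof.
by move=> VU H W k w oW WV fw; apply: H fw => //; exact: subset_trans VU.
Qed.

(* A derivation of degree -1 kills functions for degree reasons. *)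
Lemma der_fconst U D V f : is_derivation U (-1) D -> open V -> V `<=` U ->
  functions V f -> agree V (D V (fconst f)) (fun _ _ => 0).
Proof.
move=> dD oV VU ff x Vx; apply/funext => s.
exact: fun_deg_lt0 (der_deg dD oV VU (fun_deg_fconst E ff)) Vx _.
Qed.

Lemma der_fscale U D V k f w : is_derivation U (-1) D -> open V -> V `<=` U ->
  functions V f -> fun_deg V k w ->
  agree V (D V (fun x s => f x * w x s)) (fun x s => f x * D V w x s).
Proof.
move=> dD oV VU ff fw x Vx; apply/funext => s.
have e : agree V (fun x s => f x * w x s) (fmul (fconst f) w).
  by move=> y _; apply/funext => t; rewrite fmul_fconst.
rewrite (der_agree dD oV VU (fun_degZ ff fw) e Vx).
rewrite (congr1 (@^~ s) (der_leibniz dD oV VU (fun_deg_fconst E ff) fw Vx)).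
rewrite mulr0 expr0z mul1r fmul_fconst /fmul -/(sh _ _ _).
by rewrite (der_fconst dD oV VU ff Vx) sh0l add0r.
Qed.

Definition arity1 w := forall x s, size s != 1%N -> w x s = 0.

Lemma arity1_xi U N (F : frame_system E U N) k : arity1 (xi F k).
Proof. by move=> x [|v [|v' s]]. Qed.

(** * Derivations and their values on functions and on the coframe *)

Section FiniteLength.
Variables (N : nat) (vN : vanish_from E N).

(* By induction on the degree of w, written as a sum of products xi k * wcomp w k. *)
Lemma derivation_ext U d D D' :
  is_derivation U d D -> is_derivation U d D' ->
  (forall V f, open V -> V `<=` U -> functions V f ->
     agree V (D V (fconst f)) (D' V (fconst f))) ->
  (forall V i w, open V -> V `<=` U -> fun_deg V i.+1%:Z w -> arity1 w ->
     agree V (D V w) (D' V w)) ->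
  op_agree U D D'.
Proof.
move=> dD dD' H0 H1 V k w oV VU fw x Vx.
have [W [F [oW Wx]]] := frame_system_exists x vN.
have oVW : open (V `&` W) by exact: openI.
have VWV : V `&` W `<=` V by move=> y [].
have VWU : V `&` W `<=` U by move=> y /VWV /VU.
have VWW : V `&` W `<=` W by move=> y [].
rewrite (der_restrict_id dD oV oVW VWV VU fw (conj Vx Wx)).
rewrite (der_restrict_id dD' oV oVW VWV VU fw (conj Vx Wx)).
(* Degrees are integers, the bound n a natural number: at n = 0 only negative degrees remain, where
   forms vanish. *)
suff S (n : nat) : forall k w, k < n%:Z -> fun_deg (V `&` W) k w ->
    agree (V `&` W) (D (V `&` W) w) (D' (V `&` W) w).
  have fw' := fun_deg_sub VWV fw.
  by apply: (S `|k|.+1 k w) => //; rewrite -addn1 PoszD ltzD1 abszE ler_norm.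
move: (V `&` W) oVW VWU VWW => V1 oV1 V1U V1W {V w x k oV VU fw Vx VWV Wx}.
elim: n => [|n IH] k w kn fw.
  have e : agree V1 w (fun _ _ => 0).
    by move=> x Vx; apply/funext => s; exact: fun_deg_lt0 fw Vx kn.
  move=> x Vx; rewrite (der_agree dD oV1 V1U fw e Vx) (der_agree dD' oV1 V1U fw e Vx).
  by rewrite (der0 dD oV1 V1U Vx) (der0 dD' oV1 V1U Vx).
have [k0|k0] := eqVneq k 0.
  rewrite k0 in fw; have e := fun_deg0E fw.
  move=> x Vx; rewrite (der_agree dD oV1 V1U fw e Vx) (der_agree dD' oV1 V1U fw e Vx).
  by apply: H0 => //; exact: fun_deg_nil fw.
have e := fun_deg_decomp F V1W k0 fw.
have fx l : l \in idx F -> fun_deg V1 l.1.+1%:Z (xi F l).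
  by move=> lF; exact: fun_deg_xi.
have fc l : l \in idx F -> fun_deg V1 (k - l.1.+1%:Z) (wcomp F w l).
  by move=> lF; exact: fun_deg_wcomp.
have fl l : l \in idx F -> fun_deg V1 k (fmul (xi F l) (wcomp F w l)).
  by move=> lF; rewrite -(subrKC l.1.+1%:Z k); apply: fun_deg_fmul; [exact: fx|exact: fc].
move=> x Vx; rewrite (der_agree dD oV1 V1U fw e Vx) (der_agree dD' oV1 V1U fw e Vx).
apply/funext => s; rewrite (congr1 (@^~ s) (der_sum dD oV1 V1U fl Vx)).
rewrite (congr1 (@^~ s) (der_sum dD' oV1 V1U fl Vx)).
rewrite big_seq [RHS]big_seq; apply: eq_bigr => l lF.
rewrite (congr1 (@^~ s) (der_leibniz dD oV1 V1U (fx l lF) (fc l lF) Vx)).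
rewrite (congr1 (@^~ s) (der_leibniz dD' oV1 V1U (fx l lF) (fc l lF) Vx)).
rewrite /fmul -!/(sh _ _ _) (H1 V1 l.1 (xi F l) oV1 V1U (fx l lF) (@arity1_xi _ _ F l) x Vx).
rewrite (IH _ _ _ (fc l lF) x Vx) //.
by move: kn; rewrite -!(intS, natz); lia.
Qed.

Lemma sh_unitr x (a : K) (p : seq (hvec E x) -> K) s :
  sh p (unit_form a) s = a * p s.
Proof.
elim: s p => [|v s IH] p; first by rewrite sh_nil mulrC.
rewrite sh_cons IH; have -> : ins v (unit_form a) = fun=> 0 by [].
by rewrite sh0r addr0.
Qed.

(** Inserting a frame vector into w leaves a constant, so each product is a coordinate of Z times
    that constant. Thus the values of the field on arity one recover Z. *)
Lemma vert_arity1 V (Z : forall x, L E x) i w x s :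
  gsym (w x) -> hom (w x) i.+1%:Z -> arity1 w ->
  vert Z V w x s = w x [:: hv (lval (Z x) s i)].
Proof.
move=> gw hw aw; have [W [F [oW Wx]]] := frame_system_exists x vN.
rewrite (vertE F) // -[in RHS](cat0s [:: _]) (form_expand F _ Wx); last first.
  by move=> j b u v; have [w1 _] := gw; exact: (w1 [::]).
apply: eq_bigr => k _ /=.
have -> : ins (ev F k x) (w x) = unit_form (w x [:: ev F k x]).
  by apply/funext => -[|v t] //=; rewrite /ins aw.
rewrite sh_unitr mulrC; case: k => [i' j]; rewrite /co /=.
case: eqVneq => [<-|ii'] //.
rewrite hw ?mulr0 ?mul0r // /sdeg /= addn0 /hdeg /= eqz_nat eqSS.
by rewrite eq_sym.
Qed.

Lemma Lext x (l l' : L E x) : (forall s i, lval l s i = lval l' s i) -> l = l'.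
Proof.
move=> H; apply: val_inj; apply/funext => s /=.
by apply: functional_extensionality_dep => i; exact: H.
Qed.

(** On the coframe element [xi F (i, j)] the field returns the coordinate j of the component of
    index i. *)
Lemma vert_inj U (Z Z' : forall x, L E x) : open U -> op_agree U (vert Z) (vert Z') -> agree U Z Z'.
Proof.
move=> oU H x Ux; have [W [F [oW Wx]]] := frame_system_exists x vN.
apply: Lext => s i.
rewrite (frame_expand F (lval (Z x) s i) Wx) (frame_expand F (lval (Z' x) s i) Wx).
rewrite !big_nat; apply: eq_bigr => j /andP[_ jr]; congr (_ *: _).
have oUW : open (U `&` W) by exact: openI.
have jF : (i, j) \in idx F by rewrite mem_idx.
have UWW : U `&` W `<=` W by move=> y [].
have fx := fun_deg_xi jF UWW.
have := H _ _ _ oUW (@subIsetl _ _ _) fx x (conj Ux Wx).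
have /fun_degP[g h _] := fx.
move=> /(congr1 (@^~ s)).
rewrite !(vert_arity1 _ _ _ (g x (conj Ux Wx)) (h x (conj Ux Wx)) (@arity1_xi _ _ F (i, j))).
by rewrite /= /co /= eqxx.
Qed.

(** * The section of L representing a derivation of degree -1 *)

Section Represent.
Variables (U : set M) (oU : open U) (D : operator E) (dD : is_derivation U (-1) D).
Arguments D : clear implicits.

(** One frame around each point, chosen once and for all: the section gets its value at x from the
    frame chosen at x, with no compatibility between neighbouring choices. *)
Let frm (x : M) : {p : {W : set M & frame_system E W N} | open (tag p) /\ tag p x}.
Proof.
apply: cid; have [W [F [oW Wx]]] := frame_system_exists x vN.
by exists (existT _ W F).
Qed.

Let fW x := tag (sval (frm x)).
Let fF x : frame_system E (fW x) N := tagged (sval (frm x)).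
Let ofW x : open (fW x). Proof. by have [] := svalP (frm x). Qed.
Let fWx x : fW x x. Proof. by have [] := svalP (frm x). Qed.

(* The section representing D: its pairing with a coframe element is the value
   of D on that element. *)
Definition dual_form (x : M) : lform E x := fun s i =>
  if `[< U x >] then \sum_(0 <= j < rk (fF x) i)
    D (U `&` fW x) (xi (fF x) (i, j)) x s *: fv (fF x) i j x
  else 0.

Arguments dual_form : clear implicits.

Lemma fun_deg_dxi W (F : frame_system E W N) k : open W -> k \in idx F ->
  fun_deg (U `&` W) k.1%:Z (D (U `&` W) (xi F k)).
Proof.
move=> oW kF; have oUW : open (U `&` W) by exact: openI.
have UWW : U `&` W `<=` W by move=> y [].
have := der_deg dD oUW (@subIsetl _ _ _) (fun_deg_xi kF UWW).
by rewrite intS addrC addKr.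
Qed.

Lemma dual_form_axiom x : lfib_axiom (dual_form x).
Proof.
(* Outside U the default value 0 must still lie in the fibre. *)
case: (asboolP (U x)) => Ux; last first.
  have d0 s i : dual_form x s i = 0 by rewrite /dual_form asboolF.
  split; [split|by move=> s i _; exact: d0].
    move=> s t i a u v; apply: functional_extensionality_dep => j.
    by rewrite -[RHS]/(a *: dual_form x _ j + dual_form x _ j) !d0 scaler0 addr0.
  move=> s t u v; apply: functional_extensionality_dep => j.
  by rewrite -[RHS]/(_ *: dual_form x _ j) !d0 scaler0.
have dE s i : dual_form x s i = \sum_(0 <= j < rk (fF x) i)
    D (U `&` fW x) (xi (fF x) (i, j)) x s *: fv (fF x) i j x.
  by rewrite /dual_form asboolT.
have fd i j : (j < rk (fF x) i)%N ->
    fun_deg (U `&` fW x) i%:Z (D (U `&` fW x) (xi (fF x) (i, j))).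
  by move=> jr; apply: (@fun_deg_dxi _ (fF x) (i, j)) => //; rewrite mem_idx.
split; [split|].
- move=> s t i a u v; apply: functional_extensionality_dep => j.
  rewrite -[RHS]/(a *: dual_form x _ j + dual_form x _ j) !dE scaler_sumr -big_split /=.
  rewrite !big_nat; apply: eq_bigr => l /andP[_ lr].
  have /fun_degP[g _ _] := fd j l lr; have [g1 _] := g x (conj Ux (fWx x)).
  by rewrite g1 scalerDl scalerA.
- move=> s t u v; apply: functional_extensionality_dep => j.
  rewrite -[RHS]/(_ *: dual_form x _ j) !dE scaler_sumr.
  rewrite !big_nat; apply: eq_bigr => l /andP[_ lr].
  have /fun_degP[g _ _] := fd j l lr; have [_ g2] := g x (conj Ux (fWx x)).
  by rewrite g2 scalerA.
- move=> s i si; rewrite dE big_nat big1 // => l /andP[_ lr].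
  have /fun_degP[_ h _] := fd i l lr.
  by rewrite (h x (conj Ux (fWx x))) ?scale0r.
Qed.

Definition dual_sec (x : M) : L E x := LFib (asboolT (dual_form_axiom x)).

(** Near x, w is a combination of the coframe with regular coefficients; O-linearity and locality of
    D reduce the claim to the coframe. Since w is arbitrary, the frame chosen at x has dropped
    out. *)
Lemma dual_secE V i w x s : open V -> V `<=` U -> fun_deg V i.+1%:Z w ->
  arity1 w -> V x -> w x [:: hv (lval (dual_sec x) s i)] = D V w x s.
Proof.
move=> oV VU fw aw Vx; set W := U `&` fW x; set F := fF x.
have oW : open W by apply: openI.
have WU : W `<=` U by move=> y [].
have WF : W `<=` fW x by move=> y [].
have oVW : open (V `&` W) by exact: openI.
have VWV : V `&` W `<=` V by move=> y [].
have VWW : V `&` W `<=` W by move=> y [].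
have VWU : V `&` W `<=` U by move=> y [/VU].
have VWx : (V `&` W) x by split=> //; split=> //; exact: VU.
have /fun_degP[gw hw rw] := fw.
pose f j (y : M) : K := w y [:: ev F (i, j) y].
have jF j : (j < rk F i)%N -> (i, j) \in idx F by rewrite mem_idx.
have ff j : (j < rk F i)%N -> functions (V `&` W) (f j).
  move=> jr; have rb : List.Forall (bsec_reg (V `&` W))
      [:: existT (fun i => forall x, E i x) i (fv F i j)].
    constructor; last by constructor.
    by apply: reg_fv => //; exact: subset_trans VWW WF.
  exact: rw _ oVW VWV _ rb.
have fx j : (j < rk F i)%N -> fun_deg (V `&` W) i.+1%:Z (xi F (i, j)).
  by move=> jr; apply: (fun_deg_xi (jF j jr)); exact: subset_trans VWW WF.
have ffx j : j \in index_iota 0 (rk F i) ->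
    fun_deg (V `&` W) i.+1%:Z (fun y t => f j y * xi F (i, j) y t).
  by rewrite mem_index_iota => jr; apply: fun_degZ; [exact: ff|exact: fx].
(* A form of arity one is determined by its values [f j] on the frame of the component of index i,
   its degree excluding the other components. *)
have e : agree (V `&` W) w (fun y t => \sum_(0 <= j < rk F i) f j y * xi F (i, j) y t).
  move=> y [Vy [Uy Wy]]; apply/funext => -[|[i' v] [|v' t]].
  - by rewrite aw // big1 // => j _; rewrite mulr0.
  - have [ii'|ii'] := eqVneq i' i; last first.
      rewrite hw //; last first.
        by rewrite /sdeg /= addn0 /hdeg /= eqz_nat eqSS.
      by rewrite big1 // => j _; rewrite /xi /co /= (negbTE ii') mulr0.
    move: v; rewrite ii' => v; rewrite -[existT _ i v]/(hv v).
    rewrite {1}(frame_expand F v Wy).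
    have [w1 _] := gw y Vy; rewrite (form_frame_sum (s := [::])); last first.
      by move=> b u z; exact: (w1 [::]).
    by apply: eq_bigr => j _; rewrite /xi /co /= eqxx mulrC.
  - by rewrite aw // big1 // => j _; rewrite mulr0.
rewrite (der_restrict_id dD oV oVW VWV VU fw VWx).
rewrite (der_agree dD oVW VWU (fun_deg_sub VWV fw) e VWx).
rewrite (congr1 (@^~ s) (der_sum dD oVW VWU ffx VWx)).
rewrite [in LHS]/= /dual_form asboolT; last exact: VU.
have [w1 _] := gw x Vx; rewrite (form_frame_sum (s := [::])); last first.
  by move=> b u z; exact: (w1 [::]).
rewrite !big_nat; apply: eq_bigr => j /andP[_ jr].
rewrite (congr1 (@^~ s) (der_fscale dD oVW VWU (ff j jr) (fx j jr) VWx)).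
rewrite mulrC; congr (_ * _).
have fxW : fun_deg W i.+1%:Z (xi F (i, j)) by exact: (fun_deg_xi (jF j jr)).
by rewrite (der_restrict_id dD oW oVW VWW WU fxW VWx).
Qed.

(** In a single frame around x, [dual_secE] gives the coordinates of the section as values of D on
    that coframe, whichever frames were chosen at the nearby points. *)
Lemma dual_sec_reg : Lreg U dual_sec.
Proof.
move=> V s i oV VU rs; apply: reg_by_frame => // x Vx.
have [W [F [oW Wx]]] := frame_system_exists x vN.
exists W, (rk F i), (fv F i), (@cf _ _ _ _ _ _ F i); split=> //; first exact: frameP.
move=> j jr; have jF : (i, j) \in idx F by rewrite mem_idx.
have oUW : open (U `&` W) by exact: openI.
have oVW : open (V `&` W) by exact: openI.
have VWUW : V `&` W `<=` U `&` W by move=> y [/VU].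
have UWW : U `&` W `<=` W by move=> y [].
have /fun_degP[_ _ rD] := fun_deg_dxi oW jF.
have rs' : List.Forall (bsec_reg (V `&` W)) s.
  apply: List.Forall_impl rs => b; apply: reg_restrict => //.
have := rD _ oVW VWUW s rs'; apply: functions_agree => // y VWy.
have UWy := VWUW _ VWy.
rewrite -(dual_secE _ oUW (@subIsetl _ _ _) (fun_deg_xi jF UWW) (@arity1_xi _ _ F _) UWy).
by rewrite /= /co /= eqxx.
Qed.

Lemma dual_secP : op_agree U (vert dual_sec) D.
Proof.
apply: (derivation_ext (d := -1)) => //.
- exact: (vert_derivation vN oU dual_sec_reg).
- move=> V f oV VU ff x Vx.
  rewrite (der_fconst dD oV VU ff Vx).
  by rewrite (der_fconst (vert_derivation vN oU dual_sec_reg) oV VU ff Vx).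
- move=> V i w oV VU fw aw x Vx; apply/funext => s.
  have /fun_degP[gw hw _] := fw.
  by rewrite (vert_arity1 _ _ _ (gw x Vx) (hw x Vx)) // (dual_secE _ oV VU).
Qed.

End Represent.

Lemma derivation_represent U D : open U -> is_derivation U (-1) D ->
  exists Z : forall x, L E x, Lreg U Z /\ op_agree U (vert Z) D.
Proof.
move=> oU dD; exists (dual_sec oU dD); split; first exact: dual_sec_reg.
exact: dual_secP.
Qed.

End FiniteLength.

End Derivations.

(** * The bundle L *)

(* Elimination of one coordinate at a time; [m] records the dual basis. *)
Lemma subspace_basis (K : fieldType) (J : eqType) (l : seq J) (P : (J -> K) -> Prop) :
  uniq l ->
  (forall a f g, P f -> P g -> P (fun j => a * f j + g j)) ->
  (forall f, P f -> forall j, j \notin l -> f j = 0) ->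
  exists (r : nat) (b m : nat -> J -> K),
    [/\ forall k, (k < r)%N -> P (b k),
        forall f, P f -> forall j,
          f j = \sum_(0 <= k < r) (\sum_(i <- l) m k i * f i) * b k j
      & forall k k', (k < r)%N -> (k' < r)%N ->
          \sum_(i <- l) m k i * b k' i = (k == k')%:R].
Proof.
elim: l P => [|j0 l IH] P; first last.
  move=> /= /andP[j0l ul] Plin Psup.
  have neq i : i \in l -> (i == j0) = false.
    by move=> il; apply/eqP => ij; rewrite ij (negbTE j0l) in il.
  have split_sum (g h : J -> K) (a : K) :
      \sum_(i <- j0 :: l) (if i == j0 then a else g i) * h i =
      a * h j0 + \sum_(i <- l) g i * h i.
    rewrite big_cons eqxx; congr (_ + _).
    by apply: eq_big_seq => i /neq ->.
  have [[f0 [Pf0 f0j]]|no] := pselect (exists f, P f /\ f j0 != 0); last first.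
    have Pj0 f : P f -> f j0 = 0.
      by move=> Pf; apply/eqP; apply: contra_notT no => fj; exists f.
    have [|r [b [m [H1 H2 H3]]]] := IH P ul Plin.
      move=> f Pf j jl; have [->|jj0] := eqVneq j j0; first exact: Pj0.
      by apply: Psup => //; rewrite in_cons negb_or jj0.
    exists r, b, (fun k i => if i == j0 then 0 else m k i); split=> //.
      move=> f Pf j; rewrite {1}(H2 f Pf j); apply: eq_bigr => k _.
      by rewrite split_sum mul0r add0r.
    by move=> k k' kr k'r; rewrite split_sum mul0r add0r H3.
  have P0 : P (fun=> 0).
    by have := Plin (-1) f0 f0 Pf0 Pf0; under eq_fun do rewrite mulN1r addNr.
  pose b0 j := (f0 j0)^-1 * f0 j.
  have Pb0 : P b0.
    have := Plin (f0 j0)^-1 f0 _ Pf0 P0.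
    by under eq_fun do rewrite addr0.
  have b01 : b0 j0 = 1 by rewrite /b0 mulVf.
  pose P' f := P f /\ f j0 = 0.
  have [||r [b [m [H1 H2 H3]]]] := IH P' ul.
  - move=> a f g [Pf f0'] [Pg g0']; split; first exact: Plin.
    by rewrite f0' g0' mulr0 addr0.
  - move=> f [Pf f0'] j jl; have [->//|jj0] := eqVneq j j0.
    by apply: Psup => //; rewrite in_cons negb_or jj0.
  (* The new functional is evaluation at j0. The old ones are applied to f - f j0 b0, which vanishes
     at j0; this is their correction at j0 by minus their value on b0. *)
  exists r.+1, (fun k => if k is k'.+1 then b k' else b0),
    (fun k i => if k is k'.+1 then
       (if i == j0 then - \sum_(i' <- l) m k' i' * b0 i' else m k' i)
     else if i == j0 then 1 else 0).
  have sum0 (h : J -> K) : \sum_(i <- j0 :: l) (if i == j0 then 1 else 0) * h i = h j0.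
    by rewrite split_sum mul1r big1 ?addr0 // => i _; rewrite mul0r.
  split.
  - by move=> [|k] kr //; have [] := H1 k kr.
  - move=> f Pf j; rewrite big_nat_recl // sum0.
    have P'f : P' (fun i => - f j0 * b0 i + f i).
      split; first exact: Plin.
      by rewrite b01 mulr1 addNr.
    have -> : f j = f j0 * b0 j + (- f j0 * b0 j + f j) by ring.
    rewrite [X in _ + X](H2 _ P'f j); congr (_ + _); apply: eq_bigr => k _; congr (_ * _).
    rewrite split_sum; under eq_bigr do rewrite mulrDr mulrCA.
    by rewrite big_split /= -mulr_sumr mulrC mulrN mulNr.
  - move=> [|k] [|k'] kr k'r; rewrite ?sum0 //.
    + by have [_ ->] := H1 k' k'r.
    + by rewrite split_sum b01 mulr1 addNr.
    + have [_ b'0] := H1 k' k'r.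
      by rewrite split_sum b'0 mulr0 add0r H3.
move=> _ _ Psup; exists 0%N, (fun _ _ => 0), (fun _ _ => 0); split=> //.
by move=> f Pf j; rewrite big_geq //; exact: Psup.
Qed.

Section LBundle.
Variables (R : realType) (c : funclass) (M : manifold R c).
Local Notation K := (base_field R c).
Variable E : nat -> vbundle M.

Local Notation slot := (nat * nat)%type.
Local Notation coeffs := (seq slot * slot -> K).

Definition ideg (I : seq slot) : nat := sumn (map (fun k => k.1.+1) I).

(** * Forms as tensors of coefficients *)

Section Expansion.
Variables (U : set M) (N : nat) (F : frame_system E U N).
Implicit Types (a : seq slot -> K) (I : seq slot).

(** The multilinear form with value a on words of frame vectors, expanded one slot at a time. *)
Fixpoint ex x a (s : seq (hvec E x)) : K :=
  if s is v :: s' then \sum_(k <- idx F) co F k v * ex (fun I => a (k :: I)) s'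
  else a [::].

Lemma ex_ext x a a' (s : seq (hvec E x)) :
  (forall I, all (mem (idx F)) I -> a I = a' I) -> ex a s = ex a' s.
Proof.
elim: s a a' => [|v s IH] a a' H /=; first exact: H.
apply: eq_big_seq => k kF; congr (_ * _); apply: IH => I IF.
by apply: H; rewrite /= kF.
Qed.

Lemma ex_lin x (b : K) a a' (s : seq (hvec E x)) :
  ex (fun I => b * a I + a' I) s = b * ex a s + ex a' s.
Proof.
elim: s a a' => [|v s IH] a a' //=.
rewrite mulr_sumr -big_split /=; apply: eq_bigr => k _.
by rewrite IH mulrDr mulrCA.
Qed.

Lemma ex0 x (s : seq (hvec E x)) : ex (fun=> 0) s = 0.
Proof. by elim: s => //= v s IH; rewrite big1 // => k _; rewrite IH mulr0. Qed.

Lemma exZ x (b : K) a (s : seq (hvec E x)) : ex (fun I => b * a I) s = b * ex a s.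
Proof.
rewrite -[RHS]addr0 -(ex0 s) -ex_lin; congr ex; apply/funext => I.
by rewrite addr0.
Qed.

Lemma ex_sum x (T : Type) (l : seq T) (f : T -> K) (g : T -> seq slot -> K)
    (s : seq (hvec E x)) :
  ex (fun I => \sum_(t <- l) f t * g t I) s = \sum_(t <- l) f t * ex (g t) s.
Proof.
elim: l => [|t l IH].
  by rewrite big_nil -[RHS](ex0 s); congr ex; apply/funext => I; rewrite big_nil.
rewrite big_cons -IH -ex_lin; congr ex; apply/funext => I.
by rewrite big_cons.
Qed.

Lemma co_deg k x (v : hvec E x) : hdeg v != k.1.+1 -> co F k v = 0.
Proof.
by rewrite /co /hdeg eqSS => /negbTE ->.
Qed.

(** A coordinate vanishes on vectors of another degree, so only words of the same total degree as s
    contribute. *)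
Lemma ex_hom x a (s : seq (hvec E x)) :
  (forall I, ideg I = sdeg s -> a I = 0) -> ex a s = 0.
Proof.
elim: s a => [|v s IH] a H /=; first exact: H.
rewrite big1 // => k _; have [vk|/co_deg ->] := eqVneq (hdeg v) k.1.+1; last first.
  by rewrite mul0r.
rewrite IH ?mulr0 // => I Is; apply: H.
by rewrite sdeg_cons vk -Is.
Qed.

Lemma ex_gsym x a : U x ->
  (forall I I' k k', a (I ++ k :: k' :: I') =
     (-1) ^+ (k.1.+1 * k'.1.+1) * a (I ++ k' :: k :: I')) ->
  gsym (@ex x a).
Proof.
move=> Ux asym; apply/gsymP; split=> s t.
  move=> i b u v; elim: s a asym => [|w s IH] a asym /=.
    rewrite mulr_sumr -big_split /=; apply: eq_bigr => k _.
    by rewrite co_lin // mulrDl mulrA.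
  rewrite mulr_sumr -big_split /=; apply: eq_bigr => k _.
  rewrite IH; first by rewrite mulrDr mulrCA.
  by move=> I I' k1 k2; exact: (asym (k :: I)).
move=> u v; elim: s a asym => [|w s IH] a asym /=.
  under eq_bigr => k _ do rewrite mulr_sumr.
  rewrite exchange_big /= mulr_sumr; apply: eq_bigr => k _.
  rewrite mulrCA !mulr_sumr; apply: eq_bigr => k' _.
  have -> : (fun I => a [:: k', k & I]) =
      (fun I => (-1) ^+ (k'.1.+1 * k.1.+1) * a [:: k, k' & I]).
    by apply/funext => I; exact: (asym [::]).
  rewrite exZ.
  (* Unless a coordinate vanishes, the frame vectors have the degrees of u and v, and the sign of
     the coefficients is the required one. *)
  have [uk|/co_deg ->] := eqVneq (hdeg u) k'.1.+1; last by rewrite !(mul0r, mulr0).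
  have [vk|/co_deg ->] := eqVneq (hdeg v) k.1.+1; last by rewrite !(mul0r, mulr0).
  by rewrite uk vk; ring.
rewrite mulr_sumr; apply: eq_bigr => k _.
rewrite IH; first by rewrite mulrCA.
by move=> I I' k1 k2; exact: (asym (k :: I)).
Qed.

Lemma ex_form x (p : seq (hvec E x) -> K) s : U x -> gsym p ->
  p s = ex (fun I => p (map (ev F ^~ x) I)) s.
Proof.
move=> Ux; elim: s p => [|v s IH] p gp //=.
have [p1 _] := gp; rewrite -[v :: s]cat0s (form_expand F _ Ux (p1 [::] s)).
apply: eq_bigr => k _; congr (_ * _).
exact: (IH (ins (ev F k x) p) (gsym_ins _ gp)).
Qed.

Lemma ex_ev x a I : U x -> all (mem (idx F)) I -> ex a (map (ev F ^~ x) I) = a I.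
Proof.
move=> Ux; elim: I a => [|k I IH] a //= /andP[kF IF].
rewrite (bigD1_seq k) ?idx_uniq //= co_ev // eqxx mul1r IH //.
rewrite big_seq_cond big1 ?addr0 // => k' /andP[k'F kk'].
by rewrite co_ev // eq_sym (negbTE kk') mul0r.
Qed.

Lemma ex_regular V a (s : seq (bsec E)) : open V -> V `<=` U ->
  List.Forall (bsec_reg V) s ->
  functions V (fun x => ex a (map (@bsec_at _ _ _ E ^~ x) s)).
Proof.
move=> oV VU; elim: s a => [|b s IH] a rs /=; first exact: functions_cst.
have [rb rs'] := (proj1 (List.Forall_cons_iff _ _ _)) rs.
have fk k : k \in idx F -> functions V (fun x => co F k (bsec_at b x) *
    ex (fun I => a (k :: I)) (map (@bsec_at _ _ _ E ^~ x) s)).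
  move=> kF; apply: functionsM => //; last exact: IH.
  have /fun_degP[_ _ rx] := fun_deg_xi kF VU.
  exact: rx V oV (@subset_refl _ _) [:: b] (List.Forall_cons _ rb (List.Forall_nil _)).
have := functions_sum (idx F) (P := fun k => k \in idx F) oV fk.
by apply: functions_agree => // x _; rewrite -big_seq.
Qed.

Lemma sdeg_ev x I : sdeg (map (ev F ^~ x) I) = ideg I.
Proof. by rewrite /sdeg -map_comp. Qed.

Lemma cf_comb i x (g : nat -> K) j : U x -> (j < rk F i)%N ->
  cf F (\sum_(0 <= k < rk F i) g k *: fv F i k x) j = g j.
Proof.
move=> Ux jr; rewrite cf_sum // (bigD1_seq j) ?mem_index_iota ?iota_uniq //=.
rewrite cf_frame // eqxx mulr1 big_seq_cond big1 ?addr0 // => k /andP[].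
by rewrite mem_index_iota => kr kj; rewrite cf_frame // (negbTE kj) mulr0.
Qed.

(** Index i stands for degree - (i + 1), so the total degree is -1 exactly when the word has degree
    i. *)
Definition admissible (J : seq slot * slot) : bool :=
  [&& all (mem (idx F)) J.1, J.2 \in idx F & ideg J.1 == J.2.1].

(* In a frame, the fibres of L are the forms whose coefficients lie in this
   subspace, which does not depend on the point: constant bases give frames. *)
Definition Lcoeffs (f : coeffs) : Prop :=
  (forall J, ~~ admissible J -> f J = 0) /\
  (forall I I' k k' t, f (I ++ k :: k' :: I', t) =
     (-1) ^+ (k.1.+1 * k'.1.+1) * f (I ++ k' :: k :: I', t)).

Lemma Lcoeffs_lin b f g : Lcoeffs f -> Lcoeffs g ->
  Lcoeffs (fun J => b * f J + g J).
Proof.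
move=> [f1 f2] [g1 g2]; split=> [J nJ|I I' k k' t].
  by rewrite f1 // g1 // mulr0 addr0.
by rewrite f2 g2; ring.
Qed.

Fixpoint words (n : nat) : seq (seq slot) :=
  if n is n'.+1 then [::] :: [seq k :: w | k <- idx F, w <- words n'] else [:: [::]].

Lemma mem_words n I : all (mem (idx F)) I -> (size I <= n)%N -> I \in words n.
Proof.
elim: n I => [|n IH] [|k I] //= /andP[kF IF] In.
by rewrite in_cons /= allpairs_f // IH.
Qed.

(** Finite and large enough: every letter has degree at least 1, so a word of degree below N has
    fewer than N letters. *)
Definition supp : seq (seq slot * slot) :=
  undup [seq (w, t) | w <- words N, t <- idx F].

Lemma size_ideg I : (size I <= ideg I)%N.
Proof. by elim: I => //= k I IH; rewrite -add1n; exact: leq_add. Qed.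

Lemma mem_supp J : admissible J -> J \in supp.
Proof.
case: J => I t /and3P[IF tF /eqP It]; rewrite mem_undup allpairs_f // mem_words //.
apply: leq_trans (size_ideg I) _; rewrite /= in It; rewrite It.
move: tF; rewrite mem_idx; case: (leqP t.1 N) => // /ltnW /(rk0 F) ->.
by rewrite ltn0.
Qed.

Definition coeffs_of x (l : L E x) : coeffs := fun J =>
  if admissible J then Lco F J.2 l (map (ev F ^~ x) J.1) else 0.

Lemma ideg_swap I I' k k' : ideg (I ++ k :: k' :: I') = ideg (I ++ k' :: k :: I').
Proof. by rewrite /ideg !map_cat !sumn_cat; congr addn; exact: addnCA. Qed.

Lemma admissible_swap I I' k k' t :
  admissible (I ++ k :: k' :: I', t) = admissible (I ++ k' :: k :: I', t).
Proof.
by rewrite /admissible ideg_swap !all_cat /=; congr (_ && _ && _); exact: andbCA.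
Qed.

Lemma coeffs_ofP x (l : L E x) : U x -> Lcoeffs (coeffs_of l).
Proof.
move=> Ux; split=> [J /negbTE nJ|I I' k k' t]; first by rewrite /coeffs_of nJ.
rewrite /coeffs_of admissible_swap; case: ifP => _; last by rewrite mulr0.
have [_ l2] := gsym_Lco F t l Ux.
by rewrite /= !map_cat /= l2.
Qed.

Lemma Lco_coeffs x (l : L E x) t s : U x -> t \in idx F ->
  Lco F t l s = ex (fun I => coeffs_of l (I, t)) s.
Proof.
move=> Ux tF; rewrite (ex_form s Ux (gsym_Lco F t l Ux)); apply: ex_ext => I IF.
rewrite /coeffs_of /admissible /= IF tF /=; case: eqP => // /eqP It.
by apply: (hom_Lco F (k := t) l Ux); rewrite sdeg_ev eqz_nat.
Qed.

Definition form_of (f : coeffs) x : lform E x := fun s i =>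
  \sum_(0 <= j < rk F i) ex (fun I => f (I, (i, j))) s *: fv F i j x.

Lemma form_of_axiom f x : U x -> Lcoeffs f -> lfib_axiom (@form_of f x).
Proof.
move=> Ux [f1 f2].
have g i j : gsym (@ex x (fun I => f (I, (i, j)))).
  by apply: ex_gsym => // I I' k k'; exact: f2.
split; [split|].
- move=> s t i a u v; apply: functional_extensionality_dep => j.
  rewrite -[RHS]/(a *: form_of _ _ j + form_of _ _ j) /form_of scaler_sumr -big_split /=.
  apply: eq_bigr => k _; have [g1 _] := g j k.
  by rewrite g1 scalerDl scalerA.
- move=> s t u v; apply: functional_extensionality_dep => j.
  rewrite -[RHS]/(_ *: form_of _ _ j) /form_of scaler_sumr.
  apply: eq_bigr => k _; have [_ g2] := g j k.
  by rewrite g2 scalerA.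
- move=> s i si; rewrite /form_of big1 // => j _.
  rewrite ex_hom ?scale0r // => I Is; apply: f1.
  by rewrite /admissible /= Is (negbTE si) !andbF.
Qed.

Lemma coeffs_of_form f x (fx : lfib_axiom (@form_of f x)) : U x -> Lcoeffs f ->
  coeffs_of (LFib (asboolT fx) : L E x) = f.
Proof.
move=> Ux [f1 f2]; apply/funext => -[I [i j]]; rewrite /coeffs_of.
case: ifPn => [/and3P[/= IF tF _]|/f1 ->] //.
rewrite /Lco /= /form_of cf_comb //=; first by rewrite ex_ev.
by move: tF; rewrite mem_idx.
Qed.

Lemma coeffs_of_sum x (T : Type) (r : seq T) (a : T -> K) (l : T -> L E x) J : U x ->
  coeffs_of (\sum_(t <- r) a t *: l t) J = \sum_(t <- r) a t * coeffs_of (l t) J.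
Proof.
move=> Ux; elim: r => [|t r IH].
  by rewrite !big_nil /coeffs_of; case: ifP => // _; exact: cf0.
rewrite !big_cons -IH /coeffs_of; case: ifP => _; last by rewrite mulr0 addr0.
by rewrite /Lco -cf_lin.
Qed.

Lemma form_ofK x (l : L E x) s i : U x -> lval l s i = form_of (coeffs_of l) s i.
Proof.
move=> Ux; rewrite {1}(frame_expand F (lval l s i) Ux) /form_of !big_nat.
apply: eq_bigr => j /andP[_ jr]; congr (_ *: _).
by rewrite -Lco_coeffs ?mem_idx.
Qed.

Lemma form_of_regular f V i (s : seq (bsec E)) : open V -> V `<=` U ->
  List.Forall (bsec_reg V) s ->
  reg V (fun x => @form_of f x (map (@bsec_at _ _ _ E ^~ x) s) i).
Proof.
move=> oV VU rs; apply/(reg_frame F) => // j jr.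
have := ex_regular (fun I => f (I, (i, j))) oV VU rs.
by apply: functions_agree => // x /VU Ux; rewrite /form_of cf_comb.
Qed.

End Expansion.

(** The dual functionals [m] are constant too: the coordinates of a section are constant
    combinations of its coefficients, which are its values on frame sections, hence regular
    functions. *)
Lemma Lreg_vbundle N (vN : vanish_from E N) : is_vbundle (@Lreg R c M E).
Proof.
split.
- by move=> U V X oU oV VU; exact: Lreg_sub.
- move=> U X oU H V s i oV VU rs; apply: reg_local => // x Vx.
  have [W [oW Wx WU rX]] := H x (VU _ Vx).
  have oVW : open (V `&` W) by exact: openI.
  have VWV : V `&` W `<=` V by move=> y [].
  have VWW : V `&` W `<=` W by move=> y [].
  exists (V `&` W); split=> //; apply: rX => //.
  by apply: List.Forall_impl rs => b; exact: reg_restrict.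
move=> x0; have [U [F [oU Ux0]]] := frame_system_exists x0 vN.
have [||r [b [m [Pb bE bm]]]] := @subspace_basis K _ (supp F) (Lcoeffs F) (undup_uniq _).
- by move=> a f g; exact: Lcoeffs_lin.
- by move=> f [f1 _] J Js; apply: f1; apply: contra Js; exact: mem_supp.
have fx k x : (k < r)%N -> U x -> lfib_axiom (@form_of _ _ F (b k) x).
  by move=> kr Ux; apply: form_of_axiom => //; exact: Pb.
(* The form is known to lie in the fibre only over U, whence the case distinction; elsewhere the
   value is 0. *)
pose e (k : 'I_r) x : L E x :=
  if pselect (U x) is left Ux then LFib (asboolT (fx k x (ltn_ord k) Ux)) else 0.
have eE k x s i : U x -> lval (e k x) s i = form_of F (b k) s i.
  by rewrite /e; case: pselect.
have ce k x : U x -> coeffs_of F (e k x) = b k.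
  move=> Ux; rewrite /e; case: pselect => // Ux'.
  by apply: coeffs_of_form => //; exact: Pb.
pose al k x (l : L E x) : K := \sum_(J <- supp F) m k J * coeffs_of F l J.
have lE x (l : L E x) : U x -> l = \sum_(k < r) al k x l *: e k x.
  move=> Ux; have sumE s i : lval (\sum_(k < r) al k x l *: e k x) s i =
      \sum_(k < r) al k x l *: lval (e k x) s i.
    elim/big_rec2: _ => // k z y _ <-.
    by [].
  apply: Lext => s i; rewrite sumE (form_ofK F) //.
  under [RHS]eq_bigr => k _ do rewrite eE // /form_of scaler_sumr.
  rewrite exchange_big /= /form_of; apply: eq_bigr => j _.
  under [RHS]eq_bigr => k _ do rewrite scalerA.
  rewrite -scaler_suml; congr (_ *: _).
  rewrite -(big_mkord xpredT (fun k => al k x l * ex F (fun I => b k (I, (i, j))) s)).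
  rewrite -(ex_sum F (index_iota 0 r) (fun k => al k x l) (fun k I => b k (I, (i, j)))).
  by apply: ex_ext => I _; rewrite [LHS](bE _ (coeffs_ofP F l Ux)).
(* Uniqueness of coordinates: the functionals [m] are dual to the basis [b]. *)
have alU x (a : 'rV[K]_r) k : U x -> al (val k) x (\sum_(j < r) a 0 j *: e j x) = a 0 k.
  move=> Ux; rewrite /al; under eq_bigr => J _ do rewrite coeffs_of_sum // mulr_sumr.
  rewrite exchange_big /= (bigD1 k) //= [X in _ + X]big1 => [|j jk].
    under eq_bigr => J _ do rewrite ce // mulrCA.
    by rewrite -mulr_sumr bm // eqxx mulr1 addr0.
  under eq_bigr => J _ do rewrite ce // mulrCA.
  have kj : (val k == val j) = false by rewrite val_eqE eq_sym (negbTE jk).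
  by rewrite -mulr_sumr bm // kj mulr0.
exists U, r, e; split=> //.
  move=> x Ux l; exists (\row_k al k x l); split.
    by rewrite {1}(lE x l Ux); apply: eq_bigr => k _; rewrite mxE.
  by move=> a la; apply/rowP => k; rewrite mxE la alU.
move=> V X oV VU; split.
  move=> rX; exists (fun k x => al k x (X x)); split; last first.
    by move=> x /VU Ux; exact: lE.
  move=> k; apply: functions_sum => // J _.
  apply: functionsM => //; first exact: functions_cst.
  have [aJ|/negbTE nJ] := boolP (admissible F J); last first.
    apply: functions_agree oV _ (functions_cst V 0) => x _.
    by rewrite /coeffs_of nJ.
  have /and3P[IF tF _] := aJ.
  (* The frame sections spelled by the word of J; evaluating X on them gives the coefficient J. *)
  pose sb := map (fun k => existT (fun i => forall x, E i x) k.1 (fv F k.1 k.2)) J.1.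
  have rs : List.Forall (bsec_reg V) sb.
    rewrite /sb; elim: (J.1) IF => [|k' I IH] /=; first by constructor.
    move=> /andP[kF IF]; constructor; last exact: IH.
    by apply: reg_fv => //; rewrite -mem_idx.
  have := reg_on_Lco tF oV VU rX rs; apply: functions_agree => // x _.
  by rewrite /coeffs_of aJ /sb -map_comp.
move=> [a [fa Xa]] W s i oW WV rs.
have WU := subset_trans WV VU.
have re k : reg W (fun x => lval (e k x) (map (@bsec_at _ _ _ E ^~ x) s) i).
  apply: reg_agree (form_of_regular F (b k) i oW WU rs) => // x /WU Ux.
  by rewrite eE.
have rk : reg W (fun x => \sum_(k <- index_enum 'I_r)
    a k x *: lval (e k x) (map (@bsec_at _ _ _ E ^~ x) s) i).
  apply: reg_sum => // k; apply: regZ => //; exact: functions_sub (fa k).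
apply: reg_agree rk => // x /WV Vx; rewrite (Xa x Vx).
elim/big_rec2: _ => // k z y _ ->.
by [].
Qed.

End LBundle.

(** * The derived bracket *)

Section DerivedBracket.
Variables (R : realType) (c : funclass) (M : manifold R c).
Local Notation K := (base_field R c).
Variables (A : lie_infty_algebroid M) (N : nat) (vN : vanish_from A N).
Implicit Types (U V : set M) (X Y Z : forall x : M, L A x) (w : fsec A).

Definition adQ X : operator A := gcomm 1 (-1) (Q A) (vert X).
Arguments adQ : clear implicits.

Definition derived X Y : operator A := gcomm 0 (-1) (adQ X) (vert Y).
Arguments derived : clear implicits.

Lemma Q_der U : is_derivation U 1 (Q A).
Proof. by apply: derivation_sub (Q_derivation A) => x. Qed.

Lemma adQ_der U X : open U -> Lreg U X -> is_derivation U 0 (adQ X).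
Proof. by move=> oU rX; exact: (gcomm_derivation (Q_der U) (vert_derivation vN oU rX)). Qed.

Lemma derived_der U X Y : open U -> Lreg U X -> Lreg U Y ->
  is_derivation U (-1) (derived X Y).
Proof.
by move=> oU rX rY; exact: (gcomm_derivation (adQ_der oU rX) (vert_derivation vN oU rY)).
Qed.

Lemma adQE X V w x s :
  adQ X V w x s = Q A V (vert X V w) x s + vert X V (Q A V w) x s.
Proof.
rewrite /adQ /gcomm; have -> : (-1 : K) ^ (1 * -1) = -1.
  by rewrite -/(zsign K _) mul1r zsignN /zsign expr1z.
by rewrite mulN1r opprK.
Qed.

Lemma derivedE X Y V w x s :
  derived X Y V w x s = adQ X V (vert Y V w) x s - vert Y V (adQ X V w) x s.
Proof. by rewrite /derived /gcomm mul0r expr0z mul1r. Qed.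

Lemma vert_op_agree U X X' : agree U X X' -> op_agree U (vert X) (vert X').
Proof.
move=> XX' V k w oV VU fw x Vx; apply/funext => s.
by apply: vert_agree; apply: XX'; exact: VU.
Qed.

Lemma op_agree_refl U (D : operator A) : op_agree U D D.
Proof. by move=> V k w oV VU fw x Vx. Qed.

Lemma derived_agree U X X' Y Y' : open U ->
  Lreg U X -> Lreg U X' -> Lreg U Y -> Lreg U Y' ->
  op_agree U (vert X) (vert X') -> op_agree U (vert Y) (vert Y') ->
  op_agree U (derived X Y) (derived X' Y').
Proof.
move=> oU rX rX' rY rY' XX' YY'; have dQ := Q_der U.
have dv Z (rZ : Lreg U Z) := vert_derivation vN oU rZ.
apply: gcomm_agree YY'; try exact: dv; try exact: adQ_der.
by apply: gcomm_agree XX' => //; try exact: dv; exact: op_agree_refl.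
Qed.

Lemma adQ_lin U (a : K) X X' V k w : open U -> Lreg U X -> Lreg U X' ->
  open V -> V `<=` U -> fun_deg V k w ->
  agree V (adQ (fun x => a *: X x + X' x) V w)
    (fun x s => a * adQ X V w x s + adQ X' V w x s).
Proof.
move=> oU rX rX' oV VU fw x Vx; apply/funext => s; rewrite !adQE.
have dX := vert_derivation vN oU rX; have dX' := vert_derivation vN oU rX'.
have lin v l : fun_deg V l v -> agree V (vert (fun x => a *: X x + X' x) V v)
    (fun x s => a * vert X V v x s + vert X' V v x s).
  move=> /fun_degP[gv _ _] y Vy; apply/funext => t.
  by apply: (vert_linl vN X X' V (fun=> a)); exact: gv.
have fX := der_deg dX oV VU fw; have fX' := der_deg dX' oV VU fw.
have fl := fun_deg_combine a fX fX'.
have fQ := der_deg (Q_der U) oV VU fw.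
rewrite (lin _ _ fQ x Vx).
have e : agree V (fun x s => a * vert X V w x s + vert X' V w x s)
    (vert (fun x => a *: X x + X' x) V w).
  by move=> y Vy; rewrite (lin _ _ fw y Vy).
rewrite -(der_agree (Q_der U) oV VU fl e Vx).
rewrite (der_linear (Q_der U) a oV VU fX fX' Vx).
by ring.
Qed.

Lemma adQ_fconst U X V f x : open U -> Lreg U X -> open V -> V `<=` U ->
  functions V f -> V x ->
  adQ X V (fconst f) x [::] = Q A V (fconst f) x [:: hv (Lproj (X x))].
Proof.
move=> oU rX oV VU ff Vx; rewrite adQE.
have dX := vert_derivation vN oU rX.
have f0 := fun_deg_fconst A ff.
rewrite (der_agree (Q_der U) oV VU (der_deg dX oV VU f0) (der_fconst dX oV VU ff) Vx).
rewrite (der0 (Q_der U) oV VU Vx) add0r.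
(* On the empty sequence the sum in [vert] has only the term of index 0, where X enters through its
   component in E_{-1}. *)
by rewrite /vert big_ord1.
Qed.

Lemma adQ_fscale U X V f k w : open U -> Lreg U X -> open V -> V `<=` U ->
  functions V f -> fun_deg V k w ->
  agree V (adQ X V (fun x s => f x * w x s))
    (fun x s => adQ X V (fconst f) x [::] * w x s + f x * adQ X V w x s).
Proof.
move=> oU rX oV VU ff fw x Vx; apply/funext => s.
have dX := adQ_der oU rX; have f0 := fun_deg_fconst A ff.
have e : agree V (fun x s => f x * w x s) (fmul (fconst f) w).
  by move=> y _; apply/funext => t; rewrite fmul_fconst.
rewrite (der_agree dX oV VU (fun_degZ ff fw) e Vx).
rewrite (congr1 (@^~ s) (der_leibniz dX oV VU f0 fw Vx)).
rewrite mul0r expr0z mul1r fmul_fconst; congr (_ + _).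
(* [adQ X] has degree 0, so it maps a function to a function, read off on the empty sequence. *)
have fd := der_deg dX oV VU f0.
by rewrite /fmul (fun_deg0E fd Vx); exact: sh_unitl.
Qed.

(* [Q, [Q, X]] = 0 since Q squares to zero. *)
Lemma Q_adQ U X : open U -> Lreg U X ->
  op_agree U (gcomm 1 0 (Q A) (adQ X)) (fun _ _ _ _ => 0).
Proof.
move=> oU rX V k w oV VU fw x Vx; apply/funext => s.
have dX := vert_derivation vN oU rX; have dQ := Q_der U.
have fX := der_deg dX oV VU fw; have fQ := der_deg dQ oV VU fw.
have Q2 v l : fun_deg V l v -> agree V (Q A V (Q A V v)) (fun _ _ => 0).
  by move=> fv; exact: (Q_square oV fv).
rewrite /gcomm mulr0 expr0z mul1r adQE.
have e : agree V (fun x s => Q A V (vert X V w) x s + 1 * vert X V (Q A V w) x s) (adQ X V w).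
  by move=> y _; apply/funext => t; rewrite adQE mul1r.
have f1 := der_deg dQ oV VU fX; have f2 := der_deg dX oV VU fQ.
rewrite [k + 1 - 1]addrAC in f2.
have f12 : fun_deg V (k - 1 + 1) (fun x s => Q A V (vert X V w) x s + 1 * vert X V (Q A V w) x s).
  apply: fun_deg_agree (fun_deg_combine 1 f2 f1) => y _.
  by apply/funext => t; rewrite addrC.
rewrite -(der_agree dQ oV VU f12 e Vx) (derDZ dQ 1 oV VU f1 f2 Vx).
rewrite (Q2 _ _ fX x Vx) add0r mul1r.
have fQQ := der_deg dQ oV VU fQ.
rewrite (der_agree dX oV VU fQQ (Q2 _ _ fw) Vx) (der0 dX oV VU Vx).
by rewrite addr0 subrr.
Qed.

(** The hypotheses stand under the existential, so that choice defines the bracket on all families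
    and constrains it on regular ones. *)
Lemma bracket_exists U X Y : exists Z, open U -> Lreg U X -> Lreg U Y ->
  Lreg U Z /\ op_agree U (vert Z) (derived X Y).
Proof.
have [[oU rX rY]|no] := pselect [/\ open U, Lreg U X & Lreg U Y]; last first.
  by exists (fun=> 0) => oU rX rY; case: no.
by have [Z HZ] := derivation_represent vN oU (derived_der oU rX rY); exists Z.
Qed.

Definition bracket U X Y : forall x : M, L A x := sval (cid (bracket_exists U X Y)).
Arguments bracket : clear implicits.

Lemma bracketP U X Y : open U -> Lreg U X -> Lreg U Y ->
  Lreg U (bracket U X Y) /\ op_agree U (vert (bracket U X Y)) (derived X Y).
Proof. by rewrite /bracket; case: cid. Qed.

Lemma bracket_op U X Y V k w x : open U -> Lreg U X -> Lreg U Y ->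
  open V -> V `<=` U -> fun_deg V k w -> V x ->
  vert (bracket U X Y) V w x = derived X Y V w x.
Proof.
by move=> oU rX rY oV VU fw Vx; have [_ H] := bracketP oU rX rY; exact: H fw x Vx.
Qed.

Lemma Lreg_lin U f X X' : open U -> functions U f -> Lreg U X -> Lreg U X' ->
  Lreg U (fun x => f x *: X x + X' x).
Proof.
move=> oU ff rX rX' V s i oV VU rs.
have ffV : functions V f by exact: functions_sub ff.
exact: (reg_lin oV ffV (rX V s i oV VU rs) (rX' V s i oV VU rs)).
Qed.

Lemma LregZ U f X : open U -> functions U f -> Lreg U X ->
  Lreg U (fun x => f x *: X x).
Proof.
move=> oU ff rX V s i oV VU rs.
have ffV : functions V f by exact: functions_sub ff.
exact: (regZ oV ffV (rX V s i oV VU rs)).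
Qed.

Lemma vertZ X V (f : M -> K) w x s : gsym (w x) ->
  vert (fun x => f x *: X x) V w x s = f x * vert X V w x s.
Proof.
move=> gw; have v0 : vert (fun x => 0 : L A x) V w x s = 0.
  have := vert_linl vN (fun x => 0 : L A x) (fun x => 0) V (fun=> -1) s gw.
  rewrite mulN1r addNr => <-; apply: vert_agree.
  by rewrite scaler0 addr0.
rewrite -[RHS]addr0 -v0 -(vert_linl vN) //; apply: vert_agree.
by rewrite addr0.
Qed.

(** By injectivity of [vert] the claim concerns operators, and [derived] does not mention the open
    set: only its representing section was chosen over U. *)
Lemma bracket_restrict U V X X' Y Y' : open U -> open V -> V `<=` U ->
  Lreg U X -> Lreg U Y -> Lreg V X' -> Lreg V Y' ->
  agree V X X' -> agree V Y Y' ->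
  agree V (bracket U X Y) (bracket V X' Y').
Proof.
move=> oU oV VU rX rY rX' rY' XX' YY'; apply: (vert_inj vN oV).
apply: op_agree_trans (op_agree_sub VU (proj2 (bracketP oU rX rY))) _.
apply: op_agree_trans _ (op_agree_sym (proj2 (bracketP oV rX' rY'))).
have rXV := Lreg_sub VU rX; have rYV := Lreg_sub VU rY.
by apply: derived_agree => //; exact: vert_op_agree.
Qed.

Lemma bracket_linearl U (a : K) X X' Y : open U ->
  Lreg U X -> Lreg U X' -> Lreg U Y ->
  agree U (bracket U (fun x => a *: X x + X' x) Y)
    (fun x => a *: bracket U X Y x + bracket U X' Y x).
Proof.
move=> oU rX rX' rY; have rl := Lreg_lin oU (functions_cst U a) rX rX'.
apply: (vert_inj vN oU) => V k w oV VU fw x Vx; apply/funext => s.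
have /fun_degP[gw _ _] := fw.
rewrite (vert_linl vN _ _ V (fun=> a) s (gw x Vx)).
rewrite !(bracket_op _ _ _ oV VU fw Vx) // !derivedE.
have dY := vert_derivation vN oU rY; have fY := der_deg dY oV VU fw.
have dX := adQ_der oU rX; have dX' := adQ_der oU rX'; have dl := adQ_der oU rl.
rewrite (adQ_lin a oU rX rX' oV VU fY Vx).
rewrite (der_agree dY oV VU (der_deg dl oV VU fw) (adQ_lin a oU rX rX' oV VU fw) Vx).
rewrite (der_linear dY a oV VU (der_deg dX oV VU fw) (der_deg dX' oV VU fw) Vx).
by ring.
Qed.

Lemma bracket_linearr U (a : K) X Y Y' : open U ->
  Lreg U X -> Lreg U Y -> Lreg U Y' ->
  agree U (bracket U X (fun x => a *: Y x + Y' x))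
    (fun x => a *: bracket U X Y x + bracket U X Y' x).
Proof.
move=> oU rX rY rY'; have rl := Lreg_lin oU (functions_cst U a) rY rY'.
apply: (vert_inj vN oU) => V k w oV VU fw x Vx; apply/funext => s.
have /fun_degP[gw _ _] := fw.
rewrite (vert_linl vN _ _ V (fun=> a) s (gw x Vx)).
rewrite !(bracket_op _ _ _ oV VU fw Vx) // !derivedE.
have dX := adQ_der oU rX.
have fY := der_deg (vert_derivation vN oU rY) oV VU fw.
have fY' := der_deg (vert_derivation vN oU rY') oV VU fw.
have /fun_degP[gX _ _] := der_deg dX oV VU fw.
have e : agree V (vert (fun x => a *: Y x + Y' x) V w)
    (fun x s => a * vert Y V w x s + vert Y' V w x s).
  move=> y Vy; apply/funext => t.
  by apply: (vert_linl vN _ _ V (fun=> a)); exact: gw.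
rewrite (der_agree dX oV VU (der_deg (vert_derivation vN oU rl) oV VU fw) e Vx).
rewrite (der_linear dX a oV VU fY fY' Vx).
rewrite (vert_linl vN _ _ V (fun=> a) s (gX x Vx)).
by ring.
Qed.

(** For D = [Q, X], of degree 0, [D, f Y] = D(f) Y + f [D, Y]; the function D(f) is [eta]. *)
Lemma bracket_function U f X Y (eta : M -> K) : open U -> functions U f ->
  Lreg U X -> Lreg U Y ->
  (forall x, U x -> Q A U (fconst f) x [:: hv (Lproj (X x))] = eta x) ->
  agree U (bracket U X (fun x => f x *: Y x))
    (fun x => f x *: bracket U X Y x + eta x *: Y x).
Proof.
move=> oU ff rX rY etaE; have rfY := LregZ oU ff rY.
apply: (vert_inj vN oU) => V k w oV VU fw x Vx; apply/funext => s.
have /fun_degP[gw _ _] := fw.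
have ffV : functions V f by exact: functions_sub ff.
rewrite (vert_linl vN _ _ V f s (gw x Vx)) (vertZ _ _ _ _ (gw x Vx)).
rewrite !(bracket_op _ _ _ oV VU fw Vx) // !derivedE.
have dX := adQ_der oU rX; have dY := vert_derivation vN oU rY.
have fY := der_deg dY oV VU fw.
have /fun_degP[gX _ _] := der_deg dX oV VU fw.
have e : agree V (vert (fun x => f x *: Y x) V w) (fun x s => f x * vert Y V w x s).
  by move=> y Vy; apply/funext => t; apply: vertZ; exact: gw.
rewrite (der_agree dX oV VU (der_deg (vert_derivation vN oU rfY) oV VU fw) e Vx).
rewrite (adQ_fscale oU rX oV VU ffV fY Vx) (vertZ _ _ _ _ (gX x Vx)).
rewrite (adQ_fconst oU rX oV VU ffV Vx).
(* The hypothesis on [eta] concerns [Q] over U, the computation [Q] over V; locality compares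
   them. *)
rewrite -(der_restrict_id (Q_der U) oU oV VU (@subset_refl _ U) (fun_deg_fconst A ff) Vx).
by rewrite etaE ?mulrBr; [ring|exact: VU].
Qed.

(** With D = [Q, X], the Jacobi identity reads [Q, [D, Y]] = [[Q, D], Y] + [D, [Q, Y]], and [Q, D] =
    0. *)
Lemma adQ_bracket U X Y : open U -> Lreg U X -> Lreg U Y ->
  op_agree U (adQ (bracket U X Y)) (gcomm 0 0 (adQ X) (adQ Y)).
Proof.
move=> oU rX rY; have [rZ Zop] := bracketP oU rX rY.
have dQ := Q_der U; have dX := adQ_der oU rX.
have dY := vert_derivation vN oU rY; have dZ := vert_derivation vN oU rZ.
have dXY := derived_der oU rX rY.
apply: (op_agree_trans (D' := gcomm 1 (0 + -1) (Q A) (derived X Y))).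
  by apply: gcomm_agree Zop => //; exact: op_agree_refl.
move=> V k w oV VU fw x Vx; apply/funext => s.
rewrite (jacobi s dQ dX dY oV VU fw Vx).
have dG := gcomm_derivation dQ dX; have G0 := Q_adQ oU rX.
rewrite {1}/gcomm (G0 V _ _ oV VU (der_deg dY oV VU fw) x Vx).
rewrite (der_agree dY oV VU (der_deg dG oV VU fw) (G0 V _ _ oV VU fw) Vx).
rewrite (der0 dY oV VU Vx) mulr0 subr0 add0r.
by rewrite mulr0 /zsign expr0z mul1r.
Qed.

(** In the Jacobi identity for [Q, X], [Q, Y] and Z the first two entries have degree 0, so no sign
    appears; [adQ_bracket] recognises [[Q, X], [Q, Y]] as [Q, [X, Y]_L]. *)
Lemma bracket_leibniz U X Y Z : open U -> Lreg U X -> Lreg U Y -> Lreg U Z ->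
  agree U (bracket U X (bracket U Y Z))
    (fun x => bracket U (bracket U X Y) Z x + bracket U Y (bracket U X Z) x).
Proof.
move=> oU rX rY rZ.
have [rXY _] := bracketP oU rX rY; have [rYZ YZop] := bracketP oU rY rZ.
have [rXZ XZop] := bracketP oU rX rZ.
have dX := adQ_der oU rX; have dY := adQ_der oU rY; have dZ := vert_derivation vN oU rZ.
apply: (vert_inj vN oU) => V k w oV VU fw x Vx; apply/funext => s.
have /fun_degP[gw _ _] := fw.
have -> : vert (fun x => bracket U (bracket U X Y) Z x + bracket U Y (bracket U X Z) x) V w x s
   = vert (bracket U (bracket U X Y) Z) V w x s + vert (bracket U Y (bracket U X Z)) V w x s.
  rewrite -[X in X + _]mul1r -(vert_linl vN _ _ V (fun=> 1)) //; last exact: gw.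
  by apply: vert_agree; rewrite scale1r.
rewrite !(bracket_op _ _ _ oV VU fw Vx) //.
(* The nested brackets are known only through operators agreeing with their fields over U, so they
   are replaced under the commutator by congruence. *)
have cong (D D' : operator A) (T T' : operator A) : is_derivation U 0 D ->
    is_derivation U 0 D' -> is_derivation U (-1) T -> is_derivation U (-1) T' ->
    op_agree U D D' -> op_agree U T T' ->
    gcomm 0 (-1) D T V w x s = gcomm 0 (-1) D' T' V w x s.
  by move=> dD dD' dT dT' a1 a2; rewrite (gcomm_agree dD dD' dT dT' a1 a2 oV VU fw Vx).
have refl := @op_agree_refl U.
have dYZ := derived_der oU rY rZ; have dXZ := derived_der oU rX rZ.
rewrite [LHS](cong _ _ _ _ dX dX (vert_derivation vN oU rYZ) dYZ (refl _) YZop).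
rewrite [X in _ + X](cong _ _ _ _ dY dY (vert_derivation vN oU rXZ) dXZ (refl _) XZop).
rewrite [X in X + _](cong _ _ _ _ (adQ_der oU rXY) (gcomm_derivation dX dY) dZ dZ
  (adQ_bracket oU rX rY) (refl _)).
rewrite [LHS](jacobi s dX dY dZ oV VU fw Vx).
by rewrite /zsign mul0r expr0z mul1r.
Qed.

End DerivedBracket.

Theorem proposition2p3p10 (R : realType) (c : funclass) (M : manifold R c)
    (D : set M -> (forall x : M, tangent x) -> Prop)
    (A : lie_infty_algebroid M)
    (rho : forall x : M, A 0%N x -> tangent x)
    (d : forall (i : nat) (x : M), A i.+1 x -> A i x)
    (hD : hermann_foliation D)
    (hrho : is_anchor rho)
    (hd : is_linear_part d)
    (huniv : is_universal D rho d)
    (hfin : finite_length A) :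
  (forall (U : set M) (X : forall x : M, L A x), open U -> Lreg U X ->
     is_derivation U (-1) (vert X) /\ is_vertical U (vert X)) /\
  exists br : set M -> (forall x : M, L A x) -> (forall x : M, L A x) ->
              forall x : M, L A x,
    is_leibniz_algebroid (@Lreg R c M A) (fun x X => rho x (Lproj X)) br /\
    forall (U : set M) (X Y Z : forall x : M, L A x), open U ->
      Lreg U X -> Lreg U Y -> Lreg U Z ->
      (agree U (br U X Y) Z <->
       op_agree U (vert Z)
         (gcomm 0 (-1) (gcomm 1 (-1) (Q A) (vert X)) (vert Y))).
Proof.
have [N vN] := hfin; have [[rho_lin rho_reg] rhoE] := hrho.
split.
  move=> U X oU rX; split; first exact: (vert_derivation vN oU rX).
  exact: (vert_vertical vN).
exists (bracket vN); split; last first.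
  move=> U X Y Z oU rX rY rZ; have [_ brop] := bracketP vN oU rX rY; split.
    by move=> brZ; apply: op_agree_trans _ brop; apply: vert_op_agree => x /brZ.
  move=> H; apply: (vert_inj vN oU).
  by apply: op_agree_trans brop _; exact: op_agree_sym.
split.
- exact: Lreg_vbundle vN.
- split=> [x a l l'|U X oU rX]; first exact: (rho_lin x a (Lproj l) (Lproj l')).
  apply: (rho_reg U (fun x => Lproj (X x)) oU).
  (* The projection is the value on the empty sequence at index 0, an instance of the definition of
     [Lreg]. *)
  exact: (rX U [::] 0%N oU (@subset_refl _ U) (List.Forall_nil _)).
- by move=> U X Y oU rX rY; have [] := bracketP vN oU rX rY.
- exact: bracket_restrict.
- exact: bracket_linearl.
- exact: bracket_linearr.
- exact: bracket_leibniz.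
- move=> U f X Y oU ff rX rY; apply: bracket_function => // x Ux.
  exact: rhoE.
Qed.
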